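(* Let $G$ be an $m$-dimensional complex Lie group with identity element $e$ and holomorphic Lie algebra $\mathfrak g=T^{1,0}_eG$, and let $\Omega$ be a domain in $G$. Fix a basis $\varepsilon=(\varepsilon_1,\dots,\varepsilon_m)$ of $\mathfrak g$. Let $N$ be a compact Hermitian manifold and let $\mathscr F$ be a family of holomorphic mappings from $\Omega$ to $N$. Then $\mathscr F$ is not normal on $\Omega$ if and only if there exist (a) a sequence $\{f_j\}_{j=1}^{+\infty}\subset\mathscr F$; (b) a sequence $\{p_j\}_{j=1}^{+\infty}\subset\Omega$ with $p_j\to p_0\in\Omega$ as $j\to+\infty$; (c) a sequence $\{\rho_j\}_{j=1}^{+\infty}\subset\mathbb R$ with $0<\rho_j\to 0$ as $j\to+\infty$ such that the sequence $$\phi_j(z):=f_j\circ\exp_{p_j}\big(\rho_j\,(dL_{p_j})_e(\varepsilon z^T)\big),\qquad j=1,2,\dots$$ converges uniformly on compact subsets of $\mathbb C^m$ to a nonconstant holomorphic mapping $\phi:\mathbb C^m\to N$. Here $z^T$ is the transpose of $z=(z_1,\dots,z_m)$, so that $\varepsilon z^T=\sum_{k=1}^m z_k\varepsilon_k\in\mathfrak g$.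
   Context: A complex Lie group $G$ is a complex manifold with a group structure whose multiplication and inversion are holomorphic. $T^{1,0}_gG$ denotes the holomorphic tangent space of $G$ at $g$. For $g\in G$, $L_g:G\to G$, $L_g(h)=gh$, is the left translation, and $(dL_g)_h:T^{1,0}_hG\to T^{1,0}_{gh}G$ is its differential at $h$. Exponential mapping at $g$: each $\xi\in T^{1,0}_gG$ generates a unique left-invariant holomorphic vector field $\tilde\xi$ on $G$, $\tilde\xi_h=(dL_{hg^{-1}})_g(\xi)$, with $\tilde\xi_g=\xi$. Let $\gamma_\xi:\mathbb C\to G$ be the unique holomorphic curve with $\gamma_\xi'=\tilde\xi_{\gamma_\xi}$ and $\gamma_\xi(0)=g$. Then $\exp_g:T^{1,0}_gG\to G$ is defined by $\exp_g(\xi)=\gamma_\xi(1)$; it is holomorphic. Normality: for complex manifolds $M,N$, let $\mathscr C(M,N)$ be the set of continuous mappings $M\to N$ with the compact-open topology. A family $\mathscr F\subset\mathscr C(M,N)$ is normal (on $M$) if each sequence in $\mathscr F$ contains a subsequence which is either relatively compact in $\mathscr C(M,N)$ or compactly divergent. Convergence: $\phi_j$ is defined at those $z\in\mathbb C^m$ for which $\exp_{p_j}(\rho_j(dL_{p_j})_e(\varepsilon z^T))\in\Omega$; uniform convergence on compact subsets of $\mathbb C^m$ means that for every compact $K\subset\mathbb C^m$, $\phi_j$ is defined on $K$ for all sufficiently large $j$ and $\phi_j\to\phi$ uniformly on $K$ (with respect to a distance function on $N$). *)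

(* Defs.v *)
From HB Require Import structures.
From mathcomp Require Import all_boot all_order all_algebra.
From mathcomp Require Import all_classical all_reals all_analysis.
From mathcomp Require Export complex.

Set Implicit Arguments.
Unset Strict Implicit.
Unset Printing Implicit Defensive.

Import Order.TTheory GRing.Theory Num.Theory.
Import numFieldNormedType.Exports.

Local Open Scope classical_set_scope.
Local Open Scope ring_scope.
Local Open Scope complex_scope.

HB.instance Definition _ (R : realType) := NormedModule.copy R[i] R[i]^o.

(* A chart is given as raw data; the requirement that it be a homeomorphism
   from an open set onto an open set is [is_chart].  Values of [coord] outside
   [dom] are irrelevant. *)
Record chart (M E : Type) := Chart { dom : set M ; coord : M -> E }.

Section Charts.
Context {R : realType}.
Implicit Types E : normedModType R[i].

Definition is_chart (M : topologicalType) E (c : chart M E) :=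
  [/\ open (dom c),
      {in dom c &, injective (coord c)},
      forall p, dom c p -> {for p, continuous (coord c)} &
      forall V, open V -> V `<=` dom c -> open (coord c @` V)].

(* [in_chart c g] is g o c^-1 on c(dom c), extended by 0. *)
Definition in_chart (M : Type) E (E' : nmodType) (c : chart M E) (g : M -> E') :
    E -> E' :=
  fun u => xget 0 [set g p | p in [set p | dom c p /\ coord c p = u]].

(* Differentiability is over R[i], i.e. complex differentiability. *)
Definition holo_compatible (M : Type) E (c c' : chart M E) :=
  forall p, dom c p -> dom c' p ->
    differentiable (in_chart c (coord c')) (coord c p).

Definition holomorphic (M N : topologicalType) E E'
    (A : set (chart M E)) (B : set (chart N E')) (f : M -> N) :=
  continuous f /\
  forall a b p, A a -> B b -> dom a p -> dom b (f p) ->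
    differentiable (in_chart a (coord b \o f)) (coord a p).

Definition id_atlas E : set (chart E E) := [set Chart setT id].

Definition prod_atlas (M N : Type) E E'
    (A : set (chart M E)) (B : set (chart N E')) :
    set (chart (M * N) (E * E')%type) :=
  [set c | exists a b, [/\ A a, B b &
     c = Chart (dom a `*` dom b) (fun p => (coord a p.1, coord b p.2))]].

Definition sub_atlas (M : Type) E (U : set M) (A : set (chart M E)) :
    set (chart (set_type U) E) :=
  [set Chart (set_val @^-1` dom a) (coord a \o set_val) | a in A].

End Charts.

Arguments id_atlas {R} E.
Arguments sub_atlas {R M E} U A.

Lemma near_eq_diff (K : numFieldType) (V W : normedModType K) (f g : V -> W) x :
  (\forall y \near x, f y = g y) -> differentiable f x ->
  differentiable g x /\ 'd g x = 'd f x :> (V -> W).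
Proof.
move=> fg df.
have dfc := diff_continuous df.
have key : g \o shift x = cst (g x) + 'd f x +o_ 0 id.
  have /eqaddoP H := diff_locally df.
  have fg0 : \forall y \near (0:V), f (y + x) = g (y + x).
    by move: fg; rewrite (near_shift 0 x); apply: filterS => y;
    rewrite /= subr0.
  apply/eqaddoP => e e0; apply: filterS2 fg0 (H e e0) => y /= fgy.
  by rewrite /= !fctE /= fgy (nbhs_singleton fg).
have E := diff_unique dfc key.
split; last exact: E.
by apply/diff_locallyP; split; rewrite E; [exact: dfc|exact: key].
Qed.

HB.mixin Record isComplexManifold (R : realType) (n : nat) M
    of Topological M := {
  atlas : set (chart M 'rV[R[i]]_n) ;
  atlas_chart : forall c, atlas c -> is_chart c ;
  atlas_cover : forall p, exists c, atlas c /\ dom c p ;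
  atlas_compat : forall c c', atlas c -> atlas c' -> holo_compatible c c' ;
  manifold_hausdorff : hausdorff_space M ;
  manifold_second_countable : @second_countable M
}.

#[short(type="complexManifoldType")]
HB.structure Definition ComplexManifold (R : realType) (n : nat) :=
  {M of Topological M & isComplexManifold R n M}.

Section TangentSpace.
Context {R : realType} {n : nat} {M : complexManifoldType R n}.

Definition chart_around (p : M) (c : chart M 'rV[R[i]]_n) :=
  atlas c /\ dom c p.

(* A holomorphic tangent vector at p is the family of its component vectors
   in the charts around p, transforming by the differentials of the holomorphic
   coordinate changes; the components in the other charts are set to 0. *)
Definition is_tangent (p : M) (v : chart M 'rV[R[i]]_n -> 'rV[R[i]]_n) :=
  (forall c, ~ chart_around p c -> v c = 0) /\
  (forall c c', chart_around p c -> chart_around p c' ->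
     v c' = 'd (in_chart c (coord c')) (coord c p) (v c)).

Definition tangent_pred (p : M) : {pred chart M 'rV[R[i]]_n -> 'rV[R[i]]_n} :=
  fun v => `[< is_tangent p v >].

Lemma tangent_pred_closed (p : M) : submod_closed (tangent_pred p).
Proof.
split; first by apply/asboolP; split => // c c' _ _; rewrite linear0.
move=> a u v /asboolP[u0 uE] /asboolP[v0 vE]; apply/asboolP; split.
  by move=> c pc; rewrite !fctE u0// v0// scaler0 addr0.
by move=> c c' pc pc'; rewrite !fctE (uE c c')// (vE c c')// linearP.
Qed.

HB.instance Definition _ (p : M) :=
  GRing.isSubmodClosed.Build R[i] (chart M 'rV[R[i]]_n -> 'rV[R[i]]_n)
    (tangent_pred p) (tangent_pred_closed p).

Record tangent (p : M) := Tangent {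
  components :> chart M 'rV[R[i]]_n -> 'rV[R[i]]_n ;
  _ : components \in tangent_pred p }.

HB.instance Definition _ (p : M) := [isSub for @components p].
HB.instance Definition _ (p : M) := [Choice of tangent p by <:].
HB.instance Definition _ (p : M) :=
  [SubChoice_isSubLmodule of tangent p by <:].

(* The tangent vector at p with component vector a in the chart c around p. *)
Definition tangent_of (c : chart M 'rV[R[i]]_n) (p : M) (a : 'rV[R[i]]_n) :
    tangent p :=
  insubd 0 (fun c' => if `[< chart_around p c' >]
                      then 'd (in_chart c (coord c')) (coord c p) a else 0).

Lemma in_chartE (c : chart M 'rV[R[i]]_n) (E' : nmodType) (g : M -> E') p :
  chart_around p c -> in_chart c g (coord c p) = g p.
Proof.
move=> [Ac cp]; have [_ inj _ _] := atlas_chart _ Ac.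
rewrite /in_chart; case: xgetP => [y _ [q [cq e] <-]|/(_ (g p))[]];
  last by exists p.
by congr g; apply: inj => //; rewrite inE.
Qed.

Lemma transition_diff (c c' c'' : chart M 'rV[R[i]]_n) (p : M) :
  chart_around p c -> chart_around p c' -> chart_around p c'' ->
  'd (in_chart c (coord c'')) (coord c p) =
  'd (in_chart c' (coord c'')) (coord c' p) \o
  'd (in_chart c (coord c')) (coord c p) :> (_ -> _).
Proof.
move=> pc pc' pc''.
have d1 : differentiable (in_chart c (coord c')) (coord c p).
  by exact: (atlas_compat _ _ pc.1 pc'.1 _ pc.2 pc'.2).
have E : in_chart c (coord c') (coord c p) = coord c' p by exact: in_chartE.
have d2' := atlas_compat _ _ pc'.1 pc''.1 _ pc'.2 pc''.2.
have d2 : differentiable (in_chart c' (coord c''))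
    (in_chart c (coord c') (coord c p)).
  rewrite E; exact: d2'.
rewrite -[X in 'd _ X \o _]E.
rewrite -(diff_comp d1 d2).
have dd := differentiable_comp d1 d2.
refine (near_eq_diff _ dd).2.
have [oc _ _ op] := atlas_chart _ pc.1.
have [oc' _ _ _] := atlas_chart _ pc'.1.
have : nbhs (coord c p) (coord c @` (dom c `&` dom c')).
  apply: open_nbhs_nbhs; split.
  - by apply: op; [exact: openI|move=> ? []].
  - by exists p => //; split; [case: pc|case: pc'].
apply: filterS => _ [q [cq c'q] <-].
have qc : chart_around q c by split => //; exact: pc.1.
have qc' : chart_around q c' by split => //; exact: pc'.1.
by rewrite /comp !(in_chartE _ qc) (in_chartE _ qc').
Qed.

Lemma tangent_ofE c (p : M) (a : 'rV[R[i]]_n) c' :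
  chart_around p c -> chart_around p c' ->
  tangent_of c p a c' = 'd (in_chart c (coord c')) (coord c p) a.
Proof.
move=> pc pc'; rewrite /tangent_of -[components _]/(val _) insubdK; last first.
  apply/asboolP; split=> [c0 c0p|c0 c1 p0 p1]; first by rewrite asboolF.
  rewrite (asboolT p0) (asboolT p1).
  exact: (congr1 (fun f => f a) (transition_diff pc p0 p1)).
by rewrite asboolT.
Qed.

Lemma tangent_ofK c (p : M) (a : 'rV[R[i]]_n) :
  chart_around p c -> tangent_of c p a c = a.
Proof.
move=> pc; rewrite (tangent_ofE _ pc pc).
have cc : \forall y \near coord c p, id y = in_chart c (coord c) y.
  have [oc _ _ op] := atlas_chart _ pc.1.
  have : nbhs (coord c p) (coord c @` dom c).
    by apply: open_nbhs_nbhs; split; [exact: op|exists p => //; exact: pc.2].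
  apply: filterS => _ [q cq <-].
  have qc : chart_around q c by split => //; exact: pc.1.
  by rewrite (in_chartE _ qc).
have did := @ex_diff _ _ _ _ _ _ _ (is_diff_id (coord c p)).
have E := @diff_val _ _ _ _ _ _ _ (is_diff_id (coord c p)).
by rewrite (near_eq_diff cc did).2 E.
Qed.

Lemma exists_chart_around (p : M) : exists c, chart_around p c.
Proof. exact: atlas_cover. Qed.

Definition chart_at (p : M) := projT1 (cid (exists_chart_around p)).

End TangentSpace.

Arguments tangent {R n M} p.

Definition differential (R : realType) (m n : nat)
    (M : complexManifoldType R m) (N : complexManifoldType R n)
    (f : M -> N) (p : M) (v : tangent p) : tangent (f p) :=
  let c := chart_at p in let c' := chart_at (f p) in
  tangent_of c' (f p) ('d (in_chart c (coord c' \o f)) (coord c p) (v c)).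

(* The holomorphic derivative g'(t) of a curve g : C -> M. *)
Definition velocity (R : realType) (n : nat) (M : complexManifoldType R n)
    (g : R[i] -> M) (t : R[i]) : tangent (g t) :=
  let c := chart_at (g t) in tangent_of c (g t) ('D_1 (coord c \o g) t).

HB.mixin Record isComplexLieGroup (R : realType) (m : nat) G
    of ComplexManifold R m G & Group G := {
  mulg_holomorphic :
    holomorphic (prod_atlas (@atlas R m G) (@atlas R m G)) (@atlas R m G)
      (fun p : G * G => (p.1 * p.2)%g) ;
  invg_holomorphic :
    holomorphic (@atlas R m G) (@atlas R m G) (fun x : G => (x^-1)%g)
}.

#[short(type="complexLieGroupType")]
HB.structure Definition ComplexLieGroup (R : realType) (m : nat) :=
  {G of ComplexManifold R m G & Group G & isComplexLieGroup R m G}.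

Section Exponential.
Context {R : realType} {m : nat} {G : complexLieGroupType R m}.

Definition left_translation (g : G) : G -> G := fun h => (g * h)%g.

(* (dL_g)_e, with values in T_g rather than T_{g * 1}. *)
Definition dL_at1 (g : G) (v : tangent (1%g : G)) : tangent g :=
  ecast x (tangent x) (mulg1 g) (differential (left_translation g) v).

Definition left_invariant_field (g : G) (xi : tangent g) (h : G) : tangent h :=
  ecast x (tangent x) (mulgVK g h)
    (differential (left_translation (h * g^-1)%g) xi).

Definition integral_curve (g : G) (xi : tangent g) (gamma : R[i] -> G) :=
  [/\ holomorphic (id_atlas R[i]) (@atlas R m G) gamma,
      gamma 0 = g &
      forall t, velocity gamma t = left_invariant_field xi (gamma t)].

(* The integral curve exists and is unique, so the default value is never
   used. *)
Definition exp_at (g : G) (xi : tangent g) : G :=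
  xget (fun=> g) [set gamma | integral_curve xi gamma] 1.

End Exponential.

Section HermitianMetric.
Context {R : realType}.

Fixpoint Ck_on (k : nat) (V : normedModType R) (U : set V) (f : V -> R) :
    Prop :=
  if k is k'.+1 then
    (forall x, U x -> differentiable f x) /\
    forall v, Ck_on k' U (fun x => 'D_v f x)
  else forall x, U x -> {for x, continuous f}.

Definition realify n (w : 'rV[R]_n * 'rV[R]_n) : 'rV[R[i]]_n :=
  \row_k (w.1 0 k +i* w.2 0 k).

Definition smooth_on n (U : set 'rV[R[i]]_n) (f : 'rV[R[i]]_n -> R[i]) :=
  forall k,
    Ck_on k (@realify n @^-1` U) (fun w => complex.Re (f (realify w))) /\
    Ck_on k (@realify n @^-1` U) (fun w => complex.Im (f (realify w))).

End HermitianMetric.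

HB.mixin Record isHermitian (R : realType) (n : nat) N
    of ComplexManifold R n N := {
  hform : forall p : N, tangent p -> tangent p -> R[i] ;
  hform_linear : forall (p : N) (a : R[i]) (u v w : tangent p),
    hform p (a *: u + v) w = a * hform p u w + hform p v w ;
  hform_conj : forall (p : N) (u v : tangent p),
    hform p v u = ((hform p u v)^*)%C ;
  hform_pos : forall (p : N) (u : tangent p), u != 0 -> 0 < hform p u u ;
  hform_smooth : forall (c : chart N 'rV[R[i]]_n) (a b : 'rV[R[i]]_n),
    atlas c ->
    smooth_on (coord c @` dom c)
      (in_chart c (fun p => hform p (tangent_of c p a) (tangent_of c p b)))
}.

#[short(type="hermitianManifoldType")]
HB.structure Definition HermitianManifold (R : realType) (n : nat) :=
  {N of ComplexManifold R n N & isHermitian R n N}.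

Section Normality.
Context {M N : topologicalType}.

(* C(M, N) with the compact-open topology. *)
Definition cont_space : topologicalType :=
  initial_topology (fun f : continuousType M N => (f : {compact-open, M -> N})).

Definition compactly_divergent (u : nat -> M -> N) :=
  forall (K : set M) (L : set N), compact K -> compact L ->
    \forall j \near \oo, u j @` K `&` L = set0.

Definition relatively_compact (T : topologicalType) (A : set T) :=
  compact (closure A).

Definition normal_family (F : set cont_space) :=
  forall u : nat -> cont_space, (forall j, F (u j)) ->
    exists s : nat -> nat, {homo s : i j / (i < j)%N} /\
      (relatively_compact (range (u \o s)) \/
       compactly_divergent (fun j => (u (s j) : continuousType M N))).

End Normality.
Arguments cont_space : clear implicits.

Section Convergence.
Context {R : realType} {N : topologicalType}.

(* A distance function on N is a metric inducing the topology of N. *)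
Definition is_distance (d : N -> N -> R) :=
  [/\ forall x y, 0 <= d x y /\ (d x y = 0 <-> x = y),
      forall x y, d x y = d y x,
      forall x y z, d x z <= d x y + d y z &
      forall x (A : set N),
        nbhs x A <-> exists2 e, 0 < e & [set y | d x y < e] `<=` A].

(* Partially defined maps are valued in [option N].  Being defined on K for
   all large j is part of the condition. *)
Definition locally_uniform_cvg (T : topologicalType) (d : N -> N -> R)
    (phi_ : nat -> T -> option N) (phi : T -> N) :=
  forall K : set T, compact K -> forall e, 0 < e ->
    \forall j \near \oo, forall z, K z ->
      exists2 y, phi_ j z = Some y & d y (phi z) < e.

End Convergence.

Definition is_domain (T : topologicalType) (U : set T) :=
  [/\ open U, connected U & U !=set0].

Definition lin_comb (K : pzRingType) (V : lmodType K) m (eps : 'I_m -> V)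
    (z : 'rV[K]_m) : V := \sum_(k < m) z 0 k *: eps k.

Definition is_basis (K : pzRingType) (V : lmodType K) m (eps : 'I_m -> V) :=
  (forall z, lin_comb eps z = 0 -> z = 0) /\
  (forall v, exists z, v = lin_comb eps z).

(* Main.v *)
Require Import Defs.
From HB Require Import structures.
From mathcomp Require Import all_boot all_order all_algebra.
From mathcomp Require Import all_classical all_reals all_analysis.
From mathcomp Require Import ring lra.

(** Since [N] is compact, no subsequence is compactly divergent, and by Ascoli's
theorem ([equicontinuous_normal]) a family that is not normal is not
equicontinuous at some point [p0]. Near [p0] the maps are read in a chart [c]
of [G], as maps from a ball of [C^m] to [N].

Rescaling in the chart is Zalcman's lemma ([zalcman]). The failure of
equicontinuity gives oscillations at arbitrarily small scales, and a
point-picking argument ([pick_oscillation]) selects oscillations of a fixed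
size at points [x j] and scales [rho j] around which no oscillation is visible
at half the scale. By Montel's theorem ([montel_modulus]) the rescaled maps
[f j (x j + rho j y)] are equicontinuous on larger and larger balls; their
limit [psi] is entire ([weierstrass_manifold]) and not constant.

To pass from the chart to the group, the exponential mapping at [p] is
identified as [p * ex], where [ex] is a holomorphic exponential at the
identity ([exp_at_lie_exp]). It is constructed by repeated square roots
([squaring_exists]) rather than by solving a differential equation, and
compared with integral curves through their uniqueness
([integral_curve_unique]). A second difference estimate for the
multiplication ([left_product_expansion]) then shows that the point
[exp_(p j) (rho j (dL_(p j))_e (eps z))] has coordinates
[x j + rho j (T z + o(1))], with one linear automorphism [T] for all [j]
([exp_at_expansion], [frame_basis]). Hence the rescalings of the theorem
converge to [phi = psi o T] ([rescaled_cvg]).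

Conversely, suppose the family is normal and rescalings of a sequence [f j]
converge to [phi]. Some subsequence has a cluster point [g] in the
compact-open topology. The rescaled points tend to [p0], so [phi] takes only
the value [g p0] ([rescaled_limit_constant]) and is constant.

The analysis needed (Goursat's theorem and a Cauchy estimate, whence
Lipschitz and second difference bounds for bounded holomorphic maps and
Weierstrass' theorem) is developed for maps on complex normed modules. *)

Set Implicit Arguments.
Unset Strict Implicit.
Unset Printing Implicit Defensive.

Import Order.TTheory GRing.Theory Num.Theory.
Import numFieldNormedType.Exports.

Local Open Scope classical_set_scope.
Local Open Scope ring_scope.
Local Open Scope complex_scope.

(* the coordinate map of a chart, not coordinates with respect to a basis *)
Local Notation coord := Defs.coord.

(** * Complex normed modules with a real-valued norm *)

Section RealNorm.
Context {R : realType}.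
Implicit Types V W : normedModType R[i].

(** Over [R[i]] the norm takes values in [R[i]], which is only partially
ordered; its real part is the norm, and inequalities about it are linear
arithmetic in [R]. *)
Definition nm V (x : V) : R := complex.Re `|x|.

Lemma nmE V (x : V) : `|x| = (nm x)%:C.
Proof. by rewrite /nm RRe_real// ger0_real. Qed.

Lemma nm_ge0 V (x : V) : 0 <= nm x.
Proof. by rewrite -lecR -nmE normr_ge0. Qed.
Hint Resolve nm_ge0 : core.

Lemma nm0 V : nm (0 : V) = 0.
Proof. by rewrite /nm normr0. Qed.

Lemma nm_eq0 V (x : V) : nm x = 0 -> x = 0.
Proof. by move=> x0; apply/eqP; rewrite -normr_eq0 nmE x0. Qed.

Lemma nmD V (x y : V) : nm (x + y) <= nm x + nm y.
Proof. by rewrite -lecR rmorphD/= -!nmE ler_normD. Qed.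

Lemma nmN V (x : V) : nm (- x) = nm x.
Proof. by rewrite /nm normrN. Qed.

Lemma nmBC V (x y : V) : nm (x - y) = nm (y - x).
Proof. by rewrite /nm distrC. Qed.

Lemma nmB V (x y : V) : nm (x - y) <= nm x + nm y.
Proof. by rewrite (le_trans (nmD _ _))// nmN. Qed.

Lemma nm_tri V (y x z : V) : nm (x - z) <= nm (x - y) + nm (y - z).
Proof. by rewrite (le_trans _ (nmD _ _))// subrKA. Qed.

Lemma nm_le_sub V (x y : V) : nm x <= nm (x - y) + nm y.
Proof. by rewrite (le_trans _ (nmD _ _))// subrK. Qed.

Lemma nmZ V (a : R[i]) (x : V) : nm (a *: x) = nm a * nm x.
Proof. by apply: complexI; rewrite rmorphM/= -!nmE normrZ. Qed.

Lemma nmM (a b : R[i]) : nm (a * b) = nm a * nm b.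
Proof. by apply: complexI; rewrite rmorphM/= -!nmE normrM. Qed.

Lemma nmC (a : R) : nm a%:C = `|a|.
Proof. by rewrite /nm normc_def/= expr0n/= addr0 sqrtr_sqr. Qed.

Lemma nmV (a : R[i]) : nm a^-1 = (nm a)^-1.
Proof.
have [->|a0] := eqVneq a 0; first by rewrite invr0 nm0 invr0.
have na : nm a != 0 by apply: contra_neq a0 => /nm_eq0.
by apply: (mulfI na); rewrite -nmM !divff// /nm normr1.
Qed.

Lemma nm_gt0 V (x : V) : x != 0 -> 0 < nm x.
Proof.
by move=> x0; rewrite lt0r nm_ge0 andbT; apply: contra_neq x0 => /nm_eq0.
Qed.

Lemma nm_Re (z : R[i]) : `|complex.Re z| <= nm z.
Proof.
rewrite /nm normc_def/= -sqrtr_sqr ler_wsqrtr// lerDl sqr_ge0//.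
Qed.

Lemma nm_Im (z : R[i]) : `|complex.Im z| <= nm z.
Proof.
rewrite /nm normc_def/= -sqrtr_sqr ler_wsqrtr// lerDr sqr_ge0//.
Qed.

Lemma nm_ReIm (z : R[i]) : nm z <= `|complex.Re z| + `|complex.Im z|.
Proof.
rewrite /nm normc_def/= -[leRHS]ger0_norm ?addr_ge0// -sqrtr_sqr ler_wsqrtr//.
by rewrite sqrrD !real_normK ?num_real// -addrA lerD2l lerDr mulrn_wge0// mulr_ge0.
Qed.

Lemma nm_i : nm (0 +i* 1 : R[i]) = 1.
Proof. by rewrite /nm normc_def/= expr0n expr1n add0r sqrtr1. Qed.

Opaque nm.

Lemma nm_nbhsP V (x : V) (A : set V) :
  nbhs x A <-> exists2 e, 0 < e & forall y, nm (y - x) < e -> A y.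
Proof.
split=> [/nbhs_ballP[e e0 eA]|[e e0 eA]]; last apply/nbhs_ballP.
  have re : e \is Num.real by rewrite gtr0_real.
  move: e0 eA; rewrite /= -(RRe_real re) ltcR => e0 eA.
  exists (complex.Re e) => // y yx; apply: eA.
  by rewrite -ball_normE /ball_/= nmE ltcR nmBC.
exists e%:C => /=; first by rewrite ltcR.
move=> y; rewrite -ball_normE /ball_/= nmE ltcR nmBC; exact: eA.
Qed.

Lemma nm_ball_nbhs V (x : V) e : 0 < e -> nbhs x [set y | nm (y - x) < e].
Proof. by move=> e0; apply/nm_nbhsP; exists e. Qed.

Lemma nm_continuousP V W (f : V -> W) x : {for x, continuous f} <->
  forall e, 0 < e -> exists2 r, 0 < r & forall y, nm (y - x) < r ->
    nm (f y - f x) < e.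
Proof.
split=> [fx e e0|fx A /nm_nbhsP[e e0 eA]].
  have /fx : nbhs (f x) [set z | nm (z - f x) < e].
    by apply/nm_nbhsP; exists e.
  by move/nm_nbhsP.
have [r r0 rf] := fx _ e0.
by apply/nm_nbhsP; exists r => // y /rf/eA.
Qed.

Lemma nm_diff V W (f : V -> W) x : differentiable f x ->
  forall e, 0 < e -> exists2 r, 0 < r & forall y, nm (y - x) < r ->
    nm (f y - f x - 'd f x (y - x)) <= e * nm (y - x).
Proof.
move=> df e e0.
have := diff_locally df => /eqaddoP/(_ e%:C); rewrite ltcR => /(_ e0).
move/nm_nbhsP => [r r0 rf]; exists r => // y yx.
move: (rf (y - x)); rewrite subr0 => /(_ yx) /=.
by rewrite !fctE subrK !nmE -rmorphM/= lecR opprD addrA.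
Qed.

Lemma nm_linear V W (L : {linear V -> W}) : continuous L ->
  exists2 K, 0 < K & forall x, nm (L x) <= K * nm x.
Proof.
move=> cL; have /nm_continuousP/(_ _ ltr01)[r r0 rL] := cL 0.
exists (2 / r); first by rewrite divr_gt0.
move=> x; have [->|x0] := eqVneq x 0; first by rewrite linear0 !nm0 mulr0.
have nx := nm_gt0 x0.
have c0 : 0 < r / 2 / nm x by rewrite !divr_gt0.
have /rL : nm ((r / 2 / nm x)%:C *: x - 0) < r.
  rewrite subr0 nmZ nmC (ger0_norm (ltW c0)).
  by rewrite divfK ?gt_eqF//; lra.
rewrite linear0 subr0 linearZ/= nmZ nmC (ger0_norm (ltW c0)).
by rewrite -ltr_pdivlMl// mulr1 !invf_div [leRHS]mulrC => /ltW.
Qed.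

(** The bound [K] makes the candidate [L] continuous, so that it has to be the
differential by uniqueness. *)
Lemma nm_differentiable V W (f : V -> W) x (L : {linear V -> W}) K :
  (forall h, nm (L h) <= K * nm h) ->
  (forall e, 0 < e -> exists2 r, 0 < r & forall y, nm (y - x) < r ->
    nm (f y - f x - L (y - x)) <= e * nm (y - x)) ->
  differentiable f x /\ 'd f x = L :> (V -> W).
Proof.
move=> LK fL.
have K0 : 0 < `|K| + 1 by rewrite ltr_pwDr.
have cL : continuous L.
  move=> y; apply/nm_continuousP => e e0.
  exists (e / (`|K| + 1)); first by rewrite divr_gt0.
  move=> z zy; rewrite -linearB (le_lt_trans (LK _))//.
  rewrite ltr_pdivlMr// mulrC in zy; apply: le_lt_trans zy.
  by rewrite ler_wpM2r// (le_trans (ler_norm _))// lerDl.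
have key : f \o shift x = cst (f x) + L +o_ 0 id.
  apply/eqaddoP => _ /posnumP[e]; have := [elaborate gt0 e].
  have re : e%:num \is Num.real by rewrite gtr0_real.
  rewrite -(RRe_real re) ltcR => e0.
  have [r r0 rf] := fL _ e0.
  apply/nm_nbhsP; exists r => // y; rewrite subr0 => yr.
  have := rf (y + x); rewrite addrK => /(_ yr).
  by rewrite !fctE !nmE -rmorphM/= lecR opprD addrA.
have E := diff_unique cL key.
by split=> //; apply/diff_locallyP; split; rewrite E.
Qed.

Lemma nm_pair V W (x : V) (y : W) : nm (x, y) = Num.max (nm x) (nm y).
Proof.
apply: complexI; rewrite -nmE prod_normE/= !nmE.
by case: leP => [|/ltW] h; [rewrite max_r// lecR | rewrite max_l// lecR].
Qed.

Lemma nm_row_le n (v : 'rV[R[i]]_n) e : 0 <= e ->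
  (forall i, nm (v 0 i) <= e) -> nm v <= e.
Proof.
move=> e0 ve; rewrite -lecR -nmE.
change (mx_norm v <= e%:C).
have [->|/mx_norm_neq0[[i j] ->/=]] := eqVneq (mx_norm v) 0; first by rewrite lecR.
by rewrite ord1 nmE lecR.
Qed.

Lemma nm_coord n (v : 'rV[R[i]]_n) i : nm (v 0 i) <= nm v.
Proof.
rewrite -lecR -!nmE [leRHS]/Num.norm/= mx_normE -[leLHS]nngE num_le.
exact: (le_bigmax _ (fun ij => `|v ij.1 ij.2|%:nng) (0, i)).
Qed.

End RealNorm.
#[global] Opaque nm.
#[global] Hint Resolve nm_ge0 : core.

(** * Integrals of continuous complex functions on segments *)

Section SegmentIntegral.
Context {R : realType}.
Notation mu := (@lebesgue_measure R).
Implicit Types (a b c d : R) (h : R -> R[i]).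

Definition cont_seg a b h := forall x, a <= x <= b -> {for x, continuous h}.

Definition cint a b h : R[i] :=
  (\int[mu]_(x in `[a, b]) complex.Re (h x))%R +i*
  (\int[mu]_(x in `[a, b]) complex.Im (h x))%R.

Lemma Re_continuous : continuous (@complex.Re R : R[i] -> R).
Proof.
move=> z A /nbhs_ballP[e /= e0 eA]; apply/nm_nbhsP; exists e => // y yz.
apply: eA; rewrite -ball_normE/= -raddfB (le_lt_trans (nm_Re _))//.
by rewrite nmBC.
Qed.

Lemma Im_continuous : continuous (@complex.Im R : R[i] -> R).
Proof.
move=> z A /nbhs_ballP[e /= e0 eA]; apply/nm_nbhsP; exists e => // y yz.
apply: eA; rewrite -ball_normE/= -raddfB (le_lt_trans (nm_Im _))//.
by rewrite nmBC.
Qed.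

Lemma Complex_continuous : continuous (fun p : R * R => p.1 +i* p.2).
Proof.
move=> [a b] A /nm_nbhsP[e e0 eA]; apply/nbhs_ballP.
exists (e / 2) => /=; first by rewrite divr_gt0.
move=> [x y] /= [/= ax by_]; apply: eA.
rewrite (le_lt_trans (nm_ReIm _))//=.
move: ax by_; rewrite -!ball_normE /ball_/= !(distrC _ x) !(distrC _ y); lra.
Qed.

Lemma cont_seg_Re a b h : cont_seg a b h ->
  mu.-integrable `[a, b] (EFin \o (@complex.Re R \o h)).
Proof.
move=> ch; apply: continuous_compact_integrable; first exact: segment_compact.
apply: continuous_in_subspaceT => x; rewrite inE/= in_itv/= => xab.
by apply: continuous_comp; [exact: ch|exact: Re_continuous].
Qed.

Lemma cont_seg_Im a b h : cont_seg a b h ->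
  mu.-integrable `[a, b] (EFin \o (@complex.Im R \o h)).
Proof.
move=> ch; apply: continuous_compact_integrable; first exact: segment_compact.
apply: continuous_in_subspaceT => x; rewrite inE/= in_itv/= => xab.
by apply: continuous_comp; [exact: ch|exact: Im_continuous].
Qed.

Lemma segment_integral_cst a b M : a <= b ->
  (\int[mu]_(x in `[a, b]) M)%R = (b - a) * M.
Proof.
move=> ab; rewrite Rintegral_cst//= lebesgue_measure_itv/= lte_fin mulrC.
rewrite lt_neqAle ab andbT.
by have [->|_] := eqVneq a b; rewrite /= ?subrr ?mul0r.
Qed.

Lemma cint_cst a b z : a <= b -> cint a b (fun=> z) = (b - a)%:C * z.
Proof.
move=> ab; rewrite /cint !segment_integral_cst//.
by case: z => x y /=; simpc.
Qed.

Lemma cintB a b h k : cont_seg a b h -> cont_seg a b k ->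
  cint a b (fun x => h x - k x) = cint a b h - cint a b k.
Proof.
move=> ch ck; rewrite /cint; simpc.
rewrite -RintegralB//; [|exact: cont_seg_Re|exact: cont_seg_Re].
rewrite -RintegralB//; [|exact: cont_seg_Im|exact: cont_seg_Im].
by congr (_ +i* _); apply: eq_Rintegral => x _ /=; rewrite raddfB.
Qed.

Lemma eq_cint a b h k : (forall x, a <= x <= b -> h x = k x) ->
  cint a b h = cint a b k.
Proof.
move=> hk; congr (_ +i* _); apply: eq_Rintegral => x;
  by rewrite inE/= in_itv/= => /hk ->.
Qed.

Lemma cint_chasles a m b h : a <= m -> m <= b -> cont_seg a b h ->
  cint a b h = cint a m h + cint m b h.
Proof.
move=> am mb ch.
have key (f : R -> R) : mu.-integrable `[a, b] (EFin \o f) ->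
    (\int[mu]_(x in `[a, b]) f x)%R =
    (\int[mu]_(x in `[a, m]) f x)%R + (\int[mu]_(x in `[m, b]) f x)%R.
  move=> fi; have := @Rintegral_itvB R f (BLeft a) (BRight b) m fi.
  rewrite !bnd_simp => /(_ am mb); rewrite Rintegral_itv_obnd_cbnd.
    by move=> <-; rewrite addrC subrK.
  apply: integrableS fi => //.
  by move=> x; rewrite /= !in_itv/= => /andP[mx ->]; rewrite andbT (le_trans am)// ltW.
rewrite /cint (key _ (cont_seg_Re ch)) (key _ (cont_seg_Im ch)).
by simpc.
Qed.

Lemma nm_cint a b h M : a <= b -> cont_seg a b h ->
  (forall x, a <= x <= b -> nm (h x) <= M) ->
  nm (cint a b h) <= 2 * (b - a) * M.
Proof.
move=> ab ch hM.
have key (f : R -> R) : mu.-integrable `[a, b] (EFin \o f) ->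
    (forall x, a <= x <= b -> `|f x| <= M) ->
    `|(\int[mu]_(x in `[a, b]) f x)%R| <= (b - a) * M.
  move=> fi fM; rewrite (le_trans (le_normr_Rintegral _ fi))//.
  apply: (@le_trans _ _ (\int[mu]_(x in `[a, b]) M)%R).
    apply: le_Rintegral => //.
    - exact: (@integrable_norm _ _ _ mu _ _ fi).
    - apply: continuous_compact_integrable; first exact: segment_compact.
      by apply: continuous_subspaceT => x; exact: cvg_cst.
  by rewrite segment_integral_cst.
rewrite (le_trans (nm_ReIm _))//= -mulrA mulr2n mulrDl !mul1r lerD//.
  apply: key; first exact: cont_seg_Re.
  by move=> x /hM; apply: le_trans; exact: nm_Re.
apply: key; first exact: cont_seg_Im.
by move=> x /hM; apply: le_trans; exact: nm_Im.
Qed.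

Lemma cint_Re_ge a b h e : a <= b -> cont_seg a b h ->
  (forall x, a <= x <= b -> e <= complex.Re (h x)) ->
  (b - a) * e <= complex.Re (cint a b h).
Proof.
move=> ab ch he /=.
rewrite -segment_integral_cst//; apply: le_Rintegral => //.
  by apply: (@cont_seg_Re a b (fun=> e%:C)) => x _; exact: cvg_cst.
exact: cont_seg_Re.
Qed.

Lemma cint_Im_ge a b h e : a <= b -> cont_seg a b h ->
  (forall x, a <= x <= b -> e <= complex.Im (h x)) ->
  (b - a) * e <= complex.Im (cint a b h).
Proof.
move=> ab ch he /=.
rewrite -segment_integral_cst//; apply: le_Rintegral => //.
  by apply: (@cont_seg_Re a b (fun=> e%:C)) => x _; exact: cvg_cst.
exact: cont_seg_Im.
Qed.

End SegmentIntegral.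

(** * Goursat's theorem and the Cauchy estimate *)

Section Goursat.
Context {R : realType}.
Implicit Types (a b c d : R) (g : R[i] -> R[i]).

Lemma pow2_gt (x : R) : exists n, x < 2 ^+ n.
Proof.
have [n xn] : exists n : nat, x < n%:R.
  by exists (Num.bound `|x|); rewrite (le_lt_trans (ler_norm _))// archi_boundP.
exists n; rewrite (lt_le_trans xn)// -natrX ler_nat; exact/ltnW/ltn_expl.
Qed.

Lemma nested_intervals (u v : nat -> R) :
  (forall n, u n <= u n.+1) -> (forall n, v n.+1 <= v n) ->
  (forall n, u n <= v n) -> exists x, forall n, u n <= x <= v n.
Proof.
move=> uS vS uv.
have um n k : u n <= u (n + k)%N.
  by elim: k => [|k IH]; rewrite ?addn0// addnS (le_trans IH).
have vm n k : v (n + k)%N <= v n.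
  by elim: k => [|k IH]; rewrite ?addn0// addnS (le_trans _ IH).
have uvm n k : u n <= v k.
  by rewrite (le_trans (um n k))// (le_trans (uv _))// addnC.
exists (sup (range u)) => n; apply/andP; split.
  apply: ub_le_sup; last by exists n.
  by exists (v 0%N) => _ [k _ <-].
by apply: ge_sup; [by exists (u 0%N), 0%N|move=> _ [k _ <-]].
Qed.

(** Quadrisection: if [P] failed on the large rectangle it would fail on a
nested sequence of quarters shrinking to a point. A degenerate second side
turns this into bisection of a segment. *)
Lemma rect_induction (P : R -> R -> R -> R -> Prop) a b c d :
  a <= b -> c <= d ->
  (forall a b c d, a <= b -> c <= d ->
     let m := (a + b) / 2 in let n := (c + d) / 2 in
     P a m c n -> P m b c n -> P a m n d -> P m b n d -> P a b c d) ->
  (forall x y, a <= x <= b -> c <= y <= d -> exists2 e, 0 < e &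
     forall a' b' c' d', a <= a' -> b' <= b -> c <= c' -> d' <= d ->
       a' <= x <= b' -> c' <= y <= d' -> b' - a' < e -> d' - c' < e ->
       P a' b' c' d') ->
  P a b c d.
Proof.
move=> ab cd Psplit Ploc; apply: contrapT => nP.
pose good (q : (R * R) * (R * R)) :=
  [/\ q.1.1 <= q.1.2, q.2.1 <= q.2.2 & ~ P q.1.1 q.1.2 q.2.1 q.2.2].
pose half (p p' : R * R) := [/\ p.1 <= p'.1, p'.2 <= p.2 &
  p'.2 - p'.1 = (p.2 - p.1) / 2].
have step (q : {q | good q}) : {q' : {q | good q} |
    half (sval q).1 (sval q').1 /\ half (sval q).2 (sval q').2}.
  apply: cid; case: q => -[[a1 b1] [c1 d1]] [/= ab1 cd1 nP1].
  set m := (a1 + b1) / 2; set n := (c1 + d1) / 2.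
  have quarter (q' : (R * R) * (R * R)) :
      ~ (exists q'', half (a1, b1) (sval q'' : (R * R) * (R * R)).1 /\
         half (c1, d1) (sval (q'' : {q | good q})).2) ->
      half (a1, b1) q'.1 -> half (c1, d1) q'.2 ->
      q'.1.1 <= q'.1.2 -> q'.2.1 <= q'.2.2 ->
      P q'.1.1 q'.1.2 q'.2.1 q'.2.2.
    move=> nex h1 h2 l1 l2; apply: contrapT => nP'; apply: nex.
    by unshelve eexists; [exists q'|].
  apply: contrapT => nex; apply: nP1; apply: Psplit => //; rewrite -/m -/n.
  - by apply: (quarter ((a1, m), (c1, n)) nex); rewrite /half/= /m /n; try split; lra.
  - by apply: (quarter ((m, b1), (c1, n)) nex); rewrite /half/= /m /n; try split; lra.
  - by apply: (quarter ((a1, m), (n, d1)) nex); rewrite /half/= /m /n; try split; lra.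
  - by apply: (quarter ((m, b1), (n, d1)) nex); rewrite /half/= /m /n; try split; lra.
have q0 : good ((a, b), (c, d)) by [].
pose u n := sval (iter n (fun q => sval (step q)) (exist _ _ q0)).
have uS n : half (u n).1 (u n.+1).1 /\ half (u n).2 (u n.+1).2.
  by rewrite /u iterS; case: (step _).
have gu n : good (u n) by rewrite /u; case: (iter _ _ _).
have len1 n : (u n).1.2 - (u n).1.1 = (b - a) / 2 ^+ n.
  elim: n => [|n IH]; first by rewrite expr0 divr1.
  by have [[_ _ ->] _] := uS n; rewrite IH exprSr invfM mulrA.
have len2 n : (u n).2.2 - (u n).2.1 = (d - c) / 2 ^+ n.
  elim: n => [|n IH]; first by rewrite expr0 divr1.
  by have [_ [_ _ ->]] := uS n; rewrite IH exprSr invfM mulrA.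
have [x xP] : exists x, forall n, (u n).1.1 <= x <= (u n).1.2.
  by apply: nested_intervals => n; [have [[]] := uS n|have [[]] := uS n|
    have [] := gu n].
have [y yP] : exists y, forall n, (u n).2.1 <= y <= (u n).2.2.
  by apply: nested_intervals => n; [have [_ []] := uS n|have [_ []] := uS n|
    have [] := gu n].
have [e e0 Pe] := Ploc x y (xP 0%N) (yP 0%N).
have [n] := pow2_gt (((b - a) + (d - c)) / e).
rewrite ltr_pdivrMr// => ne.
have p0 : 0 < 2 ^+ n :> R by rewrite exprn_gt0.
have in1 k : a <= (u k).1.1 /\ (u k).1.2 <= b.
  by elim: k => [|k [h1 h2]]; [by []|have [[k1 k2 _] _] := uS k; lra].
have in2 k : c <= (u k).2.1 /\ (u k).2.2 <= d.
  by elim: k => [|k [h1 h2]]; [by []|have [_ [k1 k2 _]] := uS k; lra].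
have [_ _] := gu n; apply; apply: Pe => //.
- by have [] := in1 n.
- by have [] := in1 n.
- by have [] := in2 n.
- by have [] := in2 n.
- by rewrite len1 ltr_pdivrMr//; lra.
- by rewrite len2 ltr_pdivrMr//; lra.
Qed.

(** The integral of [g dz] along the boundary of [[a, b] x [c, d]],
counterclockwise. *)
Definition bd a b c d g : R[i] :=
  cint a b (fun x => g (x +i* c) - g (x +i* d)) +
  (0 +i* 1) * cint c d (fun y => g (b +i* y) - g (a +i* y)).

Definition cont_rect a b c d g :=
  forall x y, a <= x <= b -> c <= y <= d -> {for x +i* y, continuous g}.

Lemma cont_rectS a b c d a' b' c' d' g :
  a <= a' -> b' <= b -> c <= c' -> d' <= d ->
  cont_rect a b c d g -> cont_rect a' b' c' d' g.
Proof. by move=> aa bb cc dd cg x y xab ycd; apply: cg; lra. Qed.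

Lemma cont_line_h g x y : {for x +i* y, continuous g} ->
  {for x, continuous (fun x => g (x +i* y))}.
Proof.
move=> gc A /gc/nm_nbhsP[e e0 eA]; apply/nbhs_ballP; exists e => //= z.
rewrite -ball_normE/= distrC => zx; apply: eA; by rewrite (le_lt_trans (nm_ReIm _))//= subrr normr0 addr0.
Qed.

Lemma cont_line_v g x y : {for x +i* y, continuous g} ->
  {for y, continuous (fun y => g (x +i* y))}.
Proof.
move=> gc A /gc/nm_nbhsP[e e0 eA]; apply/nbhs_ballP; exists e => //= z.
rewrite -ball_normE/= distrC => zx; apply: eA; by rewrite (le_lt_trans (nm_ReIm _))//= subrr normr0 add0r.
Qed.

Lemma cont_rect_h a b c d g y : cont_rect a b c d g -> c <= y <= d ->
  cont_seg a b (fun x => g (x +i* y)).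
Proof. by move=> cg yd x xab; apply: cont_line_h; exact: cg. Qed.

Lemma cont_rect_v a b c d g x : cont_rect a b c d g -> a <= x <= b ->
  cont_seg c d (fun y => g (x +i* y)).
Proof. by move=> cg yd y xab; apply: cont_line_v; exact: cg. Qed.

Lemma cont_segB a b (h k : R -> R[i]) : cont_seg a b h -> cont_seg a b k ->
  cont_seg a b (fun x => h x - k x).
Proof. by move=> ch ck x xab; apply: cvgB; [exact: ch|exact: ck]. Qed.

(* Continuity on the four sides is all that the boundary integral uses. *)
Definition cont_bd a b c d g :=
  [/\ cont_seg a b (fun x => g (x +i* c)), cont_seg a b (fun x => g (x +i* d)),
      cont_seg c d (fun y => g (a +i* y)) & cont_seg c d (fun y => g (b +i* y))].

Lemma cont_rect_bd a b c d g : a <= b -> c <= d ->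
  cont_rect a b c d g -> cont_bd a b c d g.
Proof.
move=> ab cd cg; split.
- by apply: cont_rect_h cg _; lra.
- by apply: cont_rect_h cg _; lra.
- by apply: cont_rect_v cg _; lra.
- by apply: cont_rect_v cg _; lra.
Qed.

Lemma bd_splitx a m b c d g : a <= m -> m <= b -> c <= d ->
  cont_rect a b c d g -> bd a b c d g = bd a m c d g + bd m b c d g.
Proof.
move=> am mb cd cg; rewrite /bd (cint_chasles am mb); last first.
  by apply: cont_segB; apply: cont_rect_h cg _; lra.
have -> : cint c d (fun y => g (b +i* y) - g (a +i* y)) =
    cint c d (fun y => g (b +i* y) - g (m +i* y)) +
    cint c d (fun y => g (m +i* y) - g (a +i* y)).
  have cb := @cont_rect_v _ _ _ _ _ b cg ltac:(lra).
  have ca := @cont_rect_v _ _ _ _ _ a cg ltac:(lra).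
  have cm := @cont_rect_v _ _ _ _ _ m cg ltac:(lra).
  by rewrite (cintB cb ca) (cintB cb cm) (cintB cm ca); ring.
by ring.
Qed.

Lemma bd_splity a b c m d g : a <= b -> c <= m -> m <= d ->
  cont_rect a b c d g -> bd a b c d g = bd a b c m g + bd a b m d g.
Proof.
move=> ab cm md cg; rewrite /bd (cint_chasles cm md); last first.
  by apply: cont_segB; apply: cont_rect_v cg _; lra.
have -> : cint a b (fun x => g (x +i* c) - g (x +i* d)) =
    cint a b (fun x => g (x +i* c) - g (x +i* m)) +
    cint a b (fun x => g (x +i* m) - g (x +i* d)).
  have cc := @cont_rect_h _ _ _ _ _ c cg ltac:(lra).
  have cd := @cont_rect_h _ _ _ _ _ d cg ltac:(lra).
  have cm' := @cont_rect_h _ _ _ _ _ m cg ltac:(lra).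
  by rewrite (cintB cc cd) (cintB cc cm') (cintB cm' cd); ring.
by ring.
Qed.

Lemma bdB a b c d g h : cont_bd a b c d g -> cont_bd a b c d h ->
  bd a b c d (fun z => g z - h z) = bd a b c d g - bd a b c d h.
Proof.
move=> [g1 g2 g3 g4] [h1 h2 h3 h4]; rewrite /bd.
have key s t (u v u' v' : R -> R[i]) : cont_seg s t u -> cont_seg s t v ->
    cont_seg s t u' -> cont_seg s t v' ->
    cint s t (fun x => (u x - v x) - (u' x - v' x)) =
    cint s t (fun x => u x - u' x) - cint s t (fun x => v x - v' x).
  move=> cu cv cu' cv'.
  rewrite (cintB (cont_segB cu cv) (cont_segB cu' cv')).
  by rewrite (cintB cu cv) (cintB cu' cv') (cintB cu cu') (cintB cv cv'); ring.
by rewrite (key _ _ _ _ _ _ g1 h1 g2 h2) (key _ _ _ _ _ _ g4 h4 g3 h3); ring.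
Qed.

Lemma nm_bd a b c d g M : a <= b -> c <= d -> cont_bd a b c d g ->
  (forall x, a <= x <= b -> nm (g (x +i* c)) <= M /\ nm (g (x +i* d)) <= M) ->
  (forall y, c <= y <= d -> nm (g (a +i* y)) <= M /\ nm (g (b +i* y)) <= M) ->
  nm (bd a b c d g) <= 4 * ((b - a) + (d - c)) * M.
Proof.
move=> ab cd [g1 g2 g3 g4] gh gv; rewrite (le_trans (nmD _ _))// nmM nm_i.
have h1 : nm (cint a b (fun x => g (x +i* c) - g (x +i* d))) <=
    2 * (b - a) * (M + M).
  apply: (nm_cint ab (cont_segB g1 g2)).
  by move=> x /gh[h1 h2]; rewrite (le_trans (nmB _ _))// lerD.
have h2 : nm (cint c d (fun x => g (b +i* x) - g (a +i* x))) <=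
    2 * (d - c) * (M + M).
  apply: (nm_cint cd (cont_segB g4 g3)).
  by move=> x /gv[k1 k2]; rewrite (le_trans (nmB _ _))// lerD.
by nra.
Qed.

Lemma bd_affine a b c d (al be z0 : R[i]) : a <= b -> c <= d ->
  bd a b c d (fun z => al + be * (z - z0)) = 0.
Proof.
move=> ab cd; rewrite /bd.
under [X in cint a b X]eq_fun => x.
  have -> : al + be * (x +i* c - z0) - (al + be * (x +i* d - z0)) =
    be * (0 +i* (c - d)).
    have -> : (0 +i* (c - d) : R[i]) = (x +i* c) - (x +i* d).
      by apply/eqP; rewrite eq_complex/= ?subrr ?eqxx.
    by ring.
  over.
under [X in cint c d X]eq_fun => y.
  have -> : al + be * (b +i* y - z0) - (al + be * (a +i* y - z0)) =
    be * ((b - a) +i* 0).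
    have -> : ((b - a) +i* 0 : R[i]) = (b +i* y) - (a +i* y).
      by apply/eqP; rewrite eq_complex/= ?subrr ?eqxx.
    by ring.
  over.
rewrite !cint_cst// mulrCA [X in _ + _ * X]mulrCA [X in _ + X]mulrCA -mulrDr.
by simpc; rewrite -[RHS](mulr0 be); congr (_ * _); apply/eqP;
  rewrite eq_complex/=; apply/andP; split; apply/eqP; ring.
Qed.

Lemma continuous_affine (al be z0 : R[i]) :
  continuous (fun z : R[i] => al + be * (z - z0)).
Proof.
have b0 : 0 < nm be + 1 by have := nm_ge0 be; lra.
move=> z; apply/nm_continuousP => e e0; exists (e / (nm be + 1)).
  by rewrite divr_gt0.
move=> y yz; have -> : al + be * (y - z0) - (al + be * (z - z0)) = be * (y - z).
  by ring.
rewrite nmM (@le_lt_trans _ _ ((nm be + 1) * nm (y - z)))//.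
  by apply: ler_wpM2r; [exact: nm_ge0|rewrite lerDl].
by rewrite mulrC -ltr_pdivlMr.
Qed.

Lemma cont_differentiable g z : differentiable g z -> {for z, continuous g}.
Proof. exact: differentiable_continuous. Qed.

(** Near a point [g] is its affine part, whose boundary integral vanishes, plus
[o(size)]; so the integral over a small rectangle is [o(size ^ 2)], and this
bound is preserved when four quarters are glued. *)
Lemma goursat a b c d g : a <= b -> c <= d ->
  (forall x y, a <= x <= b -> c <= y <= d -> differentiable g (x +i* y)) ->
  bd a b c d g = 0.
Proof.
move=> ab cd dg; apply: nm_eq0; apply/eqP; rewrite eq_le nm_ge0 andbT.
suff key e : 0 < e -> nm (bd a b c d g) <= e * ((b - a) + (d - c)) ^+ 2.
  apply/ler_addgt0Pl => e e0; rewrite addr0.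
  set s := ((b - a) + (d - c)) ^+ 2.
  have s0 : 0 < s + 1 by rewrite ltr_wpDl// sqr_ge0.
  rewrite (le_trans (key (e / (s + 1)) _)) ?divr_gt0// -/s.
  by rewrite -mulrA ler_piMr ?ltW// ltr_pdivrMl// mulr1; lra.
move=> e0.
have cg : cont_rect a b c d g.
  by move=> x y xab ycd; apply: cont_differentiable; exact: dg.
pose P a' b' c' d' := a <= a' -> b' <= b -> c <= c' -> d' <= d ->
  nm (bd a' b' c' d' g) <= e * ((b' - a') + (d' - c')) ^+ 2.
suff : P a b c d by apply.
apply: rect_induction => //.
- move=> a1 b1 c1 d1 ab1 cd1 m n.
  have mE : m = (a1 + b1) / 2 by []; have nE : n = (c1 + d1) / 2 by [].
  clearbody m n.
  have hm : m - a1 = (b1 - a1) / 2 by lra.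
  have hm' : b1 - m = (b1 - a1) / 2 by lra.
  have hn : n - c1 = (d1 - c1) / 2 by lra.
  have hn' : d1 - n = (d1 - c1) / 2 by lra.
  move=> P1 P2 P3 P4 aa bb cc dd.
  have cg1 : cont_rect a1 b1 c1 d1 g by exact: cont_rectS cg.
  have cl : cont_rect a1 m c1 d1 g by apply: cont_rectS cg1; lra.
  have cr : cont_rect m b1 c1 d1 g by apply: cont_rectS cg1; lra.
  rewrite (bd_splitx _ _ cd1 cg1 (m := m)); [|lra|lra].
  rewrite (bd_splity _ _ _ cl (m := n)); [|lra|lra|lra].
  rewrite (bd_splity _ _ _ cr (m := n)); [|lra|lra|lra].
  have mb : m <= b by clear -bb hm' hm ab1; lra.
  have am : a <= m by clear -aa hm' hm ab1; lra.
  have nd : n <= d by clear -dd hn' hn cd1; lra.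
  have cn : c <= n by clear -cc hn' hn cd1; lra.
  have {}P1 := P1 aa mb cc nd; have {}P2 := P2 am bb cc nd.
  have {}P3 := P3 aa mb cn dd; have {}P4 := P4 am bb cn dd.
  have := nmD (bd a1 m c1 n g + bd a1 m n d1 g) (bd m b1 c1 n g + bd m b1 n d1 g).
  have := nmD (bd a1 m c1 n g) (bd a1 m n d1 g).
  have := nmD (bd m b1 c1 n g) (bd m b1 n d1 g).
  rewrite hm hn in P1; rewrite hm' hn in P2.
  rewrite hm hn' in P3; rewrite hm' hn' in P4.
  set s := b1 - a1 + (d1 - c1).
  have E : e * ((b1 - a1) / 2 + (d1 - c1) / 2) ^+ 2 = e * s ^+ 2 / 4.
    by rewrite /s; field.
  rewrite E in P1; rewrite E in P2; rewrite E in P3; rewrite E in P4.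
  by clear -P1 P2 P3 P4; lra.
- move=> x y xab ycd; set z0 := x +i* y.
  have [r r0 rg] := nm_diff (dg x y xab ycd) (e := e / 4) ltac:(lra).
  exists (r / 2) => [|a1 b1 c1 d1 aa bb cc dd xa yc a1b1 c1d1 _ _ _ _].
    by rewrite divr_gt0.
  pose be := 'd g z0 (1 : R[i]).
  have dE h : 'd g z0 h = be * h.
    by rewrite -{1}[h]mulr1 -[h * 1]/(h *: (1 : R[i]^o)) linearZ/= mulrC.
  pose aff z := g z0 + be * (z - z0).
  have cg1 : cont_bd a1 b1 c1 d1 g.
    by apply: cont_rect_bd; [lra|lra|exact: cont_rectS cg].
  have ca : cont_bd a1 b1 c1 d1 aff.
    by apply: cont_rect_bd; [lra|lra|move=> ? ? _ _; exact: continuous_affine].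
  have -> : bd a1 b1 c1 d1 g = bd a1 b1 c1 d1 (fun z => g z - aff z).
    by rewrite bdB// bd_affine ?subr0//; lra.
  set s := b1 - a1 + (d1 - c1).
  have est x' y' : a1 <= x' <= b1 -> c1 <= y' <= d1 ->
      nm (g (x' +i* y') - aff (x' +i* y')) <= e / 4 * s.
    move=> xx yy.
    have zs : nm (x' +i* y' - z0) <= s.
      rewrite (le_trans (nm_ReIm _))//=.
      have : `|x' - x| <= b1 - a1 by rewrite ler_norml; lra.
      have : `|y' - y| <= d1 - c1 by rewrite ler_norml; lra.
      by rewrite /s; lra.
    have zr : nm (x' +i* y' - z0) < r by apply: (le_lt_trans zs); rewrite /s; lra.
    have := rg _ zr; rewrite dE /aff opprD addrA => h.
    apply: (le_trans h); apply: ler_wpM2l => //; lra.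
  have ab1 : a1 <= b1 by lra.
  have cd1 : c1 <= d1 by lra.
  have cga : cont_bd a1 b1 c1 d1 (fun z => g z - aff z).
    case: cg1 => g1 g2 g3 g4; case: ca => k1 k2 k3 k4.
    by split; [exact: (cont_segB g1 k1)|exact: (cont_segB g2 k2)|
      exact: (cont_segB g3 k3)|exact: (cont_segB g4 k4)].
  have -> : e * s ^+ 2 = 4 * s * (e / 4 * s) by field.
  apply: (nm_bd ab1 cd1 cga).
    by move=> x' xx; split; apply: est => //; lra.
  by move=> y' yy; split; apply: est => //; lra.
Qed.

End Goursat.

Section CauchyEstimate.
Context {R : realType}.
Implicit Types (a b c d : R) (f g : R[i] -> R[i]) (w : R[i]).

Lemma cintZ a b (u : R[i]) (h : R -> R[i]) : cont_seg a b h ->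
  cint a b (fun x => u * h x) = u * cint a b h.
Proof.
case: u => u1 u2 ch; have hr := cont_seg_Re ch; have hi := cont_seg_Im ch.
have Zi (r : R) (k : R -> R) :
    (@lebesgue_measure R).-integrable `[a, b] (EFin \o k) ->
    (@lebesgue_measure R).-integrable `[a, b] (EFin \o (fun x => r * k x)).
  by move=> ki; apply: (@integrableZl _ _ _ (@lebesgue_measure R) _ _ r _ ki).
rewrite /cint; simpc; rewrite -!RintegralZl//.
rewrite -RintegralB//; [|exact: Zi|exact: Zi].
rewrite -RintegralD//; [|exact: Zi|exact: Zi].
by congr (_ +i* _); apply: eq_Rintegral => x _ /=; case: (h x).
Qed.

Lemma bdZ a b c d u g : cont_bd a b c d g ->
  bd a b c d (fun z => u * g z) = u * bd a b c d g.
Proof.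
move=> [g1 g2 g3 g4]; rewrite /bd mulrDr mulrCA.
rewrite -(cintZ u (cont_segB g1 g2)) -(cintZ u (cont_segB g4 g3)).
by congr (_ + _ * _); apply: eq_cint => x _; rewrite mulrBr.
Qed.

(** Around the exceptional point a square of side [2 t] is cut out; by
boundedness its boundary contributes [O(t)], and all other pieces vanish. *)
Lemma goursat_except a b c d g x0 y0 : a < x0 < b -> c < y0 < d ->
  cont_rect a b c d g ->
  (forall x y, a <= x <= b -> c <= y <= d -> x +i* y <> x0 +i* y0 ->
     differentiable g (x +i* y)) ->
  bd a b c d g = 0.
Proof.
move=> xab ycd cg dg; apply: nm_eq0; apply/eqP; rewrite eq_le nm_ge0 andbT.
apply/ler_addgt0Pl => e e0; rewrite addr0.
set z0 := x0 +i* y0.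
have /nm_continuousP/(_ _ ltr01)[r r0 rg] := cg x0 y0 ltac:(lra) ltac:(lra).
set M := nm (g z0) + 1.
have M0 : 0 < M by rewrite /M; have := nm_ge0 (g z0); lra.
pose t := Num.min (Num.min (x0 - a) (b - x0)) (Num.min
  (Num.min (y0 - c) (d - y0)) (Num.min (r / 4) (e / (16 * M)))).
have t0 : 0 < t.
  by rewrite !lt_min !divr_gt0 ?mulr_gt0// !subr_gt0; case/andP: xab => -> ->;
  case/andP: ycd => -> ->.
have : t <= t by [].
rewrite {2}/t !le_min => /andP[/andP[t1 t2] /andP[/andP[t3 t4] /andP[t5 t6]]].
clearbody t; have dz x y : x != x0 \/ y != y0 -> x +i* y <> z0.
  by move=> [/eqP xx|/eqP yy] [].
have zero a' b' c' d' : a <= a' -> a' <= b' -> b' <= b -> c <= c' -> c' <= d' ->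
    d' <= d -> (x0 < a' \/ b' < x0) \/ (y0 < c' \/ d' < y0) ->
    bd a' b' c' d' g = 0.
  move=> aa ab bb cc cd dd h; apply: goursat => // x y xx yy.
  apply: dg; [lra|lra|]; apply: dz.
  by case: h => [[]|[]] h; [left; rewrite gt_eqF|left; rewrite lt_eqF|
    right; rewrite gt_eqF|right; rewrite lt_eqF] => //; lra.
have xl : x0 - t < x0 by clear -t0; lra.
have xr : x0 < x0 + t by clear -t0; lra.
have yl : y0 - t < y0 by clear -t0; lra.
have yr : y0 < y0 + t by clear -t0; lra.
have xl' : a <= x0 - t by clear -t1; lra.
have xr' : x0 + t <= b by clear -t2; lra.
have yl' : c <= y0 - t by clear -t3; lra.
have yr' : y0 + t <= d by clear -t4; lra.
have cd : c <= d by clear -ycd; lra.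
have xlb : x0 - t <= b by clear -xl xr xr'; lra.
have ydb : y0 - t <= d by clear -yl yr yr'; lra.
have xlr : x0 - t <= x0 + t by clear -xl xr; lra.
have ylr : y0 - t <= y0 + t by clear -yl yr; lra.
rewrite (bd_splitx xl' xlb cd cg) (zero a (x0 - t) c d) ?lexx ?add0r//;
  last by left; right.
have cg1 : cont_rect (x0 - t) b c d g by exact: cont_rectS cg.
rewrite (bd_splitx xlr xr' cd cg1) (zero (x0 + t) b c d) ?lexx ?addr0//;
  [|by rewrite (le_trans xl')|by left; left].
have {}cg1 : cont_rect (x0 - t) (x0 + t) c d g by exact: cont_rectS cg.
rewrite (bd_splity xlr yl' ydb cg1) (zero _ _ c (y0 - t)) ?lexx ?add0r//;
  last by right; right.
have {}cg1 : cont_rect (x0 - t) (x0 + t) (y0 - t) d g by exact: cont_rectS cg.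
rewrite (bd_splity xlr ylr yr' cg1) (zero _ _ (y0 + t) d) ?lexx ?addr0//;
  [|by rewrite (le_trans yl')|by right; left].
have gM x y : x0 - t <= x <= x0 + t -> y0 - t <= y <= y0 + t ->
    nm (g (x +i* y)) <= M.
  move=> xx yy; have /rg : nm (x +i* y - z0) < r.
    apply: (le_lt_trans (nm_ReIm _)) => /=.
    have : `|x - x0| <= t by rewrite ler_norml; clear -xx; lra.
    have : `|y - y0| <= t by rewrite ler_norml; clear -yy; lra.
    by clear -t5 t0; lra.
  have := nmD (g (x +i* y) - g z0) (g z0); rewrite subrK.
  by rewrite /M -/z0; move=> h k; apply: (le_trans h); rewrite addrC lerD2l ltW.
have cb : cont_bd (x0 - t) (x0 + t) (y0 - t) (y0 + t) g.
  by apply: cont_rect_bd => //; exact: cont_rectS cg.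
apply: (le_trans (nm_bd xlr ylr cb (M := M) _ _)).
- by move=> x xx; split; apply: gM => //; rewrite lexx//= andbT.
- by move=> y yy; split; apply: gM => //; rewrite lexx//= andbT.
have -> : x0 + t - (x0 - t) + (y0 + t - (y0 - t)) = 4 * t by ring.
rewrite ler_pdivlMr ?mulr_gt0// in t6.
by clear -t6; lra.
Qed.

Definition unit_square_bd (x y : R) :=
  (-1 <= x <= 1 /\ (y = -1 \/ y = 1)) \/ ((x = -1 \/ x = 1) /\ -1 <= y <= 1).

Lemma unit_square_bd_far x y w : unit_square_bd x y -> nm w < 1 / 2 ->
  1 / 2 <= nm (x +i* y - w).
Proof.
move=> xy wh; have := nm_Re w; have := nm_Im w.
have := nm_Re (x +i* y - w); have := nm_Im (x +i* y - w).
case: w wh => u v wh /=.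
have := ler_norm (x - u); have := ler_norm (y - v).
have := ler_norm (- (x - u)); have := ler_norm (- (y - v)); rewrite !normrN.
have := ler_norm u; have := ler_norm v.
have := ler_norm (- u); have := ler_norm (- v); rewrite !normrN.
by case: xy => [[_ [->|->]]|[[->|->] _]]; lra.
Qed.

Lemma unit_square_bd_cont g :
  (forall x y, unit_square_bd x y -> {for x +i* y, continuous g}) ->
  cont_bd (-1) 1 (-1) 1 g.
Proof.
move=> cg; split => x xx; [apply: cont_line_h|apply: cont_line_h|
  apply: cont_line_v|apply: cont_line_v]; apply: cg; rewrite /unit_square_bd.
- by left; split => //; left.
- by left; split => //; right.
- by right; split => //; left.
- by right; split => //; right.
Qed.

Lemma differentiable_inv w z : z != w ->
  differentiable (fun z : R[i] => (z - w)^-1) z.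
Proof.
move=> zw; apply: differentiableV; last by rewrite subr_eq0.
by apply: differentiableB => //; exact: differentiable_cst.
Qed.

Lemma inv_continuous w z : z != w ->
  {for z, continuous (fun z => (z - w)^-1)}.
Proof.
by move=> zw; apply: cont_differentiable; exact: differentiable_inv.
Qed.

Lemma bd_inv_cont w : nm w < 1 / 2 ->
  cont_bd (-1) 1 (-1) 1 (fun z => (z - w)^-1).
Proof.
move=> wh; apply: unit_square_bd_cont => x y xy; apply: inv_continuous.
apply: contraTneq (unit_square_bd_far xy wh) => ->.
by rewrite subrr nm0 -ltNge; lra.
Qed.

(** The exact value is [2 pi i]. A crude lower bound suffices for the Cauchy
estimate and needs no evaluation: the imaginary part is an integral of
quantities that are at least [2/9] on each pair of opposite sides. *)
Lemma bd_inv_ge w : nm w < 1 / 2 ->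
  8 / 9 <= nm (bd (-1) 1 (-1) 1 (fun z => (z - w)^-1)).
Proof.
move=> wh; apply: le_trans (nm_Im _); apply: le_trans (ler_norm _).
have [c1 c2 c3 c4] := bd_inv_cont wh.
have [u1 u2] : `|complex.Re w| < 1 / 2 /\ `|complex.Im w| < 1 / 2.
  by split; rewrite (le_lt_trans _ wh) ?nm_Re ?nm_Im.
case: w wh c1 c2 c3 c4 u1 u2 => u v wh c1 c2 c3 c4.
rewrite !ltr_norml => u1 v1.
rewrite [complex.Re _]/= in u1; rewrite [complex.Im _]/= in v1.
have quot (s t : R) : 1 / 2 <= s <= 3 / 2 -> - (3 / 2) <= t <= 3 / 2 ->
    1 / 9 <= s / (s ^+ 2 + t ^+ 2).
  move=> hs ht; have s2 : 0 < s ^+ 2 + t ^+ 2 by nra.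
  by rewrite ler_pdivlMr//; nra.
have iR (s t : R) : complex.Re ((s +i* t)^-1) = s / (s ^+ 2 + t ^+ 2) by [].
have iI (s t : R) : complex.Im ((s +i* t)^-1) = - (t / (s ^+ 2 + t ^+ 2)) by [].
have dE (s t : R) : (s +i* t) - (u +i* v) = (s - u) +i* (t - v).
  by simpc.
have m11 : (-1 : R) <= 1 by lra.
have h1 := @cint_Im_ge _ _ _ _ (2 / 9) m11 (cont_segB c1 c2).
have h2 := @cint_Re_ge _ _ _ _ (2 / 9) m11 (cont_segB c4 c3).
have ImD (s t : R[i]) : complex.Im (s + t) = complex.Im s + complex.Im t.
  by case: s; case: t.
have ImB (s t : R[i]) : complex.Im (s - t) = complex.Im s - complex.Im t.
  by case: s; case: t.
have ReB (s t : R[i]) : complex.Re (s - t) = complex.Re s - complex.Re t.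
  by case: s; case: t.
rewrite /bd ImD.
have -> z : complex.Im ((0 +i* 1 : R[i]) * z) = complex.Re z.
  by case: z => s t; simpc.
have k1 : (1 - -1) * (2 / 9) <= complex.Im (cint (-1) 1 (fun x =>
    (x +i* -1 - (u +i* v))^-1 - (x +i* 1 - (u +i* v))^-1)).
  apply: h1 => x xx; rewrite !dE ImB !iI.
  have := quot (- (-1 - v)) (x - u) ltac:(lra) ltac:(lra).
  have := quot (1 - v) (x - u) ltac:(lra) ltac:(lra).
  by rewrite !sqrrN ![_ ^+ 2 + (x - u) ^+ 2]addrC mulNr; lra.
have k2 : (1 - -1) * (2 / 9) <= complex.Re (cint (-1) 1 (fun y =>
    (1 +i* y - (u +i* v))^-1 - (-1 +i* y - (u +i* v))^-1)).
  apply: h2 => y yy; rewrite !dE ReB !iR.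
  have := quot (- (-1 - u)) (y - v) ltac:(lra) ltac:(lra).
  have := quot (1 - u) (y - v) ltac:(lra) ltac:(lra).
  by rewrite !sqrrN mulNr; lra.
by move: k1 k2; rewrite /=; lra.
Qed.

Lemma unit_square_nm x y : -1 <= x <= 1 -> -1 <= y <= 1 ->
  nm (x +i* y : R[i]) < 3.
Proof.
move=> xx yy; apply: (le_lt_trans (nm_ReIm _)) => /=.
have : `|x| <= 1 by rewrite ler_norml.
have : `|y| <= 1 by rewrite ler_norml.
by lra.
Qed.

(** The difference quotient extends continuously to [w], so that the
exceptional point is harmless. *)
Lemma bd_sub_value f w : (forall z, nm z < 3 -> differentiable f z) ->
  nm w < 1 / 2 ->
  bd (-1) 1 (-1) 1 (fun z => (f z - f w) * (z - w)^-1) = 0.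
Proof.
move=> df wh; pose D := 'd f w (1 : R[i]).
have dE h : 'd f w h = D * h.
  by rewrite -{1}[h]mulr1 -[h * 1]/(h *: (1 : R[i]^o)) linearZ/= mulrC.
pose q z := if z == w then D else (f z - f w) * (z - w)^-1.
have [u1 u2] : `|complex.Re w| < 1 / 2 /\ `|complex.Im w| < 1 / 2.
  by split; rewrite (le_lt_trans _ wh) ?nm_Re ?nm_Im.
have w3 : nm w < 3 by lra.
have qw z : z != w -> nm z < 3 -> differentiable q z.
  move=> zw z3.
  have d1 : differentiable (fun z => (f z - f w) * (z - w)^-1) z.
    apply: differentiableM; last exact: differentiable_inv.
    by apply: differentiableB; [exact: df|exact: differentiable_cst].
  apply: (near_eq_diff _ d1).1; apply/nm_nbhsP.
  exists (nm (z - w)); first by rewrite nm_gt0// subr_eq0.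
  move=> y yz; rewrite /q; case: eqP yz => // ->.
  by rewrite nmBC ltxx.
have cq z : nm z < 3 -> {for z, continuous q}.
  move=> z3; have [->|zw] := eqVneq z w; last first.
    by apply: cont_differentiable; exact: qw.
  apply/nm_continuousP => e e0.
  have [r r0 rf] := nm_diff (df w w3) (e := e / 2) ltac:(lra).
  exists r => // y yw; rewrite /q eqxx; case: eqVneq => [_|yw0].
    by rewrite subrr nm0.
  have y0 : y - w != 0 by rewrite subr_eq0.
  have -> : (f y - f w) * (y - w)^-1 - D =
      (f y - f w - 'd f w (y - w)) * (y - w)^-1.
    by rewrite dE [RHS]mulrBl mulfK.
  rewrite nmM nmV; apply: (@le_lt_trans _ _ (e / 2)); last by lra.
  by rewrite ler_pdivrMr ?nm_gt0//; exact: rf.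
have -> : bd (-1) 1 (-1) 1 (fun z => (f z - f w) * (z - w)^-1) =
    bd (-1) 1 (-1) 1 q.
  have E x y : unit_square_bd x y ->
      (f (x +i* y) - f w) * (x +i* y - w)^-1 = q (x +i* y).
    move=> xy; rewrite /q; case: eqP => // E.
    have := unit_square_bd_far xy wh; rewrite E subrr nm0 leNgt => /negP[].
    by lra.
  rewrite /bd; congr (_ + _ * _); apply: eq_cint => x xx; congr (_ - _);
    apply: E; rewrite /unit_square_bd.
  - by left; split => //; left.
  - by left; split => //; right.
  - by right; split => //; right.
  - by right; split => //; left.
case: w wh D dE q u1 u2 w3 qw cq => u v wh D dE q /=.
rewrite !ltr_norml => u1 u2 w3 qw cq.
apply: (@goursat_except _ _ _ _ _ u v); [lra|lra| |].
  by move=> x y xx yy; apply: cq; exact: unit_square_nm.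
by move=> x y xx yy /eqP xy; apply: qw => //; exact: unit_square_nm.
Qed.

(** By the previous vanishing statement at [w] and at [w'],
[(f w - f w') * bd (1 / (z - w'))] equals the boundary integral of
[(f z - f w) * (1 / (z - w) - 1 / (z - w'))], and the last factor is
[O(w - w')] on the boundary of the square. *)
Lemma cauchy_estimate f M w w' : (forall z, nm z < 3 -> differentiable f z) ->
  (forall z, nm z < 3 -> nm (f z) <= M) ->
  nm w < 1 / 2 -> nm w' < 1 / 2 -> nm (f w - f w') <= 144 * M * nm (w - w').
Proof.
move=> df fM wh wh'.
have cs x y : unit_square_bd x y -> nm (x +i* y : R[i]) < 3.
  by case=> -[xx yy]; apply: unit_square_nm => //;
    [case: yy => ->; lra|case: xx => ->; lra].
have ne x y w0 : unit_square_bd x y -> nm w0 < 1 / 2 -> x +i* y != w0.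
  move=> xy w0h; apply: contraTneq (unit_square_bd_far xy w0h) => ->.
  by rewrite subrr nm0 -ltNge; lra.
have cv w0 v0 : nm v0 < 1 / 2 ->
    cont_bd (-1) 1 (-1) 1 (fun z => (f z - f w0) * (z - v0)^-1).
  move=> v0h; apply: unit_square_bd_cont => x y xy.
  apply: cont_differentiable; apply: differentiableM.
    by apply: differentiableB; [exact/df/cs|exact: differentiable_cst].
  by apply: differentiable_inv; exact: ne.
have B1 := bd_sub_value df wh; have B2 := bd_sub_value df wh'.
have B3 := bdB (cv w w wh) (cv w w' wh').
have B4 := bdB (cv w' w' wh') (cv w w' wh').
have E : bd (-1) 1 (-1) 1 (fun z => (f z - f w') * (z - w')^-1 -
     (f z - f w) * (z - w')^-1) = (f w - f w') *
     bd (-1) 1 (-1) 1 (fun z => (z - w')^-1).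
  rewrite -(bdZ (f w - f w') (bd_inv_cont wh')); congr bd.
  by apply/funext => z; ring.
have key : (f w - f w') * bd (-1) 1 (-1) 1 (fun z => (z - w')^-1) =
    bd (-1) 1 (-1) 1 (fun z => (f z - f w) * (z - w)^-1 -
      (f z - f w) * (z - w')^-1).
  by rewrite B3 -E B4 B1 B2.
have le1 : nm (bd (-1) 1 (-1) 1 (fun z => (f z - f w) * (z - w)^-1 -
      (f z - f w) * (z - w')^-1)) <= 128 * M * nm (w - w').
  have cb : cont_bd (-1) 1 (-1) 1 (fun z => (f z - f w) * (z - w)^-1 -
      (f z - f w) * (z - w')^-1).
    have [c1 c2 c3 c4] := cv w w wh; have [k1 k2 k3 k4] := cv w w' wh'.
    by split; [exact: (cont_segB c1 k1)|exact: (cont_segB c2 k2)|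
      exact: (cont_segB c3 k3)|exact: (cont_segB c4 k4)].
  have invB (s t : R[i]) : s != 0 -> t != 0 ->
      s^-1 - t^-1 = (t - s) * (s^-1 * t^-1).
    by move=> s0 t0; field; rewrite s0 t0.
  have est x y : unit_square_bd x y -> nm ((f (x +i* y) - f w) *
      (x +i* y - w)^-1 - (f (x +i* y) - f w) * (x +i* y - w')^-1) <=
      8 * M * nm (w - w').
    move=> xy; have n1 := unit_square_bd_far xy wh.
    have n2 := unit_square_bd_far xy wh'.
    have z1 : x +i* y - w != 0 by rewrite subr_eq0; exact: ne.
    have z2 : x +i* y - w' != 0 by rewrite subr_eq0; exact: ne.
    have -> : (f (x +i* y) - f w) * (x +i* y - w)^-1 - (f (x +i* y) - f w) *
        (x +i* y - w')^-1 = (f (x +i* y) - f w) * ((w - w') *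
        ((x +i* y - w)^-1 * (x +i* y - w')^-1)).
      have -> : w - w' = (x +i* y - w') - (x +i* y - w) by ring.
      by rewrite -mulrBr invB.
    rewrite !nmM !nmV.
    have f1 : nm (f (x +i* y) - f w) <= 2 * M.
      apply: (le_trans (nmB _ _)); have := fM _ (cs _ _ xy).
      have := fM w ltac:(lra); lra.
    have i1 : (nm (x +i* y - w))^-1 <= 2.
      by rewrite -[leRHS]invrK lef_pV2 ?posrE ?nm_gt0//; lra.
    have i2 : (nm (x +i* y - w'))^-1 <= 2.
      by rewrite -[leRHS]invrK lef_pV2 ?posrE ?nm_gt0//; lra.
    have -> : 8 * M * nm (w - w') = (2 * M) * (nm (w - w') * (2 * 2)) by ring.
    have p1 : 0 <= (nm (x +i* y - w))^-1 by rewrite invr_ge0 nm_ge0.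
    have p2 : 0 <= (nm (x +i* y - w'))^-1 by rewrite invr_ge0 nm_ge0.
    have p3 : 0 <= (nm (x +i* y - w))^-1 * (nm (x +i* y - w'))^-1.
      exact: mulr_ge0.
    have p4 : 0 <= nm (w - w') by exact: nm_ge0.
    apply: ler_pM; [exact: nm_ge0|exact: mulr_ge0|exact: f1|].
    apply: ler_pM; [exact: p4|exact: p3|exact: lexx|].
    exact: ler_pM.
  have := nm_bd (M := 8 * M * nm (w - w')) _ _ cb.
  have -> : 4 * (1 - -1 + (1 - -1)) * (8 * M * nm (w - w')) =
    128 * M * nm (w - w') by ring.
  apply; [lra|lra| |].
  - by move=> x xx; split; apply: est; left; split => //; [left|right].
  - by move=> x xx; split; apply: est; right; split => //; [left|right].
have := bd_inv_ge wh'; rewrite -key nmM in le1 * => ge1.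
have : 8 / 9 * nm (f w - f w') <= 128 * M * nm (w - w').
  apply: (le_trans _ le1); rewrite mulrC; apply: ler_wpM2l; last exact: ge1.
  exact: nm_ge0.
by lra.
Qed.

End CauchyEstimate.

(** * Local estimates for bounded holomorphic maps *)

Section HolomorphicEstimates.
Context {R : realType}.
Implicit Types V W : normedModType R[i].

Definition holo_on V W (f : V -> W) (p : V) (r : R) :=
  forall z, nm (z - p) < r -> differentiable f z.

Lemma holo_onS V W (f : V -> W) p r p' r' : nm (p' - p) + r' <= r ->
  holo_on f p r -> holo_on f p' r'.
Proof.
move=> h df z zp; apply: df; apply: (le_lt_trans (nm_tri p' z p)).
by apply: lt_le_trans h; rewrite addrC ltrD2l.
Qed.

Lemma holo_on_shift V W (f : V -> W) p r a : holo_on f (p + a) r ->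
  holo_on (fun z => f (z + a)) p r.
Proof.
move=> df z zp; have dfa : differentiable f (z + a).
  by apply: df; rewrite opprD addrACA subrr addr0.
have da : differentiable (fun z => z + a) z.
  by apply: differentiableD => //; exact: differentiable_cst.
exact: (@differentiable_comp _ _ _ _ (fun z => z + a) f z da dfa).
Qed.

(** Sealed so that conversion never unfolds the numeral. *)
Definition cauchy_cst : R := 864%:R.

Lemma cauchy_cstE : cauchy_cst = 144 * 6.
Proof. by rewrite /cauchy_cst -natrM. Qed.

Opaque cauchy_cst.

Lemma cauchy_cst_gt0 : 0 < cauchy_cst.
Proof. by rewrite cauchy_cstE; lra. Qed.

(** When [y] is close to [x], the Cauchy estimate is applied on the complex line
through [x] and [y], rescaled so that the disc of radius 3 stays inside the
ball; otherwise the bound [2 M] is enough. *)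
Lemma holo_lipschitz_scalar V (f : V -> R[i]) p r M x y : 0 < r ->
  holo_on f p r -> (forall z, nm (z - p) < r -> nm (f z) <= M) ->
  nm (x - p) < r / 2 -> nm (y - p) < r ->
  nm (f y - f x) <= cauchy_cst * M / r * nm (y - x).
Proof.
move=> r0 df fM xp yp.
have M0 : 0 <= M by apply: (le_trans (nm_ge0 _) (fM _ yp)).
have c0 := cauchy_cst_gt0.
set s := nm (y - x); have s0 : 0 <= s by exact: nm_ge0.
have [s12|s12] := leP (r / 12) s.
  have h : nm (f y - f x) <= 2 * M.
    apply: (le_trans (nmB _ _)); have := fM _ yp; have := fM x ltac:(lra); lra.
  apply: (le_trans h); rewrite mulrAC ler_pdivlMr// cauchy_cstE; nra.
have [yx|yx] := pselect (y = x).
  have -> : nm (f y - f x) = 0 by rewrite yx subrr nm0.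
  apply: mulr_ge0 => //; apply: divr_ge0; last exact: ltW.
  by apply: mulr_ge0 => //; exact: ltW.
have {}s0 : 0 < s by rewrite nm_gt0// subr_eq0; apply/eqP.
pose v := (r / 6 / s)%:C *: (y - x).
have nv : nm v = r / 6.
  by rewrite nmZ nmC -/s ger0_norm ?divfK ?gt_eqF//; rewrite ltW// !divr_gt0.
pose g (t : R[i]) := f (x + t *: v).
have inB (t : R[i]) : nm t < 3 -> nm (x + t *: v - p) < r.
  move=> t3; rewrite addrAC (le_lt_trans (nmD _ _))// nmZ nv.
  by have := nm_ge0 t; nra.
have dg (t : R[i]) : nm t < 3 -> differentiable g t.
  move=> t3; apply: (@differentiable_comp _ _ _ _ (fun t : R[i] => x + t *: v) f).
    apply: differentiableD; first exact: differentiable_cst.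
    by apply: (@differentiableZl _ _ _ (id : R[i] -> R[i]) v t).
  exact/df/inB.
have gM (t : R[i]) : nm t < 3 -> nm (g t) <= M by move=> t3; exact/fM/inB.
have t1 : nm ((6 * s / r)%:C : R[i]) = 6 * s / r.
  by rewrite nmC ger0_norm// divr_ge0 ?mulr_ge0// ltW.
have t1h : 6 * s / r < 1 / 2 by rewrite ltr_pdivrMr//; lra.
have := @cauchy_estimate R g M (6 * s / r)%:C 0 dg gM.
rewrite t1 nm0 subr0 t1 => /(_ t1h ltac:(lra)).
have -> : g 0 = f x by rewrite /g scale0r addr0.
have -> : g (6 * s / r)%:C = f y.
  rewrite /g /v scalerA -rmorphM/=.
  have -> : 6 * s / r * (r / 6 / s) = 1 by field; rewrite !gt_eqF.
  by rewrite scale1r addrC subrK.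
move=> /le_trans; apply.
by rewrite cauchy_cstE le_eqVlt; apply/orP; left; apply/eqP; ring.
Qed.

Lemma differentiable_coordinate V n (f : V -> 'rV[R[i]]_n) z i :
  differentiable f z -> differentiable (fun z => f z 0 i) z.
Proof.
move=> df; apply: (@differentiable_comp _ _ _ _ f
  (fun M : 'rV[R[i]]_n => M 0 i)) => //.
exact: differentiable_coord.
Qed.

Lemma holo_lipschitz V n (f : V -> 'rV[R[i]]_n) p r M x y : 0 < r ->
  holo_on f p r -> (forall z, nm (z - p) < r -> nm (f z) <= M) ->
  nm (x - p) < r / 2 -> nm (y - p) < r ->
  nm (f y - f x) <= cauchy_cst * M / r * nm (y - x).
Proof.
move=> r0 df fM xp yp.
have M0 : 0 <= M by apply: (le_trans (nm_ge0 _) (fM _ yp)).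
apply: nm_row_le.
  apply: mulr_ge0; last exact: nm_ge0.
  by apply: divr_ge0; [apply: mulr_ge0 => //; exact/ltW/cauchy_cst_gt0|exact: ltW].
move=> i; rewrite !mxE.
apply: (@holo_lipschitz_scalar _ (fun z => f z 0 i) p r) => //.
  by move=> z zp; apply: differentiable_coordinate; exact: df.
by move=> z zp; apply: (le_trans (nm_coord _ _)); exact: fM.
Qed.

(** The increment [z |-> f (z + a) - f z] is holomorphic and, by the Lipschitz
estimate, of size [O(a)]; its own Lipschitz estimate gives [O(a) O(b)]. This
bound replaces second derivatives everywhere below. *)
Lemma holo_second_difference V n (f : V -> 'rV[R[i]]_n) p r M x a b : 0 < r ->
  holo_on f p r -> (forall z, nm (z - p) < r -> nm (f z) <= M) ->
  nm (x - p) < r / 8 -> nm a < r / 8 -> nm b < r / 8 ->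
  nm (f (x + a + b) - f (x + a) - f (x + b) + f x) <=
  4 * cauchy_cst ^+ 2 * M / r ^+ 2 * nm a * nm b.
Proof.
move=> r0 df fM xp na nb.
have M0 : 0 <= M.
  by apply: (le_trans (nm_ge0 (f x))); apply: fM; lra.
pose g z := f (z + a) - f z.
have near_p z : nm (z - p) < r / 4 -> nm (z + a - p) < r / 2.
  move=> zp; rewrite addrAC (le_lt_trans (nmD _ _))//; lra.
have dg : holo_on g p (r / 4).
  move=> z zp; apply: differentiableB; last by apply: df; lra.
  apply: (@holo_on_shift _ _ f p (r / 4)) => // y yp.
  apply: df; have := nm_tri (p + a) y p.
  have -> : p + a - p = a by rewrite addrAC subrr add0r.
  lra.
have gM z : nm (z - p) < r / 4 -> nm (g z) <= cauchy_cst * M / r * nm a.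
  move=> zp; have := @holo_lipschitz _ _ f p r M z (z + a) r0 df fM.
  have -> : z + a - z = a by rewrite addrAC subrr add0r.
  by apply; [lra|have := near_p z zp; lra].
have xbp : nm (x + b - p) < r / 4.
  by rewrite addrAC (le_lt_trans (nmD _ _))//; lra.
have := @holo_lipschitz _ _ g p (r / 4) _ x (x + b) ltac:(lra) dg gM.
have -> : x + b - x = b by rewrite addrAC subrr add0r.
move=> /(_ ltac:(lra) xbp).
have -> : g (x + b) - g x = f (x + a + b) - f (x + a) - f (x + b) + f x.
  rewrite /g (addrAC x b a) opprB [in RHS](addrAC _ (- f (x + a))).
  by rewrite -[RHS]addrA [- f (x + a) + _]addrC.
move=> /le_trans; apply.
rewrite le_eqVlt; apply/orP; left; apply/eqP; field.
by rewrite gt_eqF.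
Qed.

Lemma differentiable_nm_le V W (f : V -> W) p K : differentiable f p ->
  (exists2 r, 0 < r & forall y, nm (y - p) < r ->
     nm (f y - f p) <= K * nm (y - p)) ->
  forall h, nm ('d f p h) <= K * nm h.
Proof.
move=> df [r r0 fK] h.
have [->|h0] := eqVneq h 0; first by rewrite linear0 !nm0 mulr0.
have nh := nm_gt0 h0.
rewrite -ler_pdivrMr//; apply/ler_addgt0Pr => e e0; rewrite ler_pdivrMr//.
have [s s0 fs] := nm_diff df e0.
pose t := Num.min r s / 2 / nm h.
have m0 : 0 < Num.min r s by rewrite lt_min r0.
have t0 : 0 < t by rewrite !divr_gt0.
have nt : nm (t%:C *: h) = Num.min r s / 2.
  by rewrite nmZ nmC ger0_norm ?ltW// /t divfK// gt_eqF.
have mr : Num.min r s <= r by rewrite ge_min lexx.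
have ms : Num.min r s <= s by rewrite ge_min lexx orbT.
have E : p + t%:C *: h - p = t%:C *: h by rewrite addrAC subrr add0r.
have h1 := fK (p + t%:C *: h); rewrite E in h1.
have h2 := fs (p + t%:C *: h); rewrite E in h2.
have {}h1 := h1 ltac:(rewrite nt; lra).
have {}h2 := h2 ltac:(rewrite nt; lra).
have : nm ('d f p (t%:C *: h)) <= (K + e) * nm (t%:C *: h).
  have -> : 'd f p (t%:C *: h) = (f (p + t%:C *: h) - f p) -
      (f (p + t%:C *: h) - f p - 'd f p (t%:C *: h)) by rewrite subKr.
  by apply: (le_trans (nmB _ _)); rewrite mulrDl lerD.
rewrite linearZ/= !nmZ mulrCA ler_pM2l// nmC ger0_norm ?ltW//.
Qed.

End HolomorphicEstimates.
#[global] Opaque cauchy_cst.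

(** * Limits along ultrafilters *)

Section UltraLimits.
Context {R : realType}.
Implicit Types V W : normedModType R[i].

Lemma ultra_pushforward I (T : Type) (U : set_system I) (f : I -> T) :
  UltraFilter U -> UltraFilter (fun A : set T => U (f @^-1` A)).
Proof.
move=> UU; split.
  exact: (@fmap_proper_filter _ _ f U _).
move=> G PG UG; apply/seteqP; split => A; last exact: UG.
move=> GA; have [//|UnA] := in_ultra_setVsetC (f @^-1` A) UU.
have GnA : G (~` A) by exact: UG.
have : G set0 by rewrite -(setICr A); exact: filterI.
by move=> /filter_not_empty.
Qed.

Lemma ultra_limit I (T : topologicalType) (U : set_system I) (f : I -> T) K :
  UltraFilter U -> compact K -> U (f @^-1` K) ->
  exists2 l, K l & forall A, nbhs l A -> U (f @^-1` A).
Proof.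
move=> UU; rewrite compact_ultra => cK UK.
have [l [Kl fl]] := cK _ (ultra_pushforward f UU) UK.
by exists l => // A /fl.
Qed.

Lemma ball_compact n (M : R) : compact [set v : 'rV[R[i]]_n | nm v <= M].
Proof.
pose B : set R[i] := (fun p : R * R => p.1 +i* p.2) @` (`[-M, M] `*` `[-M, M]).
have cB : compact B.
  apply: continuous_compact; last by apply: compact_setX; exact: segment_compact.
  by apply: continuous_subspaceT; exact: Complex_continuous.
have cBn : compact [set v : 'rV[R[i]]_n | forall i, B (v ord0 i)].
  exact: (@rV_compact _ n (fun=> B)).
apply: subclosed_compact cBn _.
  move=> v clv; rewrite /= leNgt; apply/negP => Mv.
  have : nbhs v [set w | nm (w - v) < nm v - M].
    by apply/nm_nbhsP; exists (nm v - M) => //; rewrite subr_gt0.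
  move=> /clv[w [/= wM wv]].
  have := nmD w (v - w); rewrite addrC subrK nmBC; lra.
move=> v /= vM i; exists (complex.Re (v ord0 i), complex.Im (v ord0 i)).
  have nv : nm (v ord0 i) <= M by apply: (le_trans (nm_coord _ _)).
  by split; rewrite /= in_itv/= -ler_norml (le_trans _ nv)// ?nm_Re ?nm_Im.
by case: (v ord0 i).
Qed.

Lemma nm_dist_le V (x y : V) : (forall e, 0 < e -> nm (x - y) <= e) -> x = y.
Proof.
move=> h; apply/eqP; rewrite -subr_eq0; apply/eqP/nm_eq0/eqP.
rewrite eq_le nm_ge0 andbT; apply/ler_addgt0Pl => e e0.
by rewrite addr0 h.
Qed.

Lemma linear_of V W (L : V -> W) :
  (forall a u v, L (a *: u + v) = a *: L u + L v) ->
  exists L' : {linear V -> W}, L' =1 L.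
Proof.
move=> Llin; pose L' : {linear V -> W} :=
  HB.pack L (GRing.isLinear.Build R[i] V W *:%R L Llin).
by exists L'.
Qed.

(** Weierstrass' theorem on uniform limits. By the Lipschitz estimate the
differences [f i - f j] have small Lipschitz constants, hence the
differentials at [p] form a Cauchy family; their limit along the ultrafilter
is the differential of [g]. *)
Lemma weierstrass I (U : set_system I) V n (f : I -> V -> 'rV[R[i]]_n)
    (g : V -> 'rV[R[i]]_n) p r : UltraFilter U -> 0 < r ->
  U [set i | holo_on (f i) p r] ->
  (forall e, 0 < e ->
    U [set i | forall z, nm (z - p) < r -> nm (f i z - g z) <= e]) ->
  differentiable g p.
Proof.
move=> UU r0 df fg; have c0 := @cauchy_cst_gt0 R.
have pr : nm (p - p) < r by rewrite subrr nm0.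
(* Named, so that arithmetic treats the differentials as opaque. *)
have [D DE] : exists D : I -> V -> 'rV[R[i]]_n, forall i h, 'd (f i) p h = D i h.
  by exists (fun i h => 'd (f i) p h).
pose eLip e i := forall y, nm (y - p) < r ->
  nm ((g y - f i y) - (g p - f i p)) <= e * nm (y - p).
have lip e : 0 < e -> U [set i | eLip e i].
  move=> e0; pose e' := e * r / cauchy_cst / 2.
  have e'0 : 0 < e' by rewrite !divr_gt0// mulr_gt0.
  have Ue := fg _ e'0; apply: filterS (filterI df Ue) => i [dfi fi] y yp.
  apply/ler_addgt0Pl => e1 e10.
  have e12 : 0 < e1 / 2 by rewrite divr_gt0.
  have [j [[dfj fj] fj1]] := filter_ex (filterI (filterI df Ue) (fg _ e12)).
  have dij : holo_on (fun z => f j z - f i z) p r.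
    by move=> z zp; apply: differentiableB; [exact: dfj|exact: dfi].
  have bij z : nm (z - p) < r -> nm (f j z - f i z) <= 2 * e'.
    move=> zp; have := nm_tri (g z) (f j z) (f i z).
    by have := fj z zp; have := fi z zp; rewrite (nmBC (g z)); lra.
  have := @holo_lipschitz _ _ _ _ p r _ p y r0 dij bij _ yp.
  rewrite subrr nm0 divr_gt0// => /(_ isT).
  have -> : cauchy_cst * (2 * e') / r * nm (y - p) = e * nm (y - p).
    by rewrite /e'; field; rewrite !gt_eqF.
  have := fj1 y yp; have := fj1 p pr.
  set A := f j y - f i y - (f j p - f i p).
  have -> : g y - f i y - (g p - f i p) =
      A - ((f j y - g y) - (f j p - g p)).
    rewrite /A; apply/rowP => k; rewrite !mxE; ring.
  have := nmB A ((f j y - g y) - (f j p - g p)).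
  by have := nmB (f j y - g y) (f j p - g p); lra.
have dd i j e : holo_on (f i) p r -> holo_on (f j) p r ->
    eLip e i -> eLip e j ->
    forall h, nm (D i h - D j h) <= 2 * e * nm h.
  move=> dfi dfj li lj h.
  have di := dfi _ pr; have dj := dfj _ pr; rewrite -!DE.
  have -> : 'd (f i) p h - 'd (f j) p h = 'd (f i - f j) p h.
    by have := congr1 (fun k : V -> 'rV[R[i]]_n => k h) (diffB di dj).
  apply: differentiable_nm_le; first exact: differentiableB.
  exists r => // y yp; rewrite !fctE.
  have := li y yp; have := lj y yp.
  set X := g y - f j y - _; set Y := g y - f i y - _.
  have -> : f i y - f j y - (f i p - f j p) = X - Y.
    by rewrite /X /Y; apply/rowP => k; rewrite !mxE; ring.
  by have := nmB X Y; lra.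
have [i0 [df0 l0]] := filter_ex (filterI df (lip 1 ltr01)).
have [K K0 dK] : exists2 K, 0 < K & forall h, nm (D i0 h) <= K * nm h.
  have [K K0 dK] := nm_linear (diff_continuous (df0 _ pr)).
  by exists K => // h; have := dK h; rewrite DE.
have limL h : exists l, forall e, 0 < e ->
    U [set i | nm (D i h - l) < e].
  have [||l _ lU] := @ultra_limit I _ U (fun i => D i h)
      [set v | nm v <= (K + 2) * nm h] UU.
  - exact: ball_compact.
  - apply: filterS (filterI df (lip 1 ltr01)) => i [dfi li] /=.
    have := dd i i0 1 dfi df0 li l0 h; have := dK h.
    by have := nm_le_sub (D i h) (D i0 h); lra.
  exists l => e e0; apply: (lU [set v | nm (v - l) < e]).
  by apply/nm_nbhsP; exists e.
have [L LU] := choice limL.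
have Lapp e : 0 < e -> U [set i | holo_on (f i) p r /\
    (eLip e i /\ forall h, nm (D i h - L h) <= 2 * e * nm h)].
  move=> e0; apply: filterS (filterI df (lip e e0)) => i [dfi li]; split => //; split => // h.
  apply/ler_addgt0Pl => e1 e10.
  have [j [[dfj lj] lj1]] := filter_ex (filterI (filterI df (lip e e0)) (LU h _ e10)).
  have := dd i j e dfi dfj li lj h.
  by have := nm_tri (D j h) (D i h) (L h); move: lj1 => /=; lra.
have Llin a u v : L (a *: u + v) = a *: L u + L v.
  apply: nm_dist_le => e e0.
  have na := nm_ge0 a.
  have e1 : 0 < e / (nm a + 2) by rewrite divr_gt0//; lra.
  have [i [/= [h1 h2] h3]] := filter_ex (filterI (filterI (LU (a *: u + v) _ e1)
    (LU u _ e1)) (LU v _ e1)).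
  have -> : L (a *: u + v) - (a *: L u + L v) =
     - (D i (a *: u + v) - L (a *: u + v)) +
     (a *: (D i u - L u) + (D i v - L v)).
    have -> : D i (a *: u + v) = a *: D i u + D i v by rewrite -!DE linearP.
    by apply/rowP => k; rewrite !mxE; ring.
  have := nmD (- (D i (a *: u + v) - L (a *: u + v)))
     (a *: (D i u - L u) + (D i v - L v)).
  have := nmD (a *: (D i u - L u)) (D i v - L v).
  rewrite nmN nmZ.
  have E : e = (nm a + 2) * (e / (nm a + 2)) by field; rewrite gt_eqF//; lra.
  set d := e / (nm a + 2) in h1 h2 h3 E e1 *.
  have : nm a * nm (D i u - L u) <= nm a * d by rewrite ler_wpM2l// ltW.
  by nra.
have [L' L'E] := linear_of Llin.
have [i1 [df1 [l1 d1]]] := filter_ex (Lapp 1 ltr01).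
have [K1 K10 dK1] : exists2 K, 0 < K & forall h, nm (D i1 h) <= K * nm h.
  have [K' K'0 dK'] := nm_linear (diff_continuous (df1 _ pr)).
  by exists K' => // h; have := dK' h; rewrite DE.
apply: (@nm_differentiable _ _ _ g p L' (K1 + 2) _ _).1.
  move=> h; rewrite L'E; have := d1 h; have := dK1 h.
  have := nm_le_sub (L h) (D i1 h).
  by rewrite nmBC; lra.
move=> e e0.
have e4 : 0 < e / 4 by rewrite divr_gt0.
have [i [dfi [li di]]] := filter_ex (Lapp (e / 4) e4).
have [s s0 fs] : exists2 s, 0 < s & forall y, nm (y - p) < s ->
    nm (f i y - f i p - D i (y - p)) <= e / 4 * nm (y - p).
  have [s s0 fs] := nm_diff (dfi _ pr) (e := e / 4) e4.
  by exists s => // y ys; have := fs y ys; rewrite DE.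
exists (Num.min r s); first by rewrite lt_min r0.
move=> y; rewrite lt_min => /andP[yr ys]; rewrite L'E.
set h := y - p.
have -> : g y - g p - L h = (g y - f i y - (g p - f i p)) +
   (f i y - f i p - D i h) + (D i h - L h).
  by apply/rowP => k; rewrite !mxE; ring.
have := li y yr; have := fs y ys; have := di h; rewrite -/h.
have := nmD ((g y - f i y - (g p - f i p)) + (f i y - f i p - D i h))
  (D i h - L h).
have := nmD (g y - f i y - (g p - f i p)) (f i y - f i p - D i h).
by lra.
Qed.

End UltraLimits.

(** * Compact metrisable targets *)

Lemma exists_free_ultrafilter : exists2 U : set_system nat,
  UltraFilter U & forall A, (\forall j \near \oo, A j) -> U A.
Proof.
by have [U [UU sU]] := @ultraFilterLemma nat \oo _; exists U.
Qed.

Section MetricTarget.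
Context {R : realType} {N : topologicalType}.
Variable d : N -> N -> R.
Hypothesis dd : is_distance d.

Lemma dist_ge0 x y : 0 <= d x y.
Proof. by case: dd => h _ _ _; case: (h x y). Qed.

Lemma dist_refl x : d x x = 0.
Proof. by case: dd => h _ _ _; case: (h x x) => _ ->. Qed.

Lemma dist_eq0 x y : d x y = 0 -> x = y.
Proof. by case: dd => h _ _ _; case: (h x y) => _ ->. Qed.

Lemma distC x y : d x y = d y x.
Proof. by case: dd. Qed.

Lemma dist_tri y x z : d x z <= d x y + d y z.
Proof. by case: dd. Qed.

Lemma dist_nbhsP x (A : set N) :
  nbhs x A <-> exists2 e, 0 < e & [set y | d x y < e] `<=` A.
Proof. by case: dd. Qed.

Lemma dist_ball x e : 0 < e -> nbhs x [set y | d x y < e].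
Proof. by move=> e0; apply/dist_nbhsP; exists e. Qed.

Lemma dist_closed_ball x e : closed [set y | d x y <= e].
Proof.
move=> y cly; rewrite /= leNgt; apply/negP => xy.
have : nbhs y [set z | d y z < d x y - e] by apply: dist_ball; rewrite subr_gt0.
move=> /cly[z [/= xz yz]]; have := dist_tri z x y; rewrite (distC z y); lra.
Qed.

Hypothesis cN : compact [set: N].

Lemma dist_ball_compact x e : compact [set y | d x y <= e].
Proof. by apply: subclosed_compact cN _ => //; exact: dist_closed_ball. Qed.

(** Values converge along the ultrafilter because the target is compact, and
equicontinuity makes the convergence uniform on compact sets. Working along an
ultrafilter avoids the extraction of diagonal subsequences. *)
Lemma ultra_ascoli I (U : set_system I) (T : topologicalType)
    (f : I -> T -> N) : UltraFilter U ->
  (forall x e, 0 < e -> exists2 W, nbhs x W &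
     U [set i | forall y, W y -> d (f i x) (f i y) < e]) ->
  exists2 g : T -> N, continuous g & forall K, compact K -> forall e, 0 < e ->
     U [set i | forall y, K y -> d (f i y) (g y) < e].
Proof.
move=> UU ef.
have lim x : exists l, forall e, 0 < e -> U [set i | d (f i x) l < e].
  have [|l _ lU] := @ultra_limit I N U (fun i => f i x) setT UU cN.
    exact: filterS filterT.
  exists l => e e0; have := lU _ (dist_ball l e0); apply: filterS => i /=.
  by rewrite distC.
have [g gU] := choice lim.
have cg x e : 0 < e -> nbhs x [set y | d (g x) (g y) < e].
  move=> e0; have e3 : 0 < e / 3 by rewrite divr_gt0.
  have [W xW UW] := ef x _ e3; apply: filterS xW => y Wy /=.
  have [i [[/= i1 i2] i3]] :=
    filter_ex (filterI (filterI UW (gU x _ e3)) (gU y _ e3)).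
  have := i1 y Wy; have := dist_tri (f i x) (g x) (g y).
  by have := dist_tri (f i y) (f i x) (g y); rewrite (distC (g x) (f i x)); lra.
exists g.
  move=> x A /dist_nbhsP[e e0 eA]; apply: filterS (cg x _ e0) => y; exact: eA.
move=> K /compact_near_coveringP cK e e0.
have e3 : 0 < e / 3 by rewrite divr_gt0.
have h x : K x -> \forall y \near x & i \near U, d (f i y) (g y) < e.
  move=> Kx; have [W xW UW] := ef x _ e3.
  exists (W `&` [set y | d (g x) (g y) < e / 3],
    [set i | forall y, W y -> d (f i x) (f i y) < e / 3] `&`
    [set i | d (f i x) (g x) < e / 3]) => /=.
    by split; apply: filterI => //; [exact: cg|exact: gU].
  move=> [y i] [/= [Wy gy] [iW ix]] /=.
  have := iW y Wy; have := dist_tri (f i x) (f i y) (g y).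
  by have := dist_tri (g x) (f i x) (g y); rewrite (distC (f i y) (f i x)); lra.
have FU : Filter U by exact: filter_filter.
exact: cK _ U (fun i y => d (f i y) (g y) < e) FU h.
Qed.

Variables (V : normedModType R[i]) (c : N -> V) (K : set N).
Hypothesis cK : compact K.
Hypothesis cc : forall p, K p -> {for p, continuous c}.

Lemma compact_nm_bounded : exists M, forall p, K p -> nm (c p) <= M.
Proof.
have /compact_near_coveringP cov := cK.
have h x : K x -> \forall y \near x & k \near \oo, nm (c y) <= k%:R.
  move=> Kx; have W := cc Kx (nm_ball_nbhs (c x) ltr01).
  exists ([set y | nm (c y - c x) < 1],
          [set k | (Num.bound (nm (c x) + 1) <= k)%N]) => /=.
    by split => //; exact: nbhs_infty_ge.
  move=> [y k] [/= yx kb] /=.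
  have b0 : 0 <= nm (c x) + 1 by have := nm_ge0 (c x); lra.
  have := archi_boundP b0; have : (Num.bound (nm (c x) + 1))%:R <= k%:R :> R.
    by rewrite ler_nat.
  by have := nm_le_sub (c y) (c x); lra.
have := cov _ \oo (fun k y => nm (c y) <= k%:R) _ h.
move=> [k _ /(_ k (leqnn k)) kK]; exists k%:R => p Kp; exact: kK.
Qed.

Lemma compact_unif_cont e : 0 < e -> exists2 t, 0 < t & forall p q, K p -> K q ->
  d p q < t -> nm (c p - c q) < e.
Proof.
move=> e0; have /compact_near_coveringP cov := cK.
have e2 : 0 < e / 2 by rewrite divr_gt0.
have h x : K x -> \forall y \near x & k \near \oo,
    forall q, d y q < k.+1%:R^-1 -> nm (c y - c q) < e.
  move=> Kx; have W : nbhs x [set y | nm (c y - c x) < e / 2].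
    exact: cc Kx _ (nm_ball_nbhs (c x) e2).
  have [r [r0 rW]] : exists r : R, 0 < r /\
      [set y | d x y < r] `<=` [set y | nm (c y - c x) < e / 2].
    by have [r r0 rW] := iffLR (dist_nbhsP _ _) W; exists r.
  have r2 : 0 < r / 2 by rewrite divr_gt0.
  exists ([set y | d x y < r / 2], [set k : nat | k.+1%:R^-1 < r / 2]) => /=.
    split; first exact: dist_ball.
    exact: near_infty_natSinv_lt (PosNum r2).
  move=> [y k] [/= xy k2] q yq; have yq2 : d y q < r / 2 := lt_trans yq k2.
  have hy : nm (c y - c x) < e / 2 by apply: rW; rewrite /=; lra.
  have hq : nm (c q - c x) < e / 2.
    by apply: rW; have := dist_tri y x q; rewrite /=; lra.
  by have := nm_tri (c x) (c y) (c q); rewrite (nmBC (c x)); lra.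
have := cov _ \oo (fun k y => forall q, d y q < k.+1%:R^-1 -> nm (c y - c q) < e) _ h.
move=> [k _ /(_ k (leqnn k)) kP]; exists k.+1%:R^-1; first by rewrite invr_gt0.
by move=> p q Kp _; exact: kP.
Qed.

Hypothesis ic : {in K &, injective c}.

(** The inverse of a continuous injection of a compact set is uniformly
continuous: offending pairs would accumulate at two distinct points with the
same image. *)
Lemma compact_inv_unif_cont e : 0 < e -> exists2 t, 0 < t & forall p q, K p -> K q ->
  nm (c p - c q) < t -> d p q < e.
Proof.
move=> e0; apply: contrapT => nex.
have bad (k : nat) : exists pq : N * N, [/\ K pq.1, K pq.2,
    nm (c pq.1 - c pq.2) < k.+1%:R^-1 & e <= d pq.1 pq.2].
  apply: contrapT => nb; apply: nex; exists k.+1%:R^-1; first by rewrite invr_gt0.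
  move=> p q Kp Kq pq; rewrite ltNge; apply/negP => pe; apply: nb.
  by exists (p, q).
have [pq pqP] := choice bad.
have [U UU Uoo] := exists_free_ultrafilter.
have UK : U [set k | K (pq k).1].
  by apply: filterS (filterT : U setT) => k _; case: (pqP k).
have UK' : U [set k | K (pq k).2].
  by apply: filterS (filterT : U setT) => k _; case: (pqP k).
have [p Kp pU] := ultra_limit UU cK UK; have [q Kq qU] := ultra_limit UU cK UK'.
have E : p = q.
  apply: ic; rewrite ?inE//; apply: nm_dist_le => t t0.
  have t3 : 0 < t / 3 by rewrite divr_gt0.
  have Ut : U [set k | k.+1%:R^-1 < t / 3 :> R].
    by apply: Uoo; exact: near_infty_natSinv_lt (PosNum t3).
  have W := cc Kp (nm_ball_nbhs (c p) t3).
  have W' := cc Kq (nm_ball_nbhs (c q) t3).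
  have [k [[/= k1 k2] k3]] := filter_ex (filterI (filterI (pU _ W) (qU _ W')) Ut).
  have [_ _ k4 _] := pqP k; have k5 := lt_trans k4 k3.
  have := nm_tri (c (pq k).1) (c p) (c q).
  have := nm_tri (c (pq k).2) (c (pq k).1) (c q).
  by rewrite (nmBC (c p) (c (pq k).1)); clear -k1 k2 k5; lra.
have e2 : 0 < e / 2 by rewrite divr_gt0.
have [k [/= k1 k2]] := filter_ex (filterI (pU _ (dist_ball p e2)) (qU _ (dist_ball q e2))).
have [_ _ _ k4] := pqP k.
have := dist_tri p (pq k).1 (pq k).2; rewrite (distC _ p) E -{1}E.
by lra.
Qed.

End MetricTarget.

Arguments dist_ball_compact {R N d} dd cN x e.
Arguments dist_closed_ball {R N d} dd x e.

(** * Holomorphic maps from normed spaces to complex manifolds *)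

Section HolAt.
Context {R : realType} {n : nat} {N : complexManifoldType R n}.
Implicit Types V W : normedModType R[i].
Implicit Types c : chart N 'rV[R[i]]_n.

(** Maps out of a normed space are all that is needed: maps between manifolds
are composed with an inverse chart. The pointwise form allows maps that are
holomorphic on a small ball only. *)
Definition hol_at V (f : V -> N) (x : V) := {for x, continuous f} /\
  forall b, chart_around (f x) b -> differentiable (coord b \o f) x.

Lemma chart_dom_nbhs (q : N) c : chart_around q c -> nbhs q (dom c).
Proof.
move=> [Ac cq]; have [oc _ _ _] := atlas_chart _ Ac.
exact: open_nbhs_nbhs.
Qed.

Lemma chart_continuous (q : N) c : chart_around q c ->
  {for q, continuous (coord c)}.
Proof. by move=> [Ac cq]; have [_ _ h _] := atlas_chart _ Ac; exact: h. Qed.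

Lemma chart_image_nbhs (q : N) c A : chart_around q c -> nbhs q A ->
  nbhs (coord c q) (coord c @` (dom c `&` A)).
Proof.
move=> qc; rewrite nbhsE => -[B [oB Bq] BA].
have [oc _ _ op] := atlas_chart _ qc.1.
have : nbhs (coord c q) (coord c @` (dom c `&` B)).
  apply: open_nbhs_nbhs; split.
    by apply: op; [exact: openI|move=> ? []].
  by exists q => //; split => //; exact: qc.2.
by apply: filterS => _ [z [cz Bz] <-]; exists z => //; split => //; exact: BA.
Qed.

Lemma in_chart_comp V (f : V -> N) (E' : nmodType) (g : N -> E') (x : V) c :
  {for x, continuous f} -> chart_around (f x) c ->
  \forall y \near x, (in_chart c g \o (coord c \o f)) y = g (f y).
Proof.
move=> cf fc; have h : nbhs x [set y | dom c (f y)] := cf _ (chart_dom_nbhs fc).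
apply: filterS h => y cy /=.
by apply: in_chartE; split => //; exact: fc.1.
Qed.

Lemma hol_at_chart V (f : V -> N) x c : {for x, continuous f} ->
  chart_around (f x) c -> differentiable (coord c \o f) x -> hol_at f x.
Proof.
move=> cf fc df; split => // b fb.
have dt := atlas_compat _ _ fc.1 fb.1 _ fc.2 fb.2.
apply: (near_eq_diff (in_chart_comp (coord b) cf fc) _).1.
exact: differentiable_comp.
Qed.

Lemma hol_at_comp V W (g : V -> W) (f : W -> N) x : differentiable g x ->
  hol_at f (g x) -> hol_at (f \o g) x.
Proof.
move=> dg [cf df]; have cg := differentiable_continuous dg; split.
  exact: continuous_comp.
by move=> b fb; exact: (@differentiable_comp _ _ _ _ g (coord b \o f) x dg (df b fb)).
Qed.

Lemma hol_at_near V (f g : V -> N) x : (\forall y \near x, f y = g y) ->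
  hol_at f x -> hol_at g x.
Proof.
move=> fg [cf df]; have fgx := nbhs_singleton fg; split.
  move=> A gA; have fA : nbhs (f x) A by rewrite fgx.
  have h : nbhs x [set y | A (f y)] := cf _ fA.
  by apply: filterS (filterI fg h) => y [/= <-].
move=> b; rewrite -fgx => /df dfb; apply: (near_eq_diff _ dfb).1.
by apply: filterS fg => y /= ->.
Qed.

Definition chart_inv c (p0 : N) (u : 'rV[R[i]]_n) : N :=
  xget p0 [set q | dom c q /\ coord c q = u].

Lemma chart_invK c p0 q : chart_around q c -> chart_inv c p0 (coord c q) = q.
Proof.
move=> [Ac cq]; have [_ inj _ _] := atlas_chart _ Ac.
rewrite /chart_inv; case: xgetP => [y _ [cy e]|/(_ q)[]//].
by apply: inj => //; rewrite inE.
Qed.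

Lemma chart_inv_near c p0 q A : chart_around q c -> nbhs q A ->
  \forall u \near coord c q, [/\ chart_around (chart_inv c p0 u) c,
     coord c (chart_inv c p0 u) = u & A (chart_inv c p0 u)].
Proof.
move=> qc qA; apply: filterS (chart_image_nbhs qc qA) => _ [z [cz Az] <-].
have zc : chart_around z c by split => //; exact: qc.1.
by rewrite chart_invK.
Qed.

Lemma hol_at_chart_inv c p0 q : chart_around q c ->
  hol_at (chart_inv c p0) (coord c q).
Proof.
move=> qc; have E := chart_invK p0 qc; apply: (@hol_at_chart _ _ _ c).
- move=> A qA; have {}qA : nbhs q A by rewrite -E.
  by apply: filterS (chart_inv_near p0 qc qA) => u [].
- by rewrite E.
have did : differentiable (id : 'rV[R[i]]_n -> _) (coord c q) by [].
apply: (near_eq_diff _ did).1.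
by apply: filterS (chart_inv_near p0 qc filterT) => u [_ /= -> _].
Qed.

End HolAt.

Lemma hol_at_map (R : realType) (m n : nat) (M : complexManifoldType R m)
    (N : complexManifoldType R n) (F : M -> N) (V : normedModType R[i])
    (f : V -> M) (x : V) : holomorphic (@atlas R m M) (@atlas R n N) F ->
  hol_at f x -> hol_at (F \o f) x.
Proof.
move=> [cF dF] [cf df].
have [a fa] := exists_chart_around (f x).
have [b fb] := exists_chart_around (F (f x)).
apply: (@hol_at_chart _ _ _ _ _ _ b) => //.
  by apply: continuous_comp => //; exact: cF.
have d1 := dF a b (f x) fa.1 fb.1 fa.2 fb.2.
apply: (near_eq_diff (in_chart_comp (coord b \o F) cf fa) _).1.
exact: (differentiable_comp (df a fa) d1).
Qed.

Lemma hol_at_mul (R : realType) (m : nat) (G : complexLieGroupType R m)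
    (V : normedModType R[i]) (f g : V -> G) (x : V) :
  hol_at f x -> hol_at g x -> hol_at (fun y => f y * g y)%g x.
Proof.
move=> [cf df] [cg dg].
have [cm dm] := @mulg_holomorphic R m G.
have cfg : {for x, continuous (fun y => (f y, g y))} by exact: cvg_pair.
have [a fa] := exists_chart_around (f x).
have [b gb] := exists_chart_around (g x).
have [c fgc] := exists_chart_around (f x * g x)%g.
apply: (@hol_at_chart _ _ _ _ _ _ c) => //.
  exact: (@continuous_comp _ _ _ (fun y => (f y, g y)) (fun p => p.1 * p.2)%g _ cfg (cm _)).
pose ab := Chart (dom a `*` dom b) (fun p : G * G => (coord a p.1, coord b p.2)).
have d1 : differentiable (in_chart ab (coord c \o (fun p : G * G => p.1 * p.2)%g))
    (coord a (f x), coord b (g x)).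
  apply: (dm ab c (f x, g x)) => //; last exact: fgc.2.
  - by exists a, b; split => //; [exact: fa.1|exact: gb.1].
  - exact: fgc.1.
  - by split; [exact: fa.2|exact: gb.2].
have d2 : differentiable (fun y => (coord a (f y), coord b (g y))) x.
  exact: (@differentiable_pair _ _ _ _ (coord a \o f) (coord b \o g) x (df a fa) (dg b gb)).
apply: (near_eq_diff _ (differentiable_comp d2 d1)).1.
have na : nbhs x [set y | dom a (f y)] := cf _ (chart_dom_nbhs fa).
have nb : nbhs x [set y | dom b (g y)] := cg _ (chart_dom_nbhs gb).
apply: filterS (filterI na nb) => y [/= ya yb].
rewrite /in_chart; case: xgetP => [z _ [[p q] [[/= pa qb] [ep eq_]] <-]|
    /(_ (coord c (f y * g y)%g))[]]; last by exists (f y, g y).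
have [_ ia _ _] := atlas_chart _ fa.1; have [_ ib _ _] := atlas_chart _ gb.1.
by congr (coord c (_ * _)%g); [apply: ia|apply: ib] => //; rewrite inE.
Qed.

Section ChartModulus.
Context {R : realType} {n : nat} {N : complexManifoldType R n}.
Variable d : N -> N -> R.
Hypotheses (dd : is_distance d) (cN : compact [set: N]).
Implicit Type V : normedModType R[i].

(** A Lebesgue number for a finite choice of charts: balls of radius [dl] lie in
one of finitely many compact coordinate patches, on which the charts are
bounded and their inverses uniformly continuous. *)
Lemma chart_modulus : exists dl M, 0 < dl /\ forall e, 0 < e ->
  exists2 t, 0 < t & forall y, exists2 b, atlas b &
    forall p q, d y p < dl -> d y q < dl ->
      [/\ dom b p, nm (coord b p) <= M &
          nm (coord b p - coord b q) < t -> d p q < e].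
Proof.
have local (y : N) : exists brM : chart N 'rV[R[i]]_n * (R * R),
    [/\ atlas brM.1, 0 < brM.2.1, [set q | d y q <= brM.2.1] `<=` dom brM.1 &
    forall q, d y q <= brM.2.1 -> nm (coord brM.1 q) <= brM.2.2].
  have [b yb] := exists_chart_around y.
  have /(dist_nbhsP dd)[r r0 rb] := chart_dom_nbhs yb.
  have sub : [set q | d y q <= r / 2] `<=` dom b.
    by move=> q /= yq; apply: rb => /=; lra.
  have cc q : [set q | d y q <= r / 2] q -> {for q, continuous (coord b)}.
    by move=> yq; apply: chart_continuous; split; [exact: yb.1|exact: sub].
  have [M MP] := @compact_nm_bounded R N _ (coord b) _
    (dist_ball_compact dd cN y (r / 2)) cc.
  by exists (b, (r / 2, M)) => /=; split => //; [exact: yb.1|rewrite divr_gt0].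
have [D DP] := choice local.
pose b y := (D y).1; pose r y := (D y).2.1; pose M y := (D y).2.2.
have bA y : atlas (b y) by case: (DP y).
have r0 y : 0 < r y by case: (DP y).
have bD y q : d y q <= r y -> dom (b y) q by case: (DP y) => _ _ h _; exact: h.
have bM y q : d y q <= r y -> nm (coord (b y) q) <= M y.
  by case: (DP y) => _ _ _ h; exact: h.
have /compact_near_coveringP cov := cN.
have [k0 kP] : exists k : nat, forall y, exists y0,
    d y0 y + k.+1%:R^-1 <= r y0 /\ M y0 <= k%:R.
  have := cov _ \oo (fun k y => exists y0,
    d y0 y + k.+1%:R^-1 <= r y0 /\ M y0 <= k%:R) _.
  case=> [y _|k _ kP]; last by exists k => y; exact: (kP k (leqnn k) y I).
  have r2 : 0 < r y / 2 by rewrite divr_gt0.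
  exists ([set q | d y q < r y / 2], [set k : nat | k.+1%:R^-1 < r y / 2 /\
      (Num.bound `|M y| <= k)%N]) => /=.
    split; first exact: dist_ball.
    apply: filterI; first exact: near_infty_natSinv_lt (PosNum r2).
    exact: nbhs_infty_ge.
  move=> [q k] [/= yq [k1 k2]]; exists y; split.
    by apply: (le_trans (lerD (ltW yq) (ltW k1))); lra.
  have := archi_boundP (normr_ge0 (M y)); have := ler_norm (M y).
  have : (Num.bound `|M y|)%:R <= k%:R :> R by rewrite ler_nat.
  by lra.
set h := k0.+1%:R^-1 : R; have h0 : 0 < h by rewrite invr_gt0.
exists (h / 2), k0%:R; split; first by rewrite divr_gt0.
move=> e e0.
have modulus y : exists2 t, 0 < t & forall p q, d y p <= r y -> d y q <= r y ->
    nm (coord (b y) p - coord (b y) q) < t -> d p q < e.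
  apply: (compact_inv_unif_cont dd (dist_ball_compact dd cN y (r y))) => //.
    by move=> p yp; apply: chart_continuous; split; [exact: bA|exact: bD].
  move=> p q; rewrite !inE => yp yq E.
  have [_ inj _ _] := atlas_chart _ (bA y).
  by apply: inj => //; rewrite inE; exact: bD.
have modulus' y : exists t, 0 < t /\ forall p q, d y p <= r y -> d y q <= r y ->
    nm (coord (b y) p - coord (b y) q) < t -> d p q < e.
  by have [t t0 tP] := modulus y; exists t.
have [t tP] := choice modulus'.
have [j jP] : exists j : nat, forall y, exists y0,
    [/\ d y0 y + h / 2 <= r y0, M y0 <= k0%:R & j.+1%:R^-1 <= t y0].
  have := cov _ \oo (fun j y => exists y0,
    [/\ d y0 y + h / 2 <= r y0, M y0 <= k0%:R & j.+1%:R^-1 <= t y0]) _.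
  case=> [y _|j _ jP]; last by exists j => y; exact: (jP j (leqnn j) y I).
  have [y0 [y1 y2]] := kP y; have [ty _] := tP y0.
  have h2 : 0 < h / 2 by rewrite divr_gt0.
  exists ([set q | d y q < h / 2], [set j : nat | j.+1%:R^-1 < t y0]) => /=.
    split; first exact: dist_ball.
    exact: near_infty_natSinv_lt (PosNum ty).
  move=> [q j] [/= yq jt]; exists y0; split => //; last exact: ltW.
  by have := dist_tri dd y y0 q; rewrite -/h in y1; lra.
exists j.+1%:R^-1; first by rewrite invr_gt0.
move=> y; have [y0 [y1 y2 y3]] := jP y; exists (b y0) => // p q yp yq.
have h1 : d y0 p <= r y0 by have := dist_tri dd y y0 p; lra.
have h2 : d y0 q <= r y0 by have := dist_tri dd y y0 q; lra.
split; [exact: bD|by apply: (le_trans (bM _ _ h1))|].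
by move=> pq; apply: (tP y0).2 => //; exact: lt_le_trans y3.
Qed.

(** Montel's theorem for maps whose values stay in a small ball: read in the
chart on that ball they are uniformly bounded, so the Lipschitz estimate
gives a modulus of continuity that depends on neither the map nor the point. *)
Lemma montel_modulus : exists2 dl, 0 < dl & forall e r, 0 < e -> 0 < r ->
  exists2 s, 0 < s & forall V (f : V -> N) p,
    (forall z, nm (z - p) < r -> hol_at f z) ->
    (forall z, nm (z - p) < r -> d (f p) (f z) < dl) ->
    forall z, nm (z - p) < s -> d (f p) (f z) < e.
Proof.
have [dl [M [dl0 mod_]]] := chart_modulus; exists dl => // e r e0 r0.
have [t t0 tP] := mod_ e e0.
pose c := cauchy_cst * `|M| / r + 1.
have c0 : 0 < c.
  rewrite /c ltr_wpDl//; apply: divr_ge0; last exact: ltW.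
  by apply: mulr_ge0 => //; exact/ltW/cauchy_cst_gt0.
exists (Num.min r (t / c)); first by rewrite lt_min r0 divr_gt0.
move=> V f p hf df z; rewrite lt_min => /andP[zr zt].
have [b Ab bP] := tP (f p).
have pp : d (f p) (f p) < dl by rewrite (dist_refl dd).
have [_ _] := bP _ _ pp (df z zr); apply.
have hol : holo_on (coord b \o f) p r.
  move=> w wr; apply: (hf w wr).2; split => //.
  by have [] := bP _ _ (df w wr) pp.
have bd w : nm (w - p) < r -> nm ((coord b \o f) w) <= `|M|.
  move=> wr; have [_ h _] := bP _ _ (df w wr) pp.
  exact: (le_trans h (ler_norm _)).
have r2 : 0 < r / 2 by rewrite divr_gt0.
have := holo_lipschitz r0 hol bd (x := p) (y := z).
rewrite subrr nm0 => /(_ r2 zr) /= h; rewrite nmBC; apply: (le_lt_trans h).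
rewrite ltr_pdivlMr// in zt; apply: le_lt_trans zt.
rewrite mulrC; apply: ler_wpM2l; first exact: nm_ge0.
by rewrite /c lerDl.
Qed.

Lemma weierstrass_manifold I (U : set_system I) V (f : I -> V -> N) (g : V -> N)
    p r : UltraFilter U -> 0 < r ->
  U [set i | forall z, nm (z - p) < r -> hol_at (f i) z] ->
  (forall e, 0 < e -> U [set i | forall z, nm (z - p) < r -> d (f i z) (g z) < e]) ->
  {for p, continuous g} -> hol_at g p.
Proof.
move=> UU r0 hf fg cg; split=> // b gb.
have /(dist_nbhsP dd)[s s0 sb] := chart_dom_nbhs gb.
have s2 : 0 < s / 2 by rewrite divr_gt0.
have s4 : 0 < s / 4 by rewrite divr_gt0.
pose K := [set q | d (g p) q <= s / 2].
have Kb : K `<=` dom b by move=> q /= Kq; apply: sb => /=; rewrite /K/= in Kq; lra.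
have cK : compact K by exact: dist_ball_compact.
have cb q : K q -> {for q, continuous (coord b)}.
  by move=> Kq; apply: chart_continuous; split; [exact: gb.1|exact: Kb].
have /nm_nbhsP[r1 r10 r1P] := cg _ (dist_ball dd (g p) s4).
pose r2 := Num.min r r1; have r20 : 0 < r2 by rewrite lt_min r0.
have in_ z : nm (z - p) < r2 -> nm (z - p) < r /\ nm (z - p) < r1.
  by rewrite lt_min => /andP.
have gK z : nm (z - p) < r2 -> d (g p) (g z) < s / 4.
  by move=> /in_[_ /r1P].
have fK : U [set i | forall z, nm (z - p) < r2 -> K (f i z)].
  apply: filterS (fg _ s4) => i fi z zp; rewrite /K/=.
  have := fi z (in_ z zp).1; have := gK z zp.
  have := dist_tri dd (g z) (g p) (f i z); rewrite (distC dd (g z)).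
  by lra.
apply: (@weierstrass R I U V n (fun i => coord b \o f i) (coord b \o g) p r2) => //.
  apply: filterS (filterI fK hf) => i [iK ih] z zp.
  by apply: (ih z (in_ z zp).1).2; split; [exact: gb.1|exact/Kb/iK].
move=> e e0.
have [t t0 tP] := compact_unif_cont dd cK cb e0.
apply: filterS (filterI fK (fg _ t0)) => i [iK it] z zp.
apply/ltW/tP; [exact: iK| |exact: it z (in_ z zp).1].
by rewrite /K/=; have := gK z zp; lra.
Qed.

End ChartModulus.

(** * Iterated square roots in a local group *)

Definition halve {R : realType} {m : nat} (x : 'rV[R[i]]_m) : 'rV[R[i]]_m :=
  (2^-1 : R)%:C *: x.

Section LocalSquaring.
Context {R : realType} {m : nat}.
Notation V := 'rV[R[i]]_m.
Variables (s : V -> V) (r K : R).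
Hypotheses (r0 : 0 < r) (K0 : 0 < K).
Hypothesis s_double : forall x, nm x < r -> nm (s x - 2%:R *: x) <= K * nm x ^+ 2.
Hypothesis s_lip : forall x y, nm x < r -> nm y < r ->
  nm (s x - s y) <= 3 * nm (x - y).

Lemma nm_half (x : V) : nm (halve x) = nm x / 2.
Proof. by rewrite /halve nmZ nmC ger0_norm ?invr_ge0// mulrC. Qed.

Lemma double_half (x : V) : 2%:R *: halve x = x.
Proof.
rewrite /halve scalerA -(rmorph_nat (@real_complex_def R (Phant R))) -rmorphM/=.
by rewrite divff ?scale1r// pnatr_eq0.
Qed.

(** Two square-root trees that agree to second order at the origin agree: each
halving of the argument contracts their distance by 3/4. *)
Lemma squaring_unique (F F' : V -> V) A e :
  (forall x, nm x < e -> [/\ F x = s (F (halve x)), nm (F x) < r &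
     [/\ F' x = s (F' (halve x)), nm (F' x) < r &
     nm (F x - F' x) <= A * nm x ^+ 2]]) ->
  forall x, nm x < e -> F x = F' x.
Proof.
move=> H.
have half_lt (x : V) : nm x < e -> nm (halve x) < e.
  by move=> xe; rewrite nm_half; have := nm_ge0 x; lra.
have key k (x : V) : nm x < e -> nm (F x - F' x) <= A * (3 / 4) ^+ k * nm x ^+ 2.
  elim: k x => [|k IH] x xe; first by rewrite expr0 mulr1; case: (H x xe) => _ _ [].
  have [-> _ [-> _ _]] := H x xe.
  have [_ h1 [_ h2 _]] := H _ (half_lt _ xe).
  apply: (le_trans (s_lip h1 h2)); have := IH _ (half_lt _ xe).
  rewrite nm_half (exprS _ k) => h.
  have -> : A * (3 / 4 * (3 / 4) ^+ k) * nm x ^+ 2 =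
    3 * (A * (3 / 4) ^+ k * (nm x / 2) ^+ 2) by field.
  by rewrite ler_pM2l.
move=> x xe; apply: nm_dist_le => e1 e10.
have : (fun k : nat => A * (3 / 4) ^+ k * nm x ^+ 2) @ \oo --> (0 : R).
  rewrite -[X in _ --> X](_ : A * 0 * nm x ^+ 2 = 0); last by rewrite mulr0 mul0r.
  apply: cvgMl; apply: cvgMr; apply: cvg_expr; rewrite ger0_norm; lra.
move=> /cvgrPdist_lt/(_ _ e10)[k _ /(_ k (leqnn k))]; rewrite sub0r normrN => h.
by apply: (le_trans (key k x xe)); apply: (le_trans (ler_norm _)); exact: ltW.
Qed.

Hypothesis s_holo : holo_on s 0 r.

(** With [s x = x * x] the equation [E x = s (E (x / 2))] says that [E (x / 2)]
is a square root of [E x]. Iteration from the identity converges because [s]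
agrees with doubling to second order, and the limit is holomorphic by
Weierstrass' theorem. No differential equation has to be solved. *)
Lemma squaring_exists : exists E : V -> V, exists2 e, 0 < e &
  (forall x, nm x < e -> [/\ E x = s (E (halve x)), nm (E x) < r &
     nm (E x - x) <= 4 * K * nm x ^+ 2]) /\ holo_on E 0 e.
Proof.
pose e := Num.min r K^-1 / 2.
have e0 : 0 < e by rewrite divr_gt0// lt_min r0 invr_gt0.
have er : 2 * e <= r by rewrite mulrC divfK ?gt_eqF// ge_min lexx.
have eK : 2 * (K * e) <= 1.
  rewrite mulrCA mulrC; have -> : 2 * e = Num.min r K^-1 by rewrite mulrC divfK ?gt_eqF.
  by rewrite -ler_pdivlMr// mul1r ge_min lexx orbT.
pose E k := iter k (fun (f : V -> V) x => s (f (halve x))) id.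
have ES k x : E k.+1 x = s (E k (halve x)) by [].
have half_lt (x : V) : nm x < e -> nm (halve x) < e.
  by move=> xe; rewrite nm_half; have := nm_ge0 x; lra.
have Kx (x : V) : nm x < e -> K * nm x ^+ 2 <= nm x / 2.
  move=> xe; have n0 := nm_ge0 x.
  have : K * nm x <= K * e by rewrite ler_pM2l// ltW.
  by rewrite expr2; nra.
have near_id k (x : V) : nm x < e -> nm (E k x - x) <= K * nm x ^+ 2.
  elim: k x => [|k IH] x xe.
    by rewrite subrr nm0; apply: mulr_ge0; [exact: ltW|exact: sqr_ge0].
  have h1 := IH _ (half_lt _ xe); have n0 := nm_ge0 x; have k0 := Kx _ xe.
  rewrite nm_half in h1.
  have b1 : nm (halve x) < r by rewrite nm_half; lra.
  have b2 : nm (E k (halve x)) < r.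
    have := nm_le_sub (E k (halve x)) (halve x); rewrite nm_half.
    have E4 : K * (nm x / 2) ^+ 2 = (K * nm x ^+ 2) / 4 by field.
    by rewrite E4 in h1; lra.
  have := s_lip b2 b1; have := s_double b1; rewrite double_half nm_half ES.
  have := nm_tri (s (halve x)) (s (E k (halve x))) x.
  have E4 : K * (nm x / 2) ^+ 2 = (K * nm x ^+ 2) / 4 by field.
  by rewrite E4 in h1 *; lra.
have Er k x : nm x < e -> nm (E k x) < r.
  move=> xe; have := near_id k x xe; have := Kx x xe.
  by have := nm_le_sub (E k x) x; have := nm_ge0 x; lra.
have step k (x : V) : nm x < e -> nm (E k.+1 x - E k x) <= K * (3 / 4) ^+ k * nm x ^+ 2.
  elim: k x => [|k IH] x xe.
    by rewrite expr0 mulr1; exact: (near_id 1%N x xe).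
  rewrite ES [E k.+1 x]ES.
  apply: (le_trans (s_lip (Er k.+1 _ (half_lt _ xe)) (Er k _ (half_lt _ xe)))).
  have := IH _ (half_lt _ xe); rewrite nm_half (exprS _ k) => h.
  have -> : K * (3 / 4 * (3 / 4) ^+ k) * nm x ^+ 2 =
    3 * (K * (3 / 4) ^+ k * (nm x / 2) ^+ 2) by field.
  by rewrite ler_pM2l.
have cauchy k j x : nm x < e -> nm (E (k + j)%N x - E k x) <=
    4 * K * ((3 / 4) ^+ k - (3 / 4) ^+ (k + j)) * nm x ^+ 2.
  move=> xe; elim: j => [|j IH].
    by rewrite addn0 !subrr nm0 mulr0 mul0r.
  rewrite addnS; have := step (k + j)%N x xe.
  have := nm_tri (E (k + j)%N x) (E (k + j).+1 x) (E k x).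
  rewrite (exprS _ (k + j)%N); set a := (3 / 4) ^+ k in IH *; set b := (3 / 4) ^+ (k + j) in IH *.
  have -> : 4 * K * (a - 3 / 4 * b) * nm x ^+ 2 =
    4 * K * (a - b) * nm x ^+ 2 + K * b * nm x ^+ 2 by field.
  by lra.
have [U UU Uoo] := exists_free_ultrafilter.
pose q k : R := (3 / 4) ^+ k.
have q0 k : 0 < q k by rewrite exprn_gt0// divr_gt0.
have lim (x : V) : exists l, nm x < e -> forall k, nm (l - E k x) <=
    4 * K * q k * nm x ^+ 2.
  have [xe|] := ltP (nm x) e; last by exists 0.
  have [|l _ lU] := @ultra_limit nat V U (fun k => E k x) _ UU (@ball_compact R m r).
    by apply: filterS filterT => k _; apply/ltW/Er.
  exists l => _ k; apply/ler_addgt0Pl => t t0.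
  have Uk : U [set j | (k <= j)%N] by apply: Uoo; exact: nbhs_infty_ge.
  have [j [/= j1 j2]] := filter_ex (filterI (lU _ (nm_ball_nbhs l t0)) Uk).
  have := cauchy k (j - k)%N x xe; rewrite subnKC//.
  have : 4 * K * (q k - q j) * nm x ^+ 2 <= 4 * K * q k * nm x ^+ 2.
    rewrite ler_wpM2r ?sqr_ge0// ler_wpM2l ?mulr_ge0 ?(ltW K0)//.
    by have := q0 j; lra.
  have := nm_tri (E j x) l (E k x); rewrite (nmBC l (E j x)).
  by rewrite /q; lra.
have [F FP] := choice lim.
have small c t : 0 < t -> exists k, c * q k < t.
  move=> t0; have : (fun k : nat => c * q k) @ \oo --> (0 : R).
    rewrite -[X in _ --> X](mulr0 c).
    by apply: cvgMr; apply: cvg_expr; rewrite ger0_norm; lra.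
  move=> /cvgrPdist_lt/(_ _ t0)[k _ /(_ k (leqnn k))]; rewrite sub0r normrN => h.
  by exists k; apply: le_lt_trans h; exact: ler_norm.
have FK x : nm x < e -> nm (F x - x) <= 4 * K * nm x ^+ 2.
  by move=> xe; have := FP x xe 0%N; rewrite /q expr0 mulr1.
have Fr x : nm x < e -> nm (F x) < r.
  move=> xe; have [k] := small (4 * K * nm x ^+ 2) (e - nm x) ltac:(lra).
  have := FP x xe k; have := near_id k x xe; have := Kx x xe.
  have := nm_le_sub (F x) (E k x); have := nm_le_sub (E k x) x.
  have := nm_ge0 x; rewrite (mulrAC _ (nm x ^+ 2) (q k)); lra.
exists F, e => //; split.
  move=> x xe; split; [|exact: Fr|exact: FK].
  apply: nm_dist_le => t t0.
  have [k ] := small (8 * K * nm x ^+ 2) t t0.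
  have h1 := FP x xe k.+1; have h2 := FP _ (half_lt _ xe) k.
  have := s_lip (Er k _ (half_lt _ xe)) (Fr _ (half_lt _ xe)).
  rewrite nmBC in h2; rewrite nm_half in h2.
  have := nm_tri (E k.+1 x) (F x) (s (F (halve x))); rewrite ES in h1 *.
  have -> : 8 * K * nm x ^+ 2 * q k = 8 * (K * q k * nm x ^+ 2) by ring.
  have E1 : 4 * K * q k.+1 * nm x ^+ 2 = 3 * (K * q k * nm x ^+ 2).
    by rewrite /q (exprS _ k); field.
  have E2 : 4 * K * q k * (nm x / 2) ^+ 2 = K * q k * nm x ^+ 2 by field.
  rewrite E1 in h1; rewrite E2 in h2.
  have : 0 <= K * q k * nm x ^+ 2.
    by rewrite mulr_ge0 ?sqr_ge0// mulr_ge0// ltW.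
  by lra.
have Eholo k : holo_on (E k) 0 e.
  elim: k => [|k IH] x; rewrite subr0 => xe; first by rewrite /E/=.
  have dh : differentiable halve x by exact: (@differentiableZ _ _ _ id).
  have d2 : differentiable (E k) (halve x) by apply: IH; rewrite subr0; exact: half_lt.
  have d3 : differentiable s (E k (halve x)).
    by apply: s_holo; rewrite subr0; apply: Er; exact: half_lt.
  apply: (@differentiable_comp _ _ _ _ (E k \o halve) s x _ d3).
  exact: (@differentiable_comp _ _ _ _ halve (E k) x dh d2).
move=> p; rewrite subr0 => pe.
have e1 : 0 < e - nm p by rewrite subr_gt0.
have inB (z : V) : nm (z - p) < e - nm p -> nm z < e.
  by move=> zp; have := nm_le_sub z p; lra.
apply: (@weierstrass R nat U V m E F p (e - nm p) UU e1).
  by apply: filterS filterT => k _ z /inB ze; apply: Eholo; rewrite subr0.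
move=> t t0; have [k kt] := small (4 * K * e ^+ 2) t t0.
apply: Uoo; exists k => // j /= kj z /inB ze; rewrite nmBC.
apply: (le_trans (FP z ze j)); apply: le_trans (ltW kt).
have qjk : q j <= q k.
  by rewrite /q -(subnKC kj) exprD ler_piMr ?exprn_ge0// ?exprn_ile1//; lra.
have n2 : nm z ^+ 2 <= e ^+ 2 by rewrite lerXn2r ?nnegrE// ?nm_ge0// ltW.
have -> : 4 * K * q j * nm z ^+ 2 = 4 * K * (q j * nm z ^+ 2) by ring.
have -> : 4 * K * e ^+ 2 * q k = 4 * K * (q k * e ^+ 2) by ring.
apply: ler_wpM2l; first by rewrite mulr_ge0// ltW.
by apply: ler_pM => //; [exact: ltW|exact: sqr_ge0].
Qed.

End LocalSquaring.

(** * The exponential map of a complex Lie group *)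

Section LieChart.
Context {R : realType} {m : nat} {G : complexLieGroupType R m}.
Notation E := 'rV[R[i]]_m.
Implicit Types V W : normedModType R[i].

Definition chart1 : chart G E := chart_at (1%g : G).

Lemma chart1P : chart_around (1%g : G) chart1.
Proof. by rewrite /chart1 /chart_at; case: (cid _). Qed.

Definition lcoord (g : G) : E := coord chart1 g - coord chart1 (1%g : G).
Definition lpt (x : E) : G := chart_inv chart1 (1%g : G) (x + coord chart1 (1%g : G)).

Lemma lcoord1 : lcoord 1%g = 0.
Proof. by rewrite /lcoord subrr. Qed.

Lemma lcoordK g : chart_around g chart1 -> lpt (lcoord g) = g.
Proof. by move=> cg; rewrite /lpt /lcoord subrK chart_invK. Qed.

Lemma lpt0 : lpt 0 = 1%g.
Proof. by rewrite -lcoord1 lcoordK//; exact: chart1P. Qed.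

Lemma lpt_local : exists2 r, 0 < r & forall x, nm x < r ->
  [/\ chart_around (lpt x) chart1, lcoord (lpt x) = x & hol_at lpt x].
Proof.
have [r r0 rP] := iffLR (nm_nbhsP _ _)
  (chart_inv_near (1%g : G) chart1P (filterT : nbhs (1%g : G) setT)).
exists r => // x xr; set u := x + coord chart1 (1%g : G).
have [h1 h2 _] : [/\ chart_around (chart_inv chart1 (1%g : G) u) chart1,
    coord chart1 (chart_inv chart1 (1%g : G) u) = u &
    setT (chart_inv chart1 (1%g : G) u)] by apply: rP; rewrite /u addrK.
split; [exact: h1|by rewrite /lcoord /lpt -/u h2 /u addrK|].
apply: (@hol_at_comp _ _ _ _ _ (fun x => x + coord chart1 (1%g : G))
  (chart_inv chart1 (1%g : G))).
  by apply: differentiableD => //; exact: differentiable_cst.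
by rewrite -/u -h2; exact: hol_at_chart_inv.
Qed.

Lemma diff_lcoord V (f : V -> G) x : hol_at f x -> chart_around (f x) chart1 ->
  differentiable (lcoord \o f) x.
Proof.
move=> [_ df] fx; have d1 := df _ fx.
exact: (@differentiableB _ _ _ (coord chart1 \o f) (cst _) x d1 (differentiable_cst _ _)).
Qed.

(** A word in the group operations that is trivial at the origin stays in the
chart at the identity on a small ball, where its coordinates are holomorphic
and bounded: this is the input of the estimates above. *)
Lemma word_local V (w : V -> G) r : 0 < r -> w 0 = 1%g ->
  (forall x, nm x < r -> hol_at w x) ->
  exists2 e, 0 < e <= r & [/\ forall x, nm x < e -> chart_around (w x) chart1,
    forall x, nm x < e -> nm (lcoord (w x)) <= 1 & holo_on (lcoord \o w) 0 e].
Proof.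
move=> r0 w1 hw.
have h0 : nm (0 : V) < r by rewrite nm0.
have cw0 : chart_around (w 0) chart1 by rewrite w1; exact: chart1P.
have [cw _] := hw 0 h0.
have W1 : nbhs (0 : V) [set x | dom chart1 (w x)] := cw _ (chart_dom_nbhs cw0).
have W2 : nbhs (0 : V) [set x | nm (lcoord (w x)) < 1].
  have cL := differentiable_continuous (diff_lcoord (hw 0 h0) cw0).
  have h : nbhs (0 : V) [set x | nm (lcoord (w x) - lcoord (w 0)) < 1] :=
    cL _ (nm_ball_nbhs ((lcoord \o w) 0) ltr01).
  by apply: filterS h => x /=; rewrite w1 lcoord1 subr0.
have [s s0 sP] := iffLR (nm_nbhsP (0 : V) _) (filterI W1 W2).
exists (Num.min r s); first by rewrite lt_min r0 s0 ge_min lexx.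
have key x : nm x < Num.min r s -> [/\ nm x < r, chart_around (w x) chart1 &
    nm (lcoord (w x)) < 1].
  rewrite lt_min => /andP[xr xs].
  have [/= x1 x2] : ([set x | dom chart1 (w x)] `&`
    [set x | nm (lcoord (w x)) < 1]) x by apply: sP; rewrite subr0.
  by split => //; split => //; exact: chart1P.1.
split=> [x /key[]//|x /key[_ _ /ltW]//|x]; rewrite subr0 => /key[xr xc _].
by apply: diff_lcoord => //; exact: hw.
Qed.

Lemma fst_differentiable V W (p : V * W) : differentiable (fst : V * W -> V) p.
Proof. by apply: linear_differentiable => q; exact: cvg_fst. Qed.

Lemma snd_differentiable V W (p : V * W) : differentiable (snd : V * W -> W) p.
Proof. by apply: linear_differentiable => q; exact: cvg_snd. Qed.

Lemma hol_at_fst V (f : E -> G) (p : E * V) : hol_at f p.1 ->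
  hol_at (fun p : E * V => f p.1) p.
Proof. by move=> hf; exact: (hol_at_comp (fst_differentiable p)). Qed.

Lemma hol_at_snd V (f : E -> G) (p : V * E) : hol_at f p.2 ->
  hol_at (fun p : V * E => f p.2) p.
Proof. by move=> hf; exact: (hol_at_comp (snd_differentiable p)). Qed.

Definition lmul (x y : E) : E := lcoord (lpt x * lpt y)%g.
Definition ldiv (x y : E) : E := lcoord (lpt x * (lpt y)^-1)%g.

(** The last clause says that the group law in coordinates is additive in each
variable up to a bilinear error; at [x = y = 0] it is the expansion
[x * y = x + y + O(x y)]. *)
Lemma lmul_local : exists r K : R, [/\ 0 < r, 0 < K,
    forall x y, nm x < r -> nm y < r -> chart_around (lpt x * lpt y)%g chart1,
    holo_on (fun p : E * E => lmul p.1 p.2) 0 r &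
    (forall x, nm x < r -> [/\ lmul x 0 = x, lmul 0 x = x &
      [/\ chart_around (lpt x) chart1, lcoord (lpt x) = x & hol_at lpt x]]) /\
    forall x y a b, nm x < r -> nm y < r -> nm a < r -> nm b < r ->
      nm (lmul (x + a) (y + b) - lmul (x + a) y - lmul x (y + b) + lmul x y) <=
      K * nm a * nm b].
Proof.
have [r r0 rP] := lpt_local.
have hw (p : E * E) : nm p < r -> hol_at (fun p => lpt p.1 * lpt p.2)%g p.
  case: p => x y; rewrite nm_pair gt_max => /andP[xr yr].
  apply: hol_at_mul; [apply: hol_at_fst|apply: hol_at_snd].
    by have [] := rP _ xr.
  by have [] := rP _ yr.
have w1 : (lpt (0 : E * E).1 * lpt (0 : E * E).2)%g = 1%g by rewrite !lpt0 mulg1.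
have [e /andP[e0 er] [e1 e2 e3]] := word_local r0 w1 hw.
have c0 := @cauchy_cst_gt0 R.
exists (e / 8), (4 * cauchy_cst ^+ 2 * 1 / e ^+ 2).
have lt8 z : z < e / 8 -> z < r by lra.
split.
- by apply: divr_gt0; lra.
- apply: divr_gt0; last exact: exprn_gt0.
  by rewrite mulr1; apply: mulr_gt0; [lra|exact: exprn_gt0].
- by move=> x y xe ye; apply: (e1 (x, y)); rewrite nm_pair gt_max; lra.
- apply: holo_onS e3; rewrite subrr nm0; lra.
split.
  move=> x xe; have [h1 h2 h3] := rP x (lt8 _ xe).
  by rewrite /lmul lpt0 mulg1 mul1g h2.
move=> x y a b xe ye ae be.
have e2' (z : E * E) : nm (z - 0) < e -> nm ((lcoord \o (fun p => lpt p.1 * lpt p.2)%g) z) <= 1.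
  by rewrite subr0; exact: e2.
have := @holo_second_difference R _ m _ (0 : E * E) e 1 (x, y) (a, 0) (0, b) e0 e3 e2'.
rewrite subr0 !nm_pair !nm0 !gt_max xe ye ae be !divr_gt0//= => /(_ isT isT isT).
rewrite (max_l (nm_ge0 a)) (max_r (nm_ge0 b)).
by rewrite !addr0.
Qed.

Lemma ldiv_local : exists r K : R, [/\ 0 < r, 0 < K &
    forall x y, nm x < r -> nm y < r ->
      chart_around (lpt x * (lpt y)^-1)%g chart1 /\
      nm (ldiv x y) <= K * nm (x - y)].
Proof.
have [r r0 rP] := lpt_local.
have hw (p : E * E) : nm p < r -> hol_at (fun p => lpt p.1 * (lpt p.2)^-1)%g p.
  case: p => x y; rewrite nm_pair gt_max => /andP[xr yr].
  apply: hol_at_mul; first by apply: hol_at_fst; have [] := rP _ xr.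
  apply: (@hol_at_map _ _ _ _ _ (fun x : G => x^-1)%g _ (fun p : E * E => lpt p.2)).
    exact: invg_holomorphic.
  by apply: hol_at_snd; have [] := rP _ yr.
have w1 : (lpt (0 : E * E).1 * (lpt (0 : E * E).2)^-1)%g = 1%g.
  by rewrite !lpt0 mulgV.
have [e /andP[e0 er] [e1 e2 e3]] := word_local r0 w1 hw.
have c0 := @cauchy_cst_gt0 R.
exists (e / 2), (cauchy_cst * 1 / e); split.
- by apply: divr_gt0; lra.
- by apply: divr_gt0; [rewrite mulr1|].
move=> x y xe ye; have lt2 z : z < e / 2 -> z < e by lra.
split; first by apply: (e1 (x, y)); rewrite nm_pair gt_max !lt2.
have e2' (z : E * E) : nm (z - 0) < e ->
    nm ((lcoord \o (fun p => lpt p.1 * (lpt p.2)^-1)%g) z) <= 1.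
  by rewrite subr0; exact: e2.
have := @holo_lipschitz R _ m _ (0 : E * E) e 1 (y, y) (x, y) e0 e3 e2'.
rewrite !subr0 !nm_pair !gt_max !lt2// ye => /(_ isT isT).
by rewrite subrr nm0 max_l ?nm_ge0//= mulgV lcoord1 subr0.
Qed.

End LieChart.

Section LieExp.
Context {R : realType} {m : nat} {G : complexLieGroupType R m}.
Notation E := 'rV[R[i]]_m.
Notation chart1 := (@chart1 R m G).
Notation lcoord := (@lcoord R m G).
Notation lpt := (@lpt R m G).
Notation lmul := (@lmul R m G).

Lemma halve_lt (x : E) e : nm x < e -> nm (halve x) < e.
Proof. by move=> xe; rewrite nm_half; have := nm_ge0 x; lra. Qed.

Lemma scale_halve (a : R[i]) (x : E) : a *: halve x = halve (a *: x).
Proof. by rewrite /halve !scalerA mulrC. Qed.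

Lemma iter_halve k (x : E) : iter k halve x = ((2 ^+ k)^-1 : R)%:C *: x.
Proof.
elim: k => [|k IH]; first by rewrite expr0 invr1 scale1r.
by rewrite iterS IH /halve scalerA -rmorphM/= exprS invfM.
Qed.

Lemma iter_halve_lt (x : E) e : 0 < e -> exists k, nm (iter k halve x) < e.
Proof.
move=> e0; have [k H] := pow2_gt (nm x / e); exists k.
rewrite iter_halve nmZ nmC ger0_norm ?invr_ge0 ?exprn_ge0//.
have p0 : 0 < 2 ^+ k :> R by rewrite exprn_gt0.
by rewrite ltr_pdivrMl//; rewrite ltr_pdivrMr in H.
Qed.

Lemma nm_nat n (x : E) : nm (n%:R *: x) = n%:R * nm x.
Proof.
by rewrite nmZ -(rmorph_nat (@real_complex_def R (Phant R))) nmC ger0_norm.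
Qed.

(** On a small ball [ex] is the square-root tree [F] of the group law, extended
by [ex v = ex (v / 2 ^ k) ^ (2 ^ k)]. The maps [v |-> ex (n v)] and
[v |-> (ex v) ^ n] are two such trees with the same linear part, so they
agree by uniqueness. *)
Lemma lie_exp_exists : exists (ex : E -> G) (e A : R), [/\ 0 < e, 0 < A,
  forall v, nm v < e -> chart_around (ex v) chart1 /\
    nm (lcoord (ex v) - v) <= A * nm v ^+ 2,
  forall n v, ex (n%:R *: v) = (ex v ^+ n)%g &
  forall v, hol_at ex v].
Proof.
have [r1 [K [r10 K0 lmc lmh [lm1 lmSD]]]] := @lmul_local R m G.
have lmb x y : nm x < r1 -> nm y < r1 -> nm (lmul x y - x - y) <= K * nm x * nm y.
  move=> xr yr; have := lmSD 0 0 x y; rewrite nm0 => /(_ r10 r10 xr yr).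
  have [hx _ _] := lm1 x xr; have [_ hy _] := lm1 y yr.
  have [h0 _ _] := lm1 0 ltac:(by rewrite nm0).
  by rewrite !add0r hx hy h0 addr0.
pose r := Num.min r1 K^-1 / 4.
have r0 : 0 < r by rewrite divr_gt0// lt_min r10 invr_gt0.
have rr1 : r < r1.
  have : Num.min r1 K^-1 <= r1 by rewrite ge_min lexx.
  by rewrite /r; have : 0 < r1 by []; lra.
have rK : K * r <= 1 / 4.
  rewrite /r mulrA ler_pM2r ?invr_gt0// mulrC -ler_pdivlMr// mul1r.
  by rewrite ge_min lexx orbT.
pose s (x : E) := lmul x x.
have s_double (x : E) : nm x < r -> nm (s x - 2%:R *: x) <= K * nm x ^+ 2.
  move=> xr; have := lmb x x (lt_trans xr rr1) (lt_trans xr rr1).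
  by rewrite scaler_nat mulr2n opprD addrA expr2 mulrA.
have s_lip (x y : E) : nm x < r -> nm y < r -> nm (s x - s y) <= 3 * nm (x - y).
  move=> xr yr; set D := x - y.
  have Dr : nm D < r1.
    have mr : Num.min r1 K^-1 <= r1 by rewrite ge_min lexx.
    by have := nmB x y; rewrite -/D; rewrite /r in xr yr; lra.
  have z0 : nm (0 : E) < r1 by rewrite nm0.
  have [hx hx' _] := lm1 x (lt_trans xr rr1).
  have [hy hy' _] := lm1 y (lt_trans yr rr1).
  have := lmSD 0 y x D z0 (lt_trans yr rr1) (lt_trans xr rr1) Dr.
  have := lmSD y 0 D y (lt_trans yr rr1) z0 Dr (lt_trans yr rr1).
  have -> : y + D = x by rewrite addrC subrK.
  rewrite !add0r hx hx' hy hy' -/(s x) -/(s y).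
  set P := lmul x y - x - s y + y; set Q := s x - lmul x y - x + y => hP hQ.
  have -> : s x - s y = P + Q + (D + D).
    by rewrite /P /Q /D; apply/rowP => i; rewrite !mxE; ring.
  have := nmD (P + Q) (D + D); have := nmD P Q; have := nmD D D.
  have D0 := nm_ge0 D.
  have k1 : K * nm D * nm y <= 1 / 4 * nm D.
    rewrite mulrAC ler_wpM2r// (le_trans _ rK)// ler_wpM2l ?(ltW K0)//.
    exact: ltW.
  have k2 : K * nm x * nm D <= 1 / 4 * nm D.
    by rewrite ler_wpM2r// (le_trans _ rK)// ler_wpM2l ?(ltW K0)// ltW.
  by clear -hP hQ k1 k2 D0; lra.
have s_holo : holo_on s 0 r.
  move=> x; rewrite subr0 => xr.
  apply: (@differentiable_comp _ _ _ _ (fun x : E => (x, x)) (fun p : E * E => lmul p.1 p.2)).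
    by apply: differentiable_pair.
  by apply: lmh; rewrite subr0 nm_pair maxxx; exact: lt_trans rr1.
have [F [e e0 [FP Fh]]] := squaring_exists r0 K0 s_double s_lip s_holo.
have Fdom v : nm v < e -> chart_around (lpt (F v)) chart1 /\ lcoord (lpt (F v)) = F v.
  move=> ve; have [_ Fr _] := FP v ve.
  by have [_ _ []] := lm1 _ (lt_trans Fr rr1).
have lptM x y : nm x < r1 -> nm y < r1 -> lpt (lmul x y) = (lpt x * lpt y)%g.
  by move=> xr yr; rewrite /lmul lcoordK//; exact: lmc.
have Fsq v : nm v < e -> lpt (F v) = (lpt (F (halve v)) ^+ 2)%g.
  move=> ve; have [-> _ _] := FP v ve.
  have [_ Fr _] := FP _ (halve_lt ve); have Fr1 := lt_trans Fr rr1.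
  by rewrite lptM.
have kex (v : E) : exists k, nm (iter k halve v) < e by exact: iter_halve_lt.
have [kk kkP] := choice kex.
pose ex v := (lpt (F (iter (kk v) halve v)) ^+ (2 ^ kk v))%g.
have exk k v : nm (iter k halve v) < e -> ex v = (lpt (F (iter k halve v)) ^+ (2 ^ k))%g.
  have step l : nm (iter l halve v) < e -> (lpt (F (iter l halve v)) ^+ (2 ^ l) =
      lpt (F (iter l.+1 halve v)) ^+ (2 ^ l.+1))%g.
    by move=> le_; rewrite (Fsq _ le_) -expgnA -expnS iterS.
  have mono j l : nm (iter j halve v) < e -> nm (iter (l + j) halve v) < e /\
      (lpt (F (iter j halve v)) ^+ (2 ^ j) =
      lpt (F (iter (l + j) halve v)) ^+ (2 ^ (l + j)))%g.
    move=> je; elim: l => [//|l [IH1 IH2]]; rewrite addSn; split.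
      by rewrite iterS; exact: halve_lt.
    by rewrite IH2 step.
  move=> ke; have [_ h1] := mono k (kk v) ke.
  by have [_ h2] := mono (kk v) k (kkP v); rewrite h1 /ex h2 addnC.
have exh k v : ex v = (ex (iter k halve v) ^+ (2 ^ k))%g.
  have := kkP (iter k halve v); rewrite -iterD => h.
  rewrite (exk _ _ h); rewrite /ex -iterD -expgnA -expnD.
  by [].
have exF v : nm v < e -> ex v = lpt (F v).
  by move=> ve; rewrite (exk 0%N v ve) expn0 expg1.
have exD v : nm v < e -> chart_around (ex v) chart1 /\ lcoord (ex v) = F v.
  by move=> ve; rewrite exF//; exact: Fdom.
have dom_sq (h : E -> G) x : (h x = h (halve x) ^+ 2)%g ->
    chart_around (h (halve x)) chart1 ->
    lcoord (h x) = s (lcoord (h (halve x))).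
  by move=> -> hd; rewrite /s /lmul lcoordK// expg2.
pose A1 := 4 * K; have A10 : 0 < A1 by rewrite mulr_gt0.
have pow n : exists rho A, [/\ 0 < rho, 0 < A & forall v, nm v < rho ->
    chart_around (ex v ^+ n)%g chart1 /\
    nm (lcoord (ex v ^+ n)%g - n%:R *: v) <= A * nm v ^+ 2].
  elim: n => [|n [rho [A [rho0 A0 IH]]]].
    exists 1, 1; split => // v _; rewrite expg0; split; first exact: chart1P.
    by rewrite lcoord1 scale0r subrr nm0 mul1r sqr_ge0.
  pose c := n%:R + A + A1 + 1.
  have n0 : 0 <= n%:R :> R by [].
  have c0 : 0 < c by rewrite /c; lra.
  pose rho' := Num.min (Num.min rho e) (Num.min 1 (r1 / c)).
  exists rho', (A1 + A + K * (c * c)); split.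
  - by rewrite !lt_min rho0 e0 ltr01 divr_gt0.
  - have : 0 < K * (c * c) by rewrite !mulr_gt0.
    by lra.
  move=> v; rewrite !lt_min => /andP[/andP[v1 v2] /andP[v3 v4]].
  have [IH1 IH2] := IH v v1; have [D1 D2] := exD v v2.
  have [_ _ F3] := FP v v2; rewrite -D2 -/A1 in F3.
  rewrite ltr_pdivlMr// in v4.
  set x := lcoord (ex v); set y := lcoord (ex v ^+ n)%g.
  have nv := nm_ge0 v.
  have vv : nm v ^+ 2 <= nm v by rewrite expr2; have := ltW v3; nra.
  have Av : A * nm v ^+ 2 <= A * nm v by rewrite ler_pM2l.
  have A1v : A1 * nm v ^+ 2 <= A1 * nm v by rewrite ler_pM2l.
  have xb : nm x <= c * nm v.
    have := nm_le_sub x v; rewrite -/x in F3 => h.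
    have : n%:R * nm v >= 0 by rewrite mulr_ge0.
    have : A * nm v >= 0 by rewrite mulr_ge0// ltW.
    by rewrite /c !mulrDl mul1r; lra.
  have yb : nm y <= c * nm v.
    have := nm_le_sub y (n%:R *: v); rewrite nm_nat => h.
    have : A1 * nm v >= 0 by rewrite mulr_ge0// ltW.
    rewrite -/y in IH2.
    by rewrite /c !mulrDl mul1r; lra.
  have cr : c * nm v < r1 by rewrite mulrC.
  have xr := le_lt_trans xb cr; have yr := le_lt_trans yb cr.
  have E1 : (ex v ^+ n.+1 = lpt x * lpt y)%g.
    by rewrite expgS /x /y !lcoordK.
  rewrite E1; split; first exact: lmc.
  have -> : n.+1%:R *: v = v + n%:R *: v.
    by rewrite (mulrS 1 n) scalerDl scale1r.
  pose P := lmul x y - x - y; pose X := x - v; pose Y := y - n%:R *: v.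
  have hP : nm P <= K * nm x * nm y by exact: lmb.
  have hX : nm X <= A1 * nm v ^+ 2 by exact: F3.
  have hY : nm Y <= A * nm v ^+ 2 by exact: IH2.
  have -> : lcoord (lpt x * lpt y)%g - (v + n%:R *: v) = P + (X + Y).
    by rewrite -/(lmul x y) /P /X /Y; apply/rowP => i; rewrite !mxE; ring.
  have xy : K * nm x * nm y <= K * (c * c) * nm v ^+ 2.
    have -> : K * (c * c) * nm v ^+ 2 = K * ((c * nm v) * (c * nm v)) by ring.
    by rewrite -mulrA ler_pM2l// ler_pM ?nm_ge0.
  have t1 := nmD P (X + Y); have t2 := nmD X Y.
  rewrite !(mulrDl _ _ (nm v ^+ 2)).
  by clear -xy hP hX hY t1 t2; lra.
have small n : exists2 rho, 0 < rho & forall v, nm v < rho ->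
    ex (n%:R *: v) = (ex v ^+ n)%g.
  have [rho [A [rho0 A0 P]]] := pow n.
  have n0 : 0 <= n%:R :> R by [].
  pose c := n%:R + A + 1; have c0 : 0 < c by rewrite /c; lra.
  pose rho' := Num.min (Num.min rho (Num.min 1 (r / c))) (e / c).
  have rho'0 : 0 < rho' by rewrite !lt_min rho0 ltr01 (divr_gt0 r0 c0) (divr_gt0 e0 c0).
  have bnd (v : E) : nm v < rho' -> [/\ nm v < rho, nm v < 1, c * nm v < r & c * nm v < e].
    rewrite !lt_min => /andP[/andP[v1 /andP[v2 v3]] v4].
    by rewrite ltr_pdivlMr// mulrC in v3; rewrite ltr_pdivlMr// mulrC in v4.
  exists rho' => // v vr.
  have nle (w : E) : n%:R * nm w <= c * nm w.
    by rewrite ler_wpM2r ?nm_ge0// /c; lra.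
  have ne (w : E) : nm w < rho' -> nm (n%:R *: w) < e.
    by move=> /bnd[_ _ _ h]; rewrite nm_nat; exact: le_lt_trans (nle w) h.
  have nr (w : E) : nm w < rho' -> nm (lcoord (ex w ^+ n)%g) < r.
    move=> wr; have [w1 w2 w3 _] := bnd w wr; have [_ h] := P w w1.
    have nw := nm_ge0 w.
    have vv : nm w ^+ 2 <= nm w by rewrite expr2; have := ltW w2; nra.
    have Av : A * nm w ^+ 2 <= A * nm w by rewrite ler_pM2l.
    have := nm_le_sub (lcoord (ex w ^+ n)%g) (n%:R *: w); rewrite nm_nat.
    by rewrite /c !mulrDl mul1r in w3; lra.
  have E : lcoord (ex (n%:R *: v)) = lcoord (ex v ^+ n)%g.
    apply: (@squaring_unique R m s r s_lip (fun v => lcoord (ex (n%:R *: v)))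
      (fun v => lcoord (ex v ^+ n)%g) (A1 * n%:R ^+ 2 + A) rho' _ v vr).
    move=> x xr; have xh := halve_lt xr.
    have [d1 d2] := exD _ (ne _ xr); have [d3 d4] := exD _ (ne _ xh).
    have [x1 _ _ _] := bnd x xr; have [x2 _ _ _] := bnd _ xh.
    have [p1 p2] := P x x1; have [p3 p4] := P _ x2.
    split.
    - apply: (@dom_sq (fun v => ex (n%:R *: v)) x) => //.
      by rewrite scale_halve; exact: (exh 1%N (n%:R *: x)).
    - rewrite d2; by have [] := FP _ (ne _ xr).
    split; [|exact: nr|].
      apply: (@dom_sq (fun v => ex v ^+ n)%g x) => //.
      by rewrite [ex x](exh 1%N x) /= expn1 expgnAC.
    have := nm_tri (n%:R *: x) (lcoord (ex (n%:R *: x))) (lcoord (ex x ^+ n)%g).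
    rewrite d2; have [_ _] := FP _ (ne _ xr); rewrite -/A1 nm_nat.
    rewrite (nmBC (n%:R *: x)) mulrDl exprMn.
    by rewrite mulrA; clear -p2; lra.
  have [d1 _] := exD _ (ne _ vr); have [v1 _ _ _] := bnd v vr.
  by rewrite -(lcoordK d1) E lcoordK//; have [] := P v v1.
exists ex, e, A1; split => //.
- by move=> v ve; have [d1 ->] := exD v ve; split => //; have [] := FP v ve.
- move=> n v; have [rho rho0 P] := small n.
  have [k kr] := iter_halve_lt v rho0.
  rewrite (exh k v) (exh k (n%:R *: v)).
  have -> : iter k halve (n%:R *: v) = n%:R *: iter k halve v.
    by rewrite !iter_halve !scalerA mulrC.
  by rewrite P// expgnAC.
move=> v; have [k kr] := iter_halve_lt v e0.
pose c := ((2 ^+ k)^-1 : R)%:C; pose sc (w : E) := c *: w.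
have scE w : sc w = iter k halve w by rewrite iter_halve.
have dsc w : differentiable sc w by exact: (@differentiableZ _ _ _ id).
have hp j (h : E -> G) w : hol_at h w -> hol_at (fun w => h w ^+ j)%g w.
  elim: j => [|j IH] hh.
    split; first exact: cst_continuous.
    move=> b _; have -> : coord b \o (fun w => h w ^+ 0)%g = cst (coord b 1%g) by [].
    exact: differentiable_cst.
  have -> : (fun w => h w ^+ j.+1)%g = (fun w => h w * h w ^+ j)%g.
    by apply/funext => y; rewrite expgS.
  by apply: hol_at_mul => //; exact: IH.
have near_v : \forall w \near v, nm (sc w) < e.
  have cs := differentiable_continuous (dsc v).
  have e1 : 0 < e - nm (sc v) by rewrite subr_gt0 scE.
  have h : nbhs v [set w | nm (sc w - sc v) < e - nm (sc v)] :=
    cs _ (nm_ball_nbhs (sc v) e1).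
  by apply: filterS h => w /=; have := nm_le_sub (sc w) (sc v); lra.
apply: (@hol_at_near _ _ _ _ (fun w => lpt (F (sc w)) ^+ (2 ^ k))%g).
  by apply: filterS near_v => w we; rewrite (exk k w) -?scE.
apply: hp; have ve := nbhs_singleton near_v.
have [_ Fr _] := FP _ ve; have [_ _ [_ _ hl]] := lm1 _ (lt_trans Fr rr1).
have dF : differentiable F (sc v) by apply: Fh; rewrite subr0.
have dFs := @differentiable_comp _ _ _ _ sc F v (dsc v) dF.
exact: (@hol_at_comp _ _ _ _ _ (F \o sc) lpt v dFs hl).
Qed.

End LieExp.

(** * Left-invariant vector fields and integral curves *)

Section Chains.
Context {R : realType}.
Implicit Types U V W : normedModType R[i].

Lemma near_comp_diff U V W (f : U -> V) (g : V -> W) (h : U -> W) x :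
  differentiable f x -> differentiable g (f x) ->
  (\forall y \near x, g (f y) = h y) ->
  differentiable h x /\ forall u, 'd h x u = 'd g (f x) ('d f x u).
Proof.
move=> df dg fgh; have dgf := differentiable_comp df dg.
have [dh E] := @near_eq_diff _ U W (g \o f) h x fgh dgf.
have E' : 'd (g \o f) x = 'd g (f x) \o 'd f x :> (U -> W) by exact: diff_comp.
split; first exact: dh.
by move=> u; exact: (etrans (congr1 (fun k : U -> W => k u) E)
  (congr1 (fun k : U -> W => k u) E')).
Qed.

Lemma near_and V (x : V) (A B : set V) : nbhs x A -> nbhs x B -> nbhs x (A `&` B).
Proof. exact: filterI. Qed.

Lemma near_sub V (x : V) (A B : set V) : (forall y, A y -> B y) ->
  nbhs x A -> nbhs x B.
Proof. exact: filterS. Qed.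

Lemma in_chart_id V (W : nmodType) (f : V -> W) : in_chart (Chart setT id) f = f.
Proof.
apply/funext => u; rewrite /in_chart; case: xgetP => [y _ [q [_ /= ->]]//|].
by move=> /(_ (f u))[]; exists u.
Qed.

Lemma diff_scalar V (f : R[i] -> V) (t h : R[i]) : 'd f t h = h *: 'd f t (1 : R[i]).
Proof. by rewrite -linearZ /= -[h *: 1]/(h * 1) mulr1. Qed.

End Chains.

Section HolAtMore.
Context {R : realType} {n : nat} {N : complexManifoldType R n}.
Implicit Types V W : normedModType R[i].

Lemma hol_at_cst V (p : N) (x : V) : hol_at (fun=> p) x.
Proof.
split; first exact: cst_continuous.
move=> b _; have -> : coord b \o (fun=> p) = cst (coord b p) :> (V -> _) by [].
exact: differentiable_cst.
Qed.

Lemma hol_at_transition V (f : V -> N) x c c' : hol_at f x ->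
  chart_around (f x) c -> chart_around (f x) c' ->
  forall u, 'd (coord c' \o f) x u =
    'd (in_chart c (coord c')) (coord c (f x)) ('d (coord c \o f) x u).
Proof.
move=> [cf df] fc fc'.
have dt := atlas_compat _ _ fc.1 fc'.1 _ fc.2 fc'.2.
by have [] := near_comp_diff (df c fc) dt (in_chart_comp (coord c') cf fc).
Qed.

Lemma holomorphic_hol_at V (f : V -> N) :
  holomorphic (id_atlas V) (@atlas R n N) f <-> forall x, hol_at f x.
Proof.
split=> [[cf df] x|hf]; split.
- exact: cf.
- move=> b fb; have := df (Chart setT id) b x erefl fb.1 I fb.2.
  by rewrite in_chart_id.
- by move=> x; have [] := hf x.
- move=> a b x -> Ab _ fb; rewrite in_chart_id.
  by have [_] := hf x; apply; split.
Qed.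

Lemma velocityE (g : R[i] -> N) t c : hol_at g t -> chart_around (g t) c ->
  velocity g t c = 'd (coord c \o g) t (1 : R[i]).
Proof.
move=> hg gc; have c0 : chart_around (g t) (chart_at (g t)).
  by rewrite /chart_at; case: (cid _).
rewrite /velocity (tangent_ofE _ c0 gc) (hol_at_transition hg c0 gc).
by rewrite deriveE//; exact: hg.2.
Qed.

Lemma tangent_eq (p : N) (u v : tangent p) c : chart_around p c ->
  u c = v c -> u = v.
Proof.
move=> pc uv; apply/val_inj/funext => c' /=.
have := valP u; have := valP v; move=> /asboolP[v0 vE] /asboolP[u0 uE].
have [pc'|npc'] := pselect (chart_around p c'); last by rewrite u0// v0.
by rewrite (uE c c')// (vE c c')//; congr ('d _ _ _).
Qed.

Lemma ecast_component (p q : N) (e : p = q) (u : tangent p) c :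
  (ecast x (tangent x) e u) c = u c.
Proof. by case: _ / e. Qed.

Lemma tangentZ_component (p : N) (a : R[i]) (u : tangent p) c :
  (a *: u) c = a *: u c.
Proof. by []. Qed.

End HolAtMore.

(** Any parametrisation [g] of [M] through [p] computes the differential, not
only the chart chosen in its definition; for left translations [g] is a
translate of [lpt]. *)
Lemma differentialE (R : realType) (m n : nat) (M : complexManifoldType R m)
    (N : complexManifoldType R n) (f : M -> N) p (v : tangent p) (c : chart N _)
    (V : normedModType R[i]) (g : V -> M) (x : V) (w : V) :
  let a := chart_at p in
  (forall q, chart_around q a -> hol_at (f \o chart_inv a p) (coord a q)) ->
  hol_at g x -> g x = p -> 'd (coord a \o g) x w = v a ->
  chart_around (f p) c ->
  differential f v c = 'd (coord c \o f \o g) x w.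
Proof.
move=> a hf hg gx gw fc; subst p.
have ap : chart_around (g x) a by rewrite /a /chart_at; case: (cid _).
have fp : chart_around (f (g x)) (chart_at (f (g x))).
  by rewrite /chart_at; case: (cid _).
have hfp := hf _ ap.
have E := chart_invK (g x) ap.
have near_inv (g' : N -> 'rV[R[i]]_n) : \forall u \near coord a (g x),
    (g' \o (f \o chart_inv a (g x))) u = in_chart a (g' \o f) u.
  apply: filterS (chart_inv_near (g x) ap filterT) => u [u1 u2 _] /=.
  by rewrite -{2}u2 (in_chartE (g' \o f) u1).
have dE (c' : chart N _) : chart_around (f (g x)) c' ->
    'd (coord c' \o f \o g) x w = 'd (in_chart a (coord c' \o f)) (coord a (g x)) (v a).
  move=> fc'; have fc'' : chart_around ((f \o chart_inv a (g x)) (coord a (g x))) c'.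
    by rewrite /= E.
  have d1 := hfp.2 c' fc''.
  have [d2 d2E] := near_eq_diff (near_inv (coord c')) d1.
  have cg := hg.1 _ (chart_dom_nbhs ap).
  have cg' : nbhs x [set y | dom a (g y)] by exact: cg.
  have key : \forall y \near x, in_chart a (coord c' \o f) ((coord a \o g) y) =
      (coord c' \o f \o g) y.
    apply: filterS cg' => y ay.
    have yc : chart_around (g y) a by split; [exact: ap.1|exact: ay].
    exact: (in_chartE (coord c' \o f) yc).
  have [_ k] := near_comp_diff (hg.2 a ap) d2 key.
  by rewrite -gw; exact: k.
rewrite /differential (tangent_ofE _ fp fc) -(dE _ fp).
have hfg : hol_at (f \o g) x.
  have h : hol_at (fun y => (f \o chart_inv a (g x)) ((coord a \o g) y)) x.
    by apply: (hol_at_comp (hg.2 a ap)); exact: hfp.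
  apply: hol_at_near h.
  have cg : nbhs x [set y | dom a (g y)] := hg.1 _ (chart_dom_nbhs ap).
  apply: filterS cg => y ay.
  have yc : chart_around (g y) a by split; [exact: ap.1|exact: ay].
  by rewrite /= (chart_invK (g x) yc).
by rewrite -(hol_at_transition hfg fp fc).
Qed.

Section LeftTranslations.
Context {R : realType} {m : nat} {G : complexLieGroupType R m}.
Notation E := 'rV[R[i]]_m.
Notation chart1 := (@chart1 R m G).
Notation lcoord := (@lcoord R m G).
Notation lpt := (@lpt R m G).

Lemma hol_at_lpt0 : hol_at lpt 0.
Proof. by have [r r0 /(_ 0)] := @lpt_local R m G; rewrite nm0 => /(_ r0)[]. Qed.

Lemma hol_at_translate (h : G) : hol_at (fun y => h * lpt y)%g 0.
Proof. by apply: hol_at_mul; [exact: hol_at_cst|exact: hol_at_lpt0]. Qed.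

(** The component in the chart [c] of the left-invariant field with value [w]
at the identity. *)
Definition left_frame (h : G) (c : chart G E) (w : E) : E :=
  'd (coord c \o (fun y => h * lpt y)%g) 0 w.

Lemma hol_at_left_translation (k p : G) c q : chart_around q c ->
  hol_at (left_translation k \o chart_inv c p) (coord c q).
Proof.
move=> qc; apply: hol_at_mul; first exact: hol_at_cst.
exact: hol_at_chart_inv.
Qed.

Lemma lpt_diff (v : tangent (1%g : G)) :
  'd (coord (chart_at (1%g : G)) \o lpt) 0 (v chart1) = v (chart_at (1%g : G)).
Proof.
have [r r0 rP] := @lpt_local R m G.
have dc : differentiable (fun y : E => y + coord chart1 (1%g : G)) (0 : E).
  by apply: differentiableD => //; exact: differentiable_cst.
have near_ : \forall y \near (0 : E), y + coord chart1 (1%g : G) =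
    (coord (chart_at (1%g : G)) \o lpt) y.
  apply/nm_nbhsP; exists r => // y; rewrite subr0 => /rP[_ + _] /=.
  by move=> E1; rewrite -{1}E1 /lcoord subrK.
have [_ ->] := near_eq_diff near_ dc.
have d1 : differentiable (id : E -> E) 0 by [].
have d2 := differentiable_cst (coord chart1 (1%g : G)) (0 : E).
have E1 := congr1 (fun k : E -> E => k (v chart1)) (diffD d1 d2).
have E2 : 'd (cst (coord chart1 (1%g : G)) : E -> E) 0 (v chart1) = 0.
  exact: (congr1 (fun k : E -> E => k (v chart1)) (diff_cst (coord chart1 (1%g : G)) (0 : E))).
have E3 : 'd (id : E -> E) 0 (v chart1) = v chart1.
  exact: (congr1 (fun k : E -> E => k (v chart1))
    (@diff_val _ _ _ _ _ _ _ (is_diff_id (0 : E)))).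
apply: (etrans E1); apply: (etrans (f_equal2 +%R E3 E2)).
by rewrite addr0.
Qed.

Lemma dL_at1E (p : G) (v : tangent (1%g : G)) c : chart_around p c ->
  dL_at1 p v c = left_frame p c (v chart1).
Proof.
move=> pc; rewrite /dL_at1 ecast_component.
have p1 : chart_around (left_translation p 1%g) c by rewrite /left_translation mulg1.
rewrite (differentialE (x := 0) (g := lpt) (w := v chart1) _ hol_at_lpt0 lpt0 _ p1)//.
  by move=> q; exact: hol_at_left_translation.
exact: lpt_diff.
Qed.

Lemma left_invariant_fieldE (p h : G) (k : R[i]) (v : tangent (1%g : G)) c :
  chart_around h c ->
  left_invariant_field (k *: dL_at1 p v) h c = left_frame h c (k *: v chart1).
Proof.
move=> hc; rewrite /left_invariant_field ecast_component.
have hc' : chart_around (left_translation (h * p^-1)%g p) c.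
  by rewrite /left_translation mulgVK.
have pa : chart_around p (chart_at p) by rewrite /chart_at; case: (cid _).
have ga : 'd (coord (chart_at p) \o (fun y => p * lpt y)%g) 0 (k *: v chart1) =
    (k *: dL_at1 p v) (chart_at p).
  rewrite tangentZ_component (dL_at1E v pa) /left_frame.
  exact: linearZ.
have g0 : (p * lpt 0)%g = p by rewrite lpt0 mulg1.
have ht q : chart_around q (chart_at p) ->
    hol_at (left_translation (h * p^-1)%g \o chart_inv (chart_at p) p)
      (coord (chart_at p) q).
  by move=> qp; exact: hol_at_left_translation.
apply: (etrans (differentialE ht (hol_at_translate p) g0 ga hc')).
rewrite /left_frame.
have -> : coord c \o left_translation (h / p)%g \o (fun y => p * lpt y)%g =
    coord c \o (fun y => h * lpt y)%g.
  by apply/funext => y /=; rewrite /left_translation mulgA mulgVK.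
by [].
Qed.

End LeftTranslations.

Section IntegralCurves.
Context {R : realType} {m : nat} {G : complexLieGroupType R m}.
Notation E := 'rV[R[i]]_m.
Notation chart1 := (@chart1 R m G).
Notation lcoord := (@lcoord R m G).
Notation lpt := (@lpt R m G).
Notation ldiv := (@ldiv R m G).
Implicit Types (g : R[i] -> G) (t : R[i]).

(** Its derivative at [t] is the left logarithmic derivative of [g], in which
the equation of integral curves has constant right-hand side. *)
Definition ldelta g t (u : R[i]) : E := lcoord ((g t)^-1 * g u)%g.

Lemma ldelta_at g t : ldelta g t t = 0.
Proof. by rewrite /ldelta mulVg lcoord1. Qed.

Lemma hol_at_ldelta g t : hol_at g t -> hol_at (fun u => (g t)^-1 * g u)%g t.
Proof. by move=> hg; apply: hol_at_mul => //; exact: hol_at_cst. Qed.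

Lemma ldelta_diff g t : hol_at g t -> differentiable (ldelta g t) t.
Proof.
move=> hg; apply: (diff_lcoord (hol_at_ldelta hg)).
by rewrite mulVg; exact: chart1P.
Qed.

Lemma ldelta_near g t : hol_at g t ->
  \forall u \near t, g u = (g t * lpt (ldelta g t u))%g.
Proof.
move=> hg; have [cg _] := hol_at_ldelta hg.
have c1 : chart_around ((g t)^-1 * g t)%g chart1 by rewrite mulVg; exact: chart1P.
have h : nbhs t [set u | dom chart1 ((g t)^-1 * g u)%g] := cg _ (chart_dom_nbhs c1).
apply: filterS h => u cu; rewrite /ldelta lcoordK ?mulVKg//.
by split; [exact: chart1P.1|exact: cu].
Qed.

Lemma left_frame_inj (h : G) c w w' : chart_around h c ->
  left_frame h c w = left_frame h c w' -> w = w'.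
Proof.
move=> hc; have ht := hol_at_translate h.
have h0 : (h * lpt 0)%g = h by rewrite lpt0 mulg1.
have hc0 : chart_around (h * lpt 0)%g c by rewrite h0.
have hol_inv : hol_at (fun u => h^-1 * chart_inv c h u)%g (coord c h).
  by apply: hol_at_mul; [exact: hol_at_cst|exact: hol_at_chart_inv].
have d1 : differentiable (lcoord \o (fun u => h^-1 * chart_inv c h u)%g)
    ((coord c \o (fun y => h * lpt y)%g) 0).
  rewrite /= h0; apply: (diff_lcoord hol_inv).
  by rewrite chart_invK// mulVg; exact: chart1P.
have near_ : \forall y \near (0 : E),
    (lcoord \o (fun u => h^-1 * chart_inv c h u)%g)
      ((coord c \o (fun y => h * lpt y)%g) y) = y.
  have [r r0 rP] := @lpt_local R m G.
  have h1 : nbhs (0 : E) [set y | dom c (h * lpt y)%g] := ht.1 _ (chart_dom_nbhs hc0).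
  apply: filterS (filterI h1 (nm_ball_nbhs (0 : E) r0)) => y [/= y1].
  rewrite subr0 => /rP[_ y2 _].
  have yc : chart_around (h * lpt y)%g c by split; [exact: hc.1|exact: y1].
  by rewrite (chart_invK h yc) mulKg.
have [_ key] := near_comp_diff (ht.2 c hc0) d1 near_.
have idE (u : E) : 'd (id : E -> E) 0 u = u.
  exact: (congr1 (fun k : E -> E => k u)
    (@diff_val _ _ _ _ _ _ _ (is_diff_id (0 : E)))).
move=> E1; apply: (etrans (esym (idE w))); apply: (etrans (key w)).
apply: (etrans _ (idE w')); apply: (etrans _ (esym (key w'))).
exact: congr1 E1.
Qed.

Lemma curve_frame g t c : hol_at g t -> chart_around (g t) c ->
  'd (coord c \o g) t (1 : R[i]) = left_frame (g t) c ('d (ldelta g t) t (1 : R[i])).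
Proof.
move=> hg gc; have ht := hol_at_translate (g t).
have gc0 : chart_around (g t * lpt 0)%g c by rewrite lpt0 mulg1.
have d2 : differentiable (coord c \o (fun y => g t * lpt y)%g) (ldelta g t t).
  by rewrite ldelta_at; exact: ht.2.
have near_ : \forall u \near t,
    (coord c \o (fun y => g t * lpt y)%g) (ldelta g t u) = (coord c \o g) u.
  by apply: filterS (ldelta_near hg) => u E1; exact: (congr1 (coord c) (esym E1)).
have [_ key] := near_comp_diff (ldelta_diff hg) d2 near_.
by apply: (etrans (key _)); rewrite /left_frame ldelta_at.
Qed.

Lemma integral_curveP (p : G) (k : R[i]) (v : tangent (1%g : G)) g :
  integral_curve (k *: dL_at1 p v) g <->
  [/\ forall t, hol_at g t, g 0 = p &
      forall t, 'd (ldelta g t) t (1 : R[i]) = k *: v chart1].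
Proof.
split=> [[/holomorphic_hol_at hg g0 gv]|[hg g0 gv]]; split => //.
- move=> t; have [c gc] := exists_chart_around (g t).
  apply: (left_frame_inj gc).
  rewrite -(curve_frame (hg t) gc) -(velocityE (hg t) gc) gv.
  exact: left_invariant_fieldE.
- exact/holomorphic_hol_at.
move=> t; have [c gc] := exists_chart_around (g t).
apply: (tangent_eq gc); rewrite (velocityE (hg t) gc) (left_invariant_fieldE _ _ _ gc).
by rewrite (curve_frame (hg t) gc) gv.
Qed.

(** Since the derivative is known to exist, a single sequence of increments
determines it; for the exponential these are the [h] with [t = n h]. *)
Lemma diff_test (f : R[i] -> E) t w A : differentiable f t -> f t = 0 ->
  (forall e, 0 < e -> exists h : R[i], [/\ h != 0, nm h < e &
     nm (f (t + h) - h *: w) <= A * nm h ^+ 2]) ->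
  'd f t (1 : R[i]) = w.
Proof.
move=> df f0 test; apply: nm_dist_le => e e0.
have e2 : 0 < e / 2 by rewrite divr_gt0.
have [r r0 rf] := nm_diff df e2.
have A0 : 0 < `|A| + 1 by rewrite ltr_wpDl.
have s0 : 0 < Num.min r (e / 2 / (`|A| + 1)) by rewrite lt_min r0 !divr_gt0.
have [h [h0 hs hA]] := test _ s0.
move: hs; rewrite lt_min ltr_pdivlMr// => /andP[hr hs].
have nh := nm_gt0 h0.
have E1 : t + h - t = h by rewrite addrAC subrr add0r.
have := rf (t + h); rewrite E1 => /(_ hr).
rewrite f0 subr0 (diff_scalar f t h).
set D := 'd f t (1 : R[i]); clearbody D => h1.
have h2 : nm (h *: (D - w)) <= e * nm h.
  have -> : h *: (D - w) = (f (t + h) - h *: w) - (f (t + h) - h *: D).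
    by apply/rowP => i; rewrite !mxE; ring.
  apply: (le_trans (nmB _ _)).
  have h3 : A * nm h ^+ 2 <= e / 2 * nm h.
    rewrite expr2 mulrA ler_pM2r//; apply: le_trans (ltW hs).
    rewrite mulrC ler_pM2l//; apply: (le_trans (ler_norm _)).
    by rewrite lerDl.
  by clear -h1 hA h3; lra.
by rewrite nmZ mulrC ler_pM2r in h2.
Qed.

(** The quotient [b u = g1 u * (g2 u)^-1] has zero derivative, since [b] near
[u] is [g1 u * (x / y) * (g2 u)^-1] with [x] and [y] equal to first order.
So [b] is locally constant on the real segment from 0 to 1, hence constant. *)
Lemma integral_curve_unique g1 g2 w :
  (forall t, hol_at g1 t) -> (forall t, hol_at g2 t) -> g1 0 = g2 0 ->
  (forall t, 'd (ldelta g1 t) t (1 : R[i]) = w) ->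
  (forall t, 'd (ldelta g2 t) t (1 : R[i]) = w) -> g1 1 = g2 1.
Proof.
move=> h1 h2 g0 d1 d2; pose b u := (g1 u * (g2 u)^-1)%g.
have hb u : hol_at b u.
  apply: hol_at_mul => //.
  by apply: (@hol_at_map _ _ _ _ _ (fun x : G => x^-1)%g) => //; exact: invg_holomorphic.
have [r [K [r0 K0 rP]]] := @ldiv_local R m G.
have db (u : (R[i] : normedModType R[i])) c : chart_around (b u) c -> 'd (coord c \o b) u (1 : R[i]) = 0.
  move=> bc; pose W y := (g1 u * lpt y * (g2 u)^-1)%g.
  have hW : hol_at W 0.
    by apply: hol_at_mul; [exact: hol_at_translate|exact: hol_at_cst].
  have W0 : W 0 = b u by rewrite /W lpt0 mulg1.
  have W0c : chart_around (W 0) c by rewrite W0.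
  have dW := hW.2 c W0c.
  have [L L0 LP] : exists2 L, 0 < L & exists2 s, 0 < s & forall y, nm y < s ->
      nm (coord c (W y) - coord c (b u)) <= L * nm y.
    have [K' K'0 K'P] := nm_linear (diff_continuous dW).
    have [s s0 sP] := nm_diff dW ltr01.
    exists (1 + K'); first by rewrite addr_gt0.
    exists s => // y ys; have := sP y; rewrite subr0 => /(_ ys) /=; rewrite W0.
    have := K'P y; move: ('d _ _ y) => D hD hs.
    have := nm_le_sub (coord c (W y) - coord c (b u)) D.
    by rewrite mulrDl; clear -hD hs; lra.
  have [s s0 sP] := LP.
  have dif (gj : R[i] -> G) : (forall t, hol_at gj t) ->
      'd (ldelta gj u) u (1 : R[i]) = w -> forall e, 0 < e ->
      \forall z \near u, nm (ldelta gj u z - (z - u) *: w) <= e * nm (z - u).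
    move=> hj dj e e0; have [q q0 qP] := nm_diff (ldelta_diff (hj u)) e0.
    apply: (iffRL (nm_nbhsP u _)); exists q => // z /qP.
    by rewrite ldelta_at subr0 (diff_scalar (ldelta gj u) u (z - u)) dj.
  have small (gj : R[i] -> G) e : (forall t, hol_at gj t) -> 0 < e ->
      \forall z \near u, nm (ldelta gj u z) < e.
    move=> hj e0.
    have h := differentiable_continuous (ldelta_diff (hj u)) (nm_ball_nbhs _ e0).
    have h' : nbhs u [set z | nm (ldelta gj u z - ldelta gj u u) < e] := h.
    by apply: near_sub h' => z /=; rewrite ldelta_at subr0.
  have bE0 : exists2 q : R, 0 < q & forall z : R[i], nm (z - u) < q ->
      b z = W (ldiv (ldelta g1 u z) (ldelta g2 u z)).
    have n1 := near_and (ldelta_near (h1 u)) (ldelta_near (h2 u)).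
    have n2 := near_and (small g1 r h1 r0) (small g2 r h2 r0).
    have [q q0 qP] := iffLR (nm_nbhsP u _) (near_and n1 n2).
    exists q => // z /qP[[/= e1 e2] [/= s1 s2]].
    have [q1 _] := rP _ _ s1 s2.
    have E1 : lpt (ldiv (ldelta g1 u z) (ldelta g2 u z)) =
      (lpt (ldelta g1 u z) * (lpt (ldelta g2 u z))^-1)%g := lcoordK q1.
    rewrite /W. by rewrite E1 /b {1}e1 {1}e2 invgM !mulgA.
  have [q1 q10 bE] := bE0.
  have bne : 'd (coord c \o b) u (1 : R[i]) = 0; last exact: bne.
  apply: nm_dist_le => e e0; rewrite subr0.
  have := @differentiable_nm_le R _ _ (coord c \o b) u e ((hb u).2 c bc).
  have LK : 0 < L * K by rewrite mulr_gt0.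
  have e4 : 0 < e / (L * K) / 2 by rewrite !divr_gt0.
  have sK : 0 < s / K by rewrite divr_gt0.
  have n1 := near_and (dif g1 h1 (d1 u) _ e4) (dif g2 h2 (d2 u) _ e4).
  have n2 := near_and (small g1 r h1 r0) (small g2 r h2 r0).
  have sK2 : 0 < s / K / 2 by rewrite divr_gt0.
  have n3 := near_and (small g1 _ h1 sK2) (small g2 _ h2 sK2).
  have n4 := near_and (near_and n1 n2) n3.
  have [q q0 qP] := iffLR (nm_nbhsP u _) n4.
  move=> key; have := key _ (1 : R[i]).
  have -> : nm (1 : R[i]) = 1 by rewrite -[1]/((1 : R)%:C) nmC normr1.
  rewrite mulr1; apply; exists (Num.min q q1); first by rewrite lt_min q0.
  move=> z; rewrite lt_min => /andP[/qP[[[/= z1 z2] [/= z3 z4]] [/= z5 z6]] /bE z7].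
  have [_ z8] := rP _ _ z3 z4; rewrite /= z7.
  set D1 := ldelta g1 u z in z1 z3 z5 z8 *; set D2 := ldelta g2 u z in z2 z4 z6 z8 *.
  have DD : nm (D1 - D2) <= e / (L * K) * nm (z - u).
    have := nm_tri ((z - u) *: w) D1 D2; rewrite (nmBC ((z - u) *: w) D2).
    by clear -z1 z2; lra.
  have DD2 : nm (D1 - D2) < s / K.
    by have := nmB D1 D2; clear -z5 z6; lra.
  have z9 : nm (ldiv D1 D2) < s.
    by apply: (le_lt_trans z8); rewrite mulrC -ltr_pdivlMr.
  apply: (le_trans (sP _ z9)).
  have -> : e * nm (z - u) = L * (K * (e / (L * K) * nm (z - u))).
    by field; rewrite !gt_eqF.
  by rewrite ler_pM2l//; apply: (le_trans z8); rewrite ler_pM2l.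
pose f (x : R) : G := b x%:C.
have loc (x : R) : exists2 e, 0 < e & forall y, `|y - x| < e -> f y = f x.
  have [c bc] := exists_chart_around (f x).
  have [cb _] := hb x%:C.
  have n1 : nbhs (x%:C : R[i]) [set z | dom c (b z)] := cb _ (chart_dom_nbhs bc).
  have [e e0 eP] := iffLR (nm_nbhsP _ _) n1.
  have inD (y : R) : `|y - x| < e -> chart_around (f y) c.
    move=> yx; split; first exact: bc.1.
    by apply: eP; rewrite -rmorphB/= nmC.
  have const (a' b' : R) : a' <= b' -> (forall y, a' <= y <= b' -> `|y - x| < e) ->
      coord c (f a') = coord c (f b').
    move=> ab abx; apply: nm_dist_le => k k0.
    pose k' := k / (b' - a' + 1).
    have k'0 : 0 < k' by rewrite divr_gt0// ltr_wpDl// subr_ge0.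
    suff : nm (coord c (f a') - coord c (f b')) <= k' * (b' - a').
      move/le_trans; apply; rewrite /k' -mulrA ler_piMr ?(ltW k0)//.
      by rewrite ler_pdivrMl ?mulr1 ?lerDl// ltr_wpDl// subr_ge0.
    pose P (a1 b1 c1 d1 : R) := a1 <= b1 -> nm (coord c (f a1) - coord c (f b1)) <= k' * (b1 - a1).
    suff : P a' b' 0 0 by apply.
    apply: rect_induction => //.
      move=> a1 b1 c1 d1' ab1 cd1 mm nn P1 P2 _ _ _.
      have mE : mm = (a1 + b1) / 2 by []. clearbody mm.
      have {}P1 := P1 ltac:(lra); have {}P2 := P2 ltac:(lra).
      have := nm_tri (coord c (f mm)) (coord c (f a1)) (coord c (f b1)).
      have -> : k' * (b1 - a1) = k' * (mm - a1) + k' * (b1 - mm) by ring.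
      by clear -P1 P2; lra.
    move=> y z yab _; have yc := inD y (abx y yab).
    have := nm_diff ((hb y%:C).2 c yc) k'0 => -[q q0 qP].
    exists q => // a1 b1 c1 d1' _ _ _ _ yab1 _ b1a1 _ ab1.
    have q1 (u : R) : `|u - y| < q -> nm (coord c (f u) - coord c (f y)) <= k' * `|u - y|.
      move=> uy; have := qP u%:C; rewrite -rmorphB/= nmC => /(_ uy).
      by rewrite (diff_scalar (coord c \o b) y%:C (u - y)%:C) db// scaler0 subr0.
    have y1 : `|a1 - y| = y - a1 by rewrite distrC ger0_norm// subr_ge0; case/andP: yab1.
    have y2 : `|b1 - y| = b1 - y by rewrite ger0_norm// subr_ge0; case/andP: yab1.
    have := q1 a1; have := q1 b1; rewrite y1 y2 => /(_ ltac:(lra)) q2 /(_ ltac:(lra)) q3.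
    have := nm_tri (coord c (f y)) (coord c (f a1)) (coord c (f b1)).
    rewrite (nmBC (coord c (f y)) (coord c (f b1))).
    have -> : k' * (b1 - a1) = k' * (y - a1) + k' * (b1 - y) by ring.
    by clear -q2 q3; lra.
  exists e => // y yx.
  have [_ inj _ _] := atlas_chart _ bc.1.
  have xx : `|x - x| < e by rewrite subrr normr0.
  apply: inj; rewrite ?inE; [exact: (inD y yx).2|exact: bc.2|].
  move: yx; rewrite ltr_norml => /andP[yx1 yx2].
  have [yx'|yx'] := leP y x.
    apply: const => // z /andP[z1 z2]; rewrite ltr_norml; apply/andP; split.
      by clear -yx1 z1; lra.
    by clear -z2 e0; lra.
  apply/esym/const; first exact: ltW.
  move=> z /andP[z1 z2]; rewrite ltr_norml; apply/andP; split.
    by clear -z1 e0; lra.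
  by clear -yx2 z2; lra.
have : f 0 = f 1.
  pose P (a1 b1 c1 d1 : R) := a1 <= b1 -> f a1 = f b1.
  suff : P 0 1 0 0 by apply.
  apply: rect_induction => //.
    move=> a1 b1 c1 d1' ab1 cd1 mm nn P1 P2 _ _ _.
    by rewrite P1 ?P2//; rewrite /mm; lra.
  move=> x y x01 _; have [e e0 eP] := loc x.
  exists e => // a1 b1 c1 d1' _ _ _ _ xab _ b1a1 _ ab1.
  have h (u : R) : a1 <= u <= b1 -> f u = f x.
    by move=> yy; apply: eP; rewrite ltr_norml; clear -yy xab b1a1; lra.
  by rewrite (h a1) ?(h b1) ?lexx ?ab1.
have -> : f 0 = 1%g.
  have E0 : ((0 : R)%:C : R[i]) = 0 by [].
  by rewrite /f /b E0 g0 mulgV.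
have -> : f 1 = (g1 1%R * (g2 1%R)^-1)%g by [].
by move=> /(congr1 (fun x => x * g2 1%R)%g); rewrite mul1g mulgVK.
Qed.

End IntegralCurves.

(** The curve [t |-> p * ex (t w)] is an integral curve: its velocity at
[t = n h] is read off from [ex ((n + 1) h w) = ex (n h w) * ex (h w)], and
every [t] has arbitrarily small divisors [h]. Uniqueness of integral curves
then identifies the exponential mapping. *)
Lemma exp_at_lie_exp (R : realType) (m : nat) (G : complexLieGroupType R m) :
  exists (ex : 'rV[R[i]]_m -> G) (e A : R), [/\ 0 < e, 0 < A,
    forall v, nm v < e -> chart_around (ex v) (@chart1 R m G) /\
      nm (lcoord (ex v) - v) <= A * nm v ^+ 2 &
    forall (p : G) (k : R[i]) (v : tangent (1%g : G)),
      exp_at (k *: dL_at1 p v) = (p * ex (k *: v (@chart1 R m G)))%g].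
Proof.
have [ex [e [A [e0 A0 eP exM hex]]]] := @lie_exp_exists R m G.
exists ex, e, A; split => // p k v.
set w := k *: v (@chart1 R m G).
have ex0 : ex 0 = 1%g by rewrite -[X in ex X](scale0r w) (exM 0%N w) expg0.
pose g (t : R[i]) := (p * ex (t *: w))%g.
have hg t : hol_at g t.
  apply: hol_at_mul; first exact: hol_at_cst.
  have ds : differentiable (fun t : R[i] => t *: w) t.
    exact: (@differentiableZl _ _ _ (id : R[i] -> R[i]) w t).
  exact: (@hol_at_comp _ _ _ _ _ (fun t : R[i] => t *: w) ex t ds).
have gw t : 'd (ldelta g t) t (1 : R[i]) = w.
  apply: (@diff_test R m _ t w (A * nm w ^+ 2)).
  - by apply: ldelta_diff; exact: hg.
  - by rewrite ldelta_at.
  move=> e1 e10.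
  pose b := Num.min e1 (e / (nm w + 1)).
  have nw := nm_ge0 w.
  have b0 : 0 < b by rewrite lt_min e10 divr_gt0// ltr_wpDl.
  have [N [h [h0 hb th]]] : exists (N : nat) (h : R[i]),
      [/\ h != 0, nm h < b & t = N%:R * h].
    have [->|t0] := eqVneq t 0.
      exists 0%N, (b / 2)%:C; split; last by rewrite mul0r.
        apply/eqP => /(congr1 (@complex.Re R)) /=; apply/eqP.
        by rewrite gt_eqF// divr_gt0.
      by rewrite nmC ger0_norm; lra.
    have [N tN] : exists N : nat, nm t / b < N.+1%:R.
      exists (Num.bound (nm t / b)); apply: (lt_trans (archi_boundP _)).
        by rewrite divr_ge0 ?nm_ge0// ltW.
      by rewrite ltr_nat.
    have N0 : (N.+1%:R : R[i]) != 0 by rewrite pnatr_eq0.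
    exists N.+1, (N.+1%:R^-1 * t); split.
    - by rewrite mulf_neq0// invr_eq0.
    - rewrite nmM nmV -(rmorph_nat (@real_complex_def R (Phant R))) nmC ger0_norm//.
      by rewrite mulrC ltr_pdivrMr// mulrC -ltr_pdivrMr.
    by rewrite mulrA divff// mul1r.
  move: hb; rewrite lt_min => /andP[he1 hbe].
  have hwe : nm (h *: w) < e.
    rewrite nmZ; rewrite ltr_pdivlMr ?ltr_wpDl// in hbe.
    by apply: le_lt_trans hbe; rewrite ler_wpM2l ?nm_ge0// lerDl.
  exists h; split => //.
  have -> : ldelta g t (t + h) = lcoord (ex (h *: w)).
    rewrite /ldelta /g invgM -mulgA mulKg.
    have E1 : t *: w = N%:R *: (h *: w) by rewrite th scalerA.
    have E2 : (t + h) *: w = N.+1%:R *: (h *: w).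
      by rewrite th scalerA (mulrS 1 N) mulrDl mul1r addrC.
    by rewrite E1 E2 !exM expgSr mulKg.
  have [_ h1] := eP _ hwe; apply: (le_trans h1).
  by rewrite nmZ exprMn mulrCA mulrC mulrA.
have gc : integral_curve (k *: dL_at1 p v) g.
  by apply/integral_curveP; split => //; rewrite /g scale0r ex0 mulg1.
rewrite /exp_at; case: xgetP => [g' _ /integral_curveP[hg' g'0 g'w]|/(_ g)[]//].
have -> : (p * ex w)%g = g 1 by rewrite /g scale1r.
have g00 : g' 0 = g 0 by rewrite g'0 /g scale0r ex0 mulg1.
exact: (@integral_curve_unique R m G g' g w hg' hg g00 g'w gw).
Qed.

(** * The rescaling principle *)

Section Zalcman.
Context {R : realType} {m n : nat} {N : complexManifoldType R n}.
Notation E := 'rV[R[i]]_m.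
Variable d : N -> N -> R.
Hypotheses (dd : is_distance d) (cN : compact [set: N]).

(** A finite-scale substitute for a large derivative; unlike the latter it
refers to the distance of the target only. *)
Definition oscillates (dl : R) (h : E -> N) (x : E) (rho : R) :=
  exists2 y, nm (y - x) < rho & dl <= d (h x) (h y).

(** Point picking. If every oscillation had one of half its scale nearby, the
resulting points would converge, since the scales are summable, and [h] would
be discontinuous at their limit. *)
Lemma pick_oscillation (h : E -> N) x0 dl k r : 0 < dl -> 0 < k -> 0 < r ->
  (forall x, nm (x - x0) <= 2 * k * r -> {for x, continuous h}) ->
  oscillates dl h x0 r ->
  exists x rho, [/\ oscillates dl h x rho, 0 < rho <= r, nm (x - x0) <= 2 * k * r &
    forall y, nm (y - x) < k * rho -> ~ oscillates dl h y (rho / 2)].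
Proof.
move=> dl0 k0 r0 ch osc0; apply: contrapT => nex.
pose rho i : R := r / 2 ^+ i.
have p0 i : 0 < 2 ^+ i :> R by rewrite exprn_gt0.
have rho0 i : 0 < rho i by rewrite divr_gt0.
have rhoS i : rho i.+1 = rho i / 2 by rewrite /rho exprSr invfM mulrA.
have rhor i : rho i <= r.
  by elim: i => [|i IH]; [rewrite /rho expr0 divr1|rewrite rhoS; have := rho0 i; lra].
pose good i (x : E) := oscillates dl h x (rho i) /\
  nm (x - x0) <= 2 * k * (r - rho i).
have next i x : exists x', good i x -> good i.+1 x'.
  have [[ox xb]|ng] := pselect (good i x); last by exists x.
  have [y [yx oy]] : exists y, nm (y - x) < k * rho i /\ oscillates dl h y (rho i / 2).
    apply: contrapT => nb; apply: nex; exists x, (rho i); split => //.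
    - by rewrite rho0 rhor.
    - apply: (le_trans xb); rewrite ler_pM2l ?mulr_gt0//.
      by have := rho0 i; lra.
    by move=> y yx oy; apply: nb; exists y.
  exists y => _; split; first by rewrite rhoS.
  have := nm_tri x y x0; rewrite rhoS.
  have -> : 2 * k * (r - rho i / 2) = 2 * k * (r - rho i) + k * rho i by field.
  by clear -xb yx; lra.
have [nxt nxtP] := choice (fun ix : nat * E => next ix.1 ix.2).
pose x := fix x i := if i is i'.+1 then nxt (i', x i') else x0.
have gx i : good i (x i).
  elim: i => [|i IH]; last exact: (nxtP (i, x i) IH).
  split; first by rewrite /rho expr0 divr1.
  by rewrite /= subrr nm0 /rho expr0 divr1 subrr mulr0.
have far i : exists yi, nm (yi - x i) < rho i /\ dl <= d (h (x i)) (h yi).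
  by have [[yi y1 y2] _] := gx i; exists yi.
have [y yP] := choice far.
have [U UU Uoo] := exists_free_ultrafilter.
have kr0 : 0 < 2 * k * r by rewrite !mulr_gt0.
have xb i : nm (x i - x0) <= 2 * k * r.
  have [_ h1] := gx i; apply: (le_trans h1); rewrite ler_pM2l ?mulr_gt0//.
  by have := rho0 i; lra.
have [|l lb lU] := @ultra_limit nat E U (fun i => x i - x0) _ UU
    (@ball_compact R m (2 * k * r)).
  by apply: filterS filterT => i _; exact: xb.
pose xl := l + x0.
have cl : {for xl, continuous h} by apply: ch; rewrite /xl addrK.
have dl2 : 0 < dl / 2 by rewrite divr_gt0.
have [e e0 eP] := iffLR (nm_nbhsP xl _) (cl _ (dist_ball dd (h xl) dl2)).
have e2 : 0 < e / 2 by rewrite divr_gt0.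
have [i0 i0P] := pow2_gt (r / (e / 2)).
have U2 : U [set i | rho i < e / 2].
  apply: Uoo; exists i0 => // i /= ii.
  rewrite ltr_pdivrMr// in i0P.
  rewrite /rho ltr_pdivrMr//; apply: (lt_le_trans i0P).
  rewrite mulrC; apply: ler_wpM2l; first exact: ltW.
  by rewrite ler_eXn2l ?ltr1n.
have [i [/= i1 i2]] := filter_ex (filterI (lU _ (nm_ball_nbhs l e2)) U2).
have xi : nm (x i - xl) < e / 2 by rewrite /xl opprD addrCA addrC -addrA (addrC _ (- l)) in i1 *.
have [y1 y2] := yP i.
have hx := eP (x i) ltac:(lra).
have hy : d (h xl) (h (y i)) < dl / 2.
  by apply: eP; have := nm_tri (x i) (y i) xl; lra.
have := dist_tri dd (h xl) (h (x i)) (h (y i)).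
by rewrite (distC dd (h (x i)) (h xl)); rewrite /= in hx hy; lra.
Qed.

End Zalcman.

Section ZalcmanLemma.
Context {R : realType} {m n : nat} {N : complexManifoldType R n}.
Notation E := 'rV[R[i]]_m.
Variable d : N -> N -> R.
Hypotheses (dd : is_distance d) (cN : compact [set: N]).

(** Zalcman's lemma. Oscillations at arbitrarily small scales [r j] are replaced
by picked ones at [x j] of scale [rho j], around which nothing oscillates at
scale [rho j / 2] within [k j rho j], with [k j] tending to infinity. The
rescaled maps then satisfy Montel's theorem on larger and larger balls, so
they have a holomorphic limit, which still oscillates on the unit ball. *)
Lemma zalcman (Phi : set (E -> N)) x0 a : 0 < a ->
  (forall h, Phi h -> forall x, nm (x - x0) < a -> hol_at h x) ->
  (exists2 e, 0 < e & forall r, 0 < r -> exists2 h, Phi h & oscillates d e h x0 r) ->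
  exists (h : nat -> E -> N) (x : nat -> E) (rho : nat -> R) (psi : E -> N),
    [/\ forall j, [/\ Phi (h j), nm (x j - x0) < Num.min a j.+1%:R^-1 &
          0 < rho j < j.+1%:R^-1],
        forall z, hol_at psi z, exists z w, psi z <> psi w &
        forall M e, 0 < e -> \forall j \near \oo, forall y, nm y <= M ->
          nm (x j + (rho j)%:C *: y - x0) < a /\
          d (h j (x j + (rho j)%:C *: y)) (psi y) < e].
Proof.
move=> a0 hol [e0 e00 osc0].
have [dl dl0 mont] := montel_modulus dd cN.
(* Montel's theorem turns any oscillation into one of the fixed size [dl]. *)
have osc r : 0 < r -> exists2 h, Phi h & oscillates d dl h x0 r.
  move=> r0; apply: contrapT => nex.
  have r1 : 0 < Num.min r a by rewrite lt_min r0.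
  have [s s0 sP] := mont e0 _ e00 r1.
  have [h Ph [y yx ey]] := osc0 s s0.
  have : d (h x0) (h y) < e0.
    apply: (sP _ h x0) => // z; rewrite lt_min => /andP[zr za]; first exact: hol za.
    by rewrite ltNge; apply/negP => zd; apply: nex; exists h => //; exists z.
  by rewrite ltNge ey.
pose k (j : nat) : R := j.+1%:R.
have k1 j : 1 <= k j by rewrite /k ler1n.
have k0 j : 0 < k j by rewrite /k.
pose r j : R := Num.min a (k j)^-1 / (6 * k j).
have m0 j : 0 < Num.min a (k j)^-1 by rewrite lt_min a0 invr_gt0 k0.
have r0 j : 0 < r j by apply: divr_gt0; [exact: m0|exact: mulr_gt0].
have rk j : 6 * (k j * r j) = Num.min a (k j)^-1.
  by rewrite /r; field; rewrite gt_eqF ?k0.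
have rka j : 6 * (k j * r j) <= a by rewrite rk ge_min lexx.
have rkj j : 6 * (k j * r j) <= (k j)^-1 by rewrite rk ge_min lexx orbT.
have rkr j : r j <= k j * r j by apply: ler_peMl => //; exact/ltW/r0.
have pick j : exists hxr : (E -> N) * (E * R), [/\ Phi hxr.1,
    oscillates d dl hxr.1 hxr.2.1 hxr.2.2, 0 < hxr.2.2 <= r j,
    nm (hxr.2.1 - x0) <= 2 * k j * r j &
    forall y, nm (y - hxr.2.1) < k j * hxr.2.2 ->
      ~ oscillates d dl hxr.1 y (hxr.2.2 / 2)].
  have [h Ph oh] := osc _ (r0 j).
  have ch x : nm (x - x0) <= 2 * k j * r j -> {for x, continuous h}.
    move=> xb; have xa : nm (x - x0) < a.
      apply: (le_lt_trans xb); rewrite -mulrA.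
      have := rka j; have := r0 j; have := rkr j.
      by move: (k j * r j) (r j) => kr rr; lra.
    by have [] := hol h Ph x xa.
  have [x [rho [h1 h2 h3 h4]]] := pick_oscillation dd dl0 (k0 j) (r0 j) ch oh.
  by exists (h, (x, rho)).
have [D DP] := choice pick.
pose h j := (D j).1; pose x j := (D j).2.1; pose rho j := (D j).2.2.
have Ph j : Phi (h j) by case: (DP j).
have oh j : oscillates d dl (h j) (x j) (rho j) by case: (DP j).
have rho0 j : 0 < rho j by case: (DP j) => _ _ /andP[].
have rhor j : rho j <= r j by case: (DP j) => _ _ /andP[].
have xb j : nm (x j - x0) <= 2 * (k j * r j).
  by case: (DP j) => _ _ _ + _; rewrite mulrA.
have calm j y : nm (y - x j) < k j * rho j -> ~ oscillates d dl (h j) y (rho j / 2).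
  by case: (DP j) => _ _ _ _; exact.
clearbody h x rho; clear D DP pick.
pose sc j (y : E) := x j + (rho j)%:C *: y.
pose psi_ j y := h j (sc j y).
have scB j y z : nm (sc j y - sc j z) = rho j * nm (y - z).
  rewrite /sc opprD addrACA subrr add0r -scalerBr nmZ nmC ger0_norm//.
  exact: ltW.
have sc0 j : sc j 0 = x j by rewrite /sc scaler0 addr0.
have sc_in j y : nm y <= k j + 1 -> nm (sc j y - x0) < a.
  move=> yk; have := nm_tri (x j) (sc j y) x0; rewrite -{1}(sc0 j) scB subr0.
  have : rho j * nm y <= r j * (k j + 1).
    by apply: ler_pM => //; [exact: ltW|exact: nm_ge0].
  rewrite mulrDr mulr1 (mulrC (r j)).
  have := xb j; have := rka j; have := rkr j; have := r0 j.
  by lra.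
have hpsi j y : nm y <= k j + 1 -> hol_at (psi_ j) y.
  move=> yk; have ds : differentiable (sc j) y.
    apply: differentiableD; first exact: differentiable_cst.
    exact: (@differentiableZ _ _ _ id).
  exact: (hol_at_comp ds (hol _ (Ph j) _ (sc_in j y yk))).
have calm' j y w : nm y < k j -> nm (w - y) < 1 / 2 -> d (psi_ j y) (psi_ j w) < dl.
  move=> yk wy; rewrite ltNge; apply/negP => le_.
  apply: (calm j (sc j y)).
    by rewrite -[X in _ - X]sc0 scB subr0 mulrC ltr_pM2r.
  exists (sc j w) => //; rewrite scB.
  by have := rho0 j; rewrite -(ltr_pM2l (rho0 j)) in wy; lra.
have half0 : 0 < 1 / 2 :> R by rewrite divr_gt0.
have equi e : 0 < e -> exists2 s, 0 < s & forall j y w, nm y < k j ->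
    nm (w - y) < s -> d (psi_ j y) (psi_ j w) < e.
  move=> e1; have [s s0 sP] := mont e _ e1 half0.
  exists s => // j y w yk wy; apply: (sP _ (psi_ j) y) => // z zy.
    by apply: hpsi; have := nm_le_sub z y; lra.
  exact: calm'.
have [U UU Uoo] := exists_free_ultrafilter.
have big M : U [set j | M < k j].
  apply: Uoo; exists (Num.bound `|M|) => // j /= Mj.
  apply: (le_lt_trans (ler_norm M)); apply: (lt_le_trans (archi_boundP _)) => //.
  by rewrite /k ler_nat; exact: leqW.
have [|psi cpsi Upsi] := @ultra_ascoli R N d dd cN nat U E psi_ UU.
  move=> y e e1; have [s s0 sP] := equi e e1.
  exists [set w | nm (w - y) < s]; first exact: nm_ball_nbhs.
  by apply: filterS (big (nm y)) => j /= yk w wy; exact: sP.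
have unif M e : 0 < e -> U [set j | forall y, nm y <= M -> d (psi_ j y) (psi y) < e].
  by move=> e1; exact: (Upsi _ (@ball_compact R m M) e e1).
have hol_psi z : hol_at psi z.
  apply: (@weierstrass_manifold R n N d dd cN nat U E psi_ psi z 1 UU ltr01).
  - apply: filterS (big (nm z)) => j /= zk w wz.
    by apply: hpsi; have := nm_le_sub w z; lra.
  - move=> e e1; apply: filterS (unif (nm z + 1) e e1) => j /= jP w wz.
    by apply: jP; have := nm_le_sub w z; lra.
  exact: cpsi.
have nonconst : exists z w, psi z <> psi w.
  apply: contrapT => nc.
  have cst_ z : psi z = psi 0 by apply: contrapT => zn; apply: nc; exists z, 0.
  have dl2 : 0 < dl / 2 by rewrite divr_gt0.
  have [j /= jP] := filter_ex (unif 1 _ dl2).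
  have [y yx dy] := oh j.
  pose w := (rho j)^-1%:C *: (y - x j).
  have scw : sc j w = y.
    rewrite /sc /w scalerA -rmorphM/= divff ?gt_eqF// scale1r.
    by rewrite addrC subrK.
  have w1 : nm w <= 1.
    rewrite nmZ nmC ger0_norm ?invr_ge0 ?(ltW (rho0 j))//.
    by rewrite ler_pdivrMl// mulr1 ltW.
  have h1 := jP w w1; have h0 := jP 0 ltac:(by rewrite nm0).
  rewrite /psi_ scw (cst_ w) in h1; rewrite /psi_ sc0 in h0.
  have := dist_tri dd (psi 0) (h j (x j)) (h j y).
  by rewrite (distC dd (psi 0) (h j y)); clear -h1 h0 dy; lra.
have sub l : exists j, (l <= j)%N /\
    forall y, nm y <= l%:R -> d (psi_ j y) (psi y) < l.+1%:R^-1.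
  have l0 : 0 < l.+1%:R^-1 :> R by rewrite invr_gt0.
  have Ul : U [set j | (l <= j)%N] by apply: Uoo; exact: nbhs_infty_ge.
  by have [j [j1 j2]] := filter_ex (filterI Ul (unif l%:R _ l0)); exists j.
have [s sP] := choice sub.
have le_s l : (s l).+1%:R^-1 <= l.+1%:R^-1 :> R.
  rewrite lef_pV2 ?posrE//; rewrite ler_nat ltnS; by case: (sP l).
exists (h \o s), (x \o s), (rho \o s), psi; split => //.
- move=> l /=; split; first exact: Ph.
    rewrite lt_min -[X in nm (X - _) < a]sc0 sc_in ?nm0 ?addr_ge0 ?ler01 ?(ltW (k0 _))//=.
    apply: lt_le_trans (le_s l).
    apply: (le_lt_trans (xb _)); apply: (lt_le_trans _ (rkj _)).
    by have := mulr_gt0 (k0 (s l)) (r0 (s l)); move: (_ * _) => u; lra.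
  apply/andP; split; first exact: rho0.
  apply: lt_le_trans (le_s l).
  apply: (le_lt_trans (rhor _)); apply: (le_lt_trans (rkr _)).
  apply: (lt_le_trans _ (rkj _)).
  by have := mulr_gt0 (k0 (s l)) (r0 (s l)); move: (_ * _) => u; lra.
move=> M e e1.
exists (maxn (Num.bound `|M|) (Num.bound e^-1)) => // l /=.
rewrite geq_max => /andP[lM le_ ] y yM.
have Ml : nm y <= l%:R.
  apply: (le_trans yM); apply: (le_trans (ler_norm M)).
  apply: (le_trans (ltW (archi_boundP _))) => //.
  by rewrite ler_nat.
have [s1 s2] := sP l; split.
  apply: (sc_in (s l)); rewrite /k.
  have : l%:R <= (s l)%:R :> R by rewrite ler_nat.
  have : (s l)%:R <= (s l).+1%:R :> R by rewrite ler_nat.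
  by lra.
apply: (lt_trans (s2 y Ml)).
rewrite -[ltRHS]invrK ltf_pV2 ?posrE ?invr_gt0//.
apply: (lt_le_trans (archi_boundP _)); first by rewrite invr_ge0 ltW.
by rewrite ler_nat; exact: leqW.
Qed.

End ZalcmanLemma.

(** * Normal families and equicontinuity *)

Section ContSpace.
Context {T N : topologicalType}.
Notation CT := (cont_space T N).

Lemma cont_space_nbhs (f : CT) K O : compact K -> open O ->
  (f : continuousType T N) @` K `<=` O ->
  nbhs f [set g : CT | (g : continuousType T N) @` K `<=` O].
Proof.
move=> cK oO fKO.
pose j (h : continuousType T N) := (h : {compact-open, T -> N}).
have oKO : open ([set g | g @` K `<=` O] : set {compact-open, T -> N}).
  exact: compact_open_open.
apply: (@open_nbhs_nbhs CT); split => //.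
by exists [set g | g @` K `<=` O].
Qed.

Lemma cont_space_cvg (F : set_system CT) (g : CT) : Filter F ->
  (forall K O, compact K -> open O -> (g : continuousType T N) @` K `<=` O ->
    F [set h : CT | (h : continuousType T N) @` K `<=` O]) ->
  F --> g.
Proof.
move=> FF FKO.
pose j (h : continuousType T N) := (h : {compact-open, T -> N}).
have FjF : Filter (fmap j F) by exact: fmap_filter.
have key : fmap j F --> j g.
  by apply/compact_open_cvgP => K O cK oO gKO; exact: FKO.
move=> A [B [[C oC CB] Bg BA]].
have jC : nbhs (j g) C by apply: open_nbhs_nbhs; split => //; move: Bg; rewrite -CB.
have FC : F (j @^-1` C) by exact: key _ jC.
apply: (@filterS _ F FF (j @^-1` C)) FC => h hC; apply: BA; rewrite -CB; exact: hC.
Qed.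

End ContSpace.

Section Equicontinuity.
Context {R : realType} {T N : topologicalType}.
Variable d : N -> N -> R.
Hypotheses (dd : is_distance d) (cN : compact [set: N]).
Notation CT := (cont_space T N).

Lemma dist_open_ball x e : open [set y | d x y < e].
Proof.
rewrite openE => y /= xy; apply/(dist_nbhsP dd); exists (e - d x y).
  by rewrite subr_gt0.
by move=> z /= yz; have := dist_tri dd y x z; lra.
Qed.

(** A compact set of values keeps a positive distance from the complement of
any open set containing it, so uniform closeness on a compact set implies
closeness in the compact-open topology. *)
Lemma dist_compact_open (g : T -> N) K O : continuous g -> compact K -> open O ->
  g @` K `<=` O -> exists2 e : R, 0 < e & forall h : T -> N,
    (forall y, K y -> d (h y) (g y) < e) -> h @` K `<=` O.
Proof.
move=> cg /compact_near_coveringP cK oO gKO.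
have h x : K x -> \forall y \near x & k \near \oo,
    forall z, d z (g y) < k.+1%:R^-1 -> O z.
  move=> Kx; have Ogx : O (g x) by apply: gKO; exists x.
  have [e [e0 eO]] : exists e : R, 0 < e /\ [set y | d (g x) y < e] `<=` O.
    have /(dist_nbhsP dd)[e e0 eO] : nbhs (g x) O by exact: open_nbhs_nbhs.
    by exists e.
  have e2 : 0 < e / 2 by rewrite divr_gt0.
  exists ([set y | d (g x) (g y) < e / 2], [set k : nat | k.+1%:R^-1 < e / 2]) => /=.
    split; last exact: near_infty_natSinv_lt (PosNum e2).
    exact: cg x _ (dist_ball dd (g x) e2).
  move=> [y k] [/= xy k2] z zy; apply: eO => /=.
  have := dist_tri dd (g y) (g x) z; rewrite (distC dd (g y) z).
  by have zy2 : d z (g y) < e / 2 := lt_trans zy k2; lra.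
have := cK _ \oo (fun k y => forall z, d z (g y) < k.+1%:R^-1 -> O z) _ h.
move=> [k _ /(_ k (leqnn k)) kK]; exists k.+1%:R^-1; first by rewrite invr_gt0.
by move=> f fg _ [y Ky <-]; exact: kK (fg y Ky).
Qed.

(** Ascoli's theorem. Equicontinuity passes to the closure, because evaluation
at a point is continuous, and then every ultrafilter on the closure has a
continuous limit. *)
Lemma equicontinuous_normal (F : set CT) :
  (forall x (e : R), 0 < e -> exists2 W, nbhs x W & forall f : CT, F f -> forall y, W y ->
     d ((f : continuousType T N) x) ((f : continuousType T N) y) < e) ->
  normal_family F.
Proof.
move=> eF u Fu; exists id; split => //; left.
rewrite /relatively_compact; set A := range (u \o id).
rewrite compact_ultra => U UU UA.
pose f (h : CT) : T -> N := (h : continuousType T N).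
have [] := @ultra_ascoli R N d dd cN CT U T f UU.
  move=> x e e0; have e3 : 0 < e / 3 by rewrite divr_gt0.
  have [W xW WF] := eF x _ e3; exists W => //.
  apply: filterS UA => h clh y Wy.
  have near1 z : nbhs h [set g : CT | d (f h z) (f g z) < e / 3].
    have O : open [set p | d (f h z) p < e / 3] by exact: dist_open_ball.
    have hO : (h : continuousType T N) @` [set z] `<=` [set p | d (f h z) p < e / 3].
      by move=> _ [_ -> <-] /=; rewrite (dist_refl dd).
    have := cont_space_nbhs (@compact_set1 _ z) O hO.
    by apply: filterS => g /(_ (f g z)) /=; apply; exists z.
  have [g [[k _ gk] [/= g1 g2]]] := clh _ (filterI (near1 x) (near1 y)).
  have := WF g; rewrite -gk => /(_ (Fu k) y Wy); rewrite -/(f _ x) -/(f _ y).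
  move: g1 g2; rewrite -gk.
  have := dist_tri dd (f (u k) x) (f h x) (f h y).
  have := dist_tri dd (f (u k) y) (f (u k) x) (f h y).
  rewrite (distC dd (f (u k) y) (f h y)) /=; clear; lra.
move=> g cg gU.
pose gc : CT := (mkcts cg : continuousType T N).
have Ug : U --> gc.
  apply: cont_space_cvg => K O cK oO gKO.
  have [e e0 eO] := dist_compact_open cg cK oO gKO.
  by apply: filterS (gU K cK e e0) => h; exact: eO.
exists gc; split => //.
apply: closed_closure => B gB.
by have [h [hA hB]] := filter_ex (filterI UA (Ug _ gB)); exists h.
Qed.

End Equicontinuity.

(** * Maps on an open subset of a manifold, read in charts *)

Section OpenSubset.
Context {R : realType} {m n : nat}.
Context {M : complexManifoldType R m} {N : complexManifoldType R n}.
Variables (Omega : set M) (w0 : set_type Omega).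
Hypothesis oO : open Omega.
Implicit Type f : set_type Omega -> N.

Definition to_sub (q : M) : set_type Omega := insubd w0 q.

Lemma to_subK (q : M) : Omega q -> set_val (to_sub q) = q.
Proof. by move=> Oq; rewrite /to_sub set_valE insubdK//; exact: mem_set. Qed.

Lemma set_valK (w : set_type Omega) : to_sub (set_val w) = w.
Proof. by rewrite /to_sub set_valE valKd. Qed.

Lemma omap_to_sub (A : Type) (f : set_type Omega -> A) (q : M) : Omega q ->
  omap f (insub q) = Some (f (to_sub q)).
Proof. by move=> Oq; rewrite /to_sub /insubd; case: insubP => //; rewrite mem_set. Qed.

Lemma to_sub_continuous (q : M) : Omega q ->
  {for q, continuous to_sub}.
Proof.
move=> Oq A [B [[C oC CB] Bq BA]].
have Cq : C q by move: Bq; rewrite -CB /= to_subK.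
have : nbhs q (Omega `&` C) by apply: open_nbhs_nbhs; split => //; exact: openI.
apply: filterS => z [Oz Cz]; apply: BA; rewrite -CB /=.
by rewrite to_subK.
Qed.

Lemma hol_at_to_sub (V : normedModType R[i]) f (g : V -> M) (x : V) :
  holomorphic (sub_atlas Omega (@atlas R m M)) (@atlas R n N) f ->
  hol_at g x -> Omega (g x) -> hol_at (fun y => f (to_sub (g y))) x.
Proof.
move=> [cf df] hg Ogx; have [cg dg] := hg.
have ci : {for x, continuous (fun y => to_sub (g y))}.
  exact: (@continuous_comp _ _ _ g to_sub x cg (to_sub_continuous Ogx)).
split.
  exact: (@continuous_comp _ _ _ (fun y => to_sub (g y)) f x ci (cf _)).
move=> b fb; have [c gc] := exists_chart_around (g x).
pose sc := Chart (set_val @^-1` dom c) (coord c \o @set_val _ Omega).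
have d1 : differentiable (in_chart sc (coord b \o f)) (coord c (g x)).
  have := df sc b (to_sub (g x)).
  rewrite /sc /= to_subK//; apply => //; [|exact: fb.1|exact: gc.2|exact: fb.2].
  by exists c => //; exact: gc.1.
apply: (near_eq_diff _ (differentiable_comp (dg c gc) d1)).1.
have W1 : nbhs x [set y | dom c (g y)] := cg _ (chart_dom_nbhs gc).
have W2 : nbhs x [set y | Omega (g y)] := cg _ (open_nbhs_nbhs (conj oO Ogx)).
apply: filterS (filterI W1 W2) => y [/= cy Oy].
rewrite /in_chart; case: xgetP => [z _ [w [/= cw e] <-]|
    /(_ (coord b (f (to_sub (g y)))))[]]; last first.
  by exists (to_sub (g y)) => //=; rewrite to_subK.
have [_ ic _ _] := atlas_chart _ gc.1.
have E : set_val w = g y by apply: ic => //; rewrite inE.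
by rewrite -E set_valK.
Qed.

Lemma chart_ball (p0 : M) c : Omega p0 -> chart_around p0 c ->
  exists2 a, 0 < a & forall x, nm (x - coord c p0) < a ->
    [/\ chart_around (chart_inv c p0 x) c, coord c (chart_inv c p0 x) = x,
        Omega (chart_inv c p0 x) & hol_at (chart_inv c p0) x].
Proof.
move=> Op pc.
have [a a0 aP] := iffLR (nm_nbhsP _ _)
  (chart_inv_near p0 pc (open_nbhs_nbhs (conj oO Op))).
exists a => // x xa; have [h1 h2 h3] : [/\ chart_around (chart_inv c p0 x) c,
  coord c (chart_inv c p0 x) = x & Omega (chart_inv c p0 x)] by exact: aP.
split => //; rewrite -h2; exact: hol_at_chart_inv.
Qed.

End OpenSubset.

(** * Rescaling along the exponential mapping *)

Section LeftProduct.
Context {R : realType} {m : nat} {G : complexLieGroupType R m}.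
Notation E := 'rV[R[i]]_m.
Notation chart1 := (@chart1 R m G).
Notation lcoord := (@lcoord R m G).
Notation lpt := (@lpt R m G).

(** In coordinates, [x * y - x] differs from its value at [x = p0] by
[O((x - p0) y)]: it is a second difference of the multiplication. *)
Lemma left_product_local (p0 : G) c : chart_around p0 c ->
  exists r K : R, [/\ 0 < r, 0 < K &
    forall x y, nm (x - coord c p0) < r -> nm y < r ->
      chart_around (chart_inv c p0 x * lpt y)%g c /\
      nm (coord c (chart_inv c p0 x * lpt y)%g - x -
        (coord c (p0 * lpt y)%g - coord c p0)) <= K * nm (x - coord c p0) * nm y].
Proof.
move=> pc; set x0 := coord c p0.
have [a a0 aP] := chart_ball openT (I : setT p0) pc.
have [l l0 lP] := @lpt_local R m G.
pose w (p : E * E) := (chart_inv c p0 p.1 * lpt p.2)%g.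
pose b := Num.min a l.
have b0 : 0 < b by rewrite lt_min a0 l0.
have hw p : nm (p - (x0, 0)) < b -> hol_at w p.
  case: p => x y; rewrite /= nm_pair subr0 gt_max !lt_min.
  move=> /andP[/andP[xa _] /andP[_ yl]].
  apply: hol_at_mul; [apply: hol_at_fst|apply: hol_at_snd].
    by have [] := aP _ xa.
  by have [] := lP _ yl.
have i0 : chart_inv c p0 x0 = p0 by exact: chart_invK.
have w00 : w (x0, 0) = p0 by rewrite /w /= i0 lpt0 mulg1.
have cw0 : chart_around (w (x0, 0)) c by rewrite w00.
have n0 : nm ((x0, 0) - (x0, 0) : E * E) < b by rewrite subrr nm0.
have [cw dw] := hw _ n0.
have W1 : nbhs ((x0, 0) : E * E) [set p | dom c (w p)] := cw _ (chart_dom_nbhs cw0).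
have W2 : nbhs ((x0, 0) : E * E) [set p | nm (coord c (w p) - x0) < 1].
  have cL := differentiable_continuous (dw c cw0).
  have h : nbhs ((x0, 0) : E * E)
      [set p | nm (coord c (w p) - coord c (w (x0, 0))) < 1] :=
    cL _ (nm_ball_nbhs ((coord c \o w) (x0, 0)) ltr01).
  by apply: filterS h => x /=; rewrite w00.
have [s s0 sP] := iffLR (nm_nbhsP _ _) (filterI W1 W2).
pose r := Num.min b s; have r0 : 0 < r by rewrite lt_min b0.
have key p : nm (p - (x0, 0)) < r -> [/\ nm (p - (x0, 0)) < b, chart_around (w p) c &
    nm (coord c (w p) - x0) < 1].
  rewrite lt_min => /andP[pb ps]; have [h1 h2] := sP _ ps.
  by split => //; split; [exact: pc.1|exact: h1].
have hol : holo_on (coord c \o w) (x0, 0) r.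
  by move=> p /key[pb pc' _]; exact: (hw _ pb).2.
have bd p : nm (p - (x0, 0)) < r -> nm ((coord c \o w) p) <= nm x0 + 1.
  by move=> /key[_ _ h]; have := nm_le_sub (coord c (w p)) x0; rewrite /=; lra.
have c0 := @cauchy_cst_gt0 R.
have r8 : 0 < r / 8 by rewrite divr_gt0.
have nx := nm_ge0 x0.
exists (r / 8), (4 * cauchy_cst ^+ 2 * (nm x0 + 1) / r ^+ 2); split => //.
  apply: divr_gt0; last exact: exprn_gt0.
  by apply: mulr_gt0; [apply: mulr_gt0; [lra|exact: exprn_gt0]|lra].
move=> x y xr yr.
have xr' : nm (x - x0) < r by lra.
have yr' : nm y < r by lra.
have xyr : nm ((x, y) - (x0, 0) : E * E) < r by rewrite /= nm_pair subr0 gt_max xr' yr'.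
have xr0 : nm ((x, 0) - (x0, 0) : E * E) < r.
  by rewrite /= nm_pair subrr nm0 gt_max xr' r0.
split; first by have [] := key _ xyr.
have := holo_second_difference r0 hol bd (x := (x0, 0)) (a := (x - x0, 0)) (b := (0, y)).
rewrite subrr !nm_pair !nm0 !gt_max xr yr r8 /= => /(_ isT isT isT).
rewrite (max_l (nm_ge0 _)) (max_r (nm_ge0 _)).
rewrite /w /= !addr0 !add0r [x0 + _]addrC subrK lpt0 !mulg1 i0.
have xa : nm (x - x0) < a.
  by move: xr'; rewrite !lt_min -!andbA => /andP[].
by have [_ -> _ _] := aP _ xa; rewrite -/x0 opprB [x0 - _]addrC addrA.
Qed.

(** At [p0] this is the definition of [left_frame] as a differential; the
preceding lemma makes it uniform in the point. *)
Lemma left_product_expansion (ex : E -> G) (e A : R) (p0 : G) c :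
  0 < e -> 0 < A ->
  (forall v, nm v < e -> chart_around (ex v) chart1 /\
     nm (lcoord (ex v) - v) <= A * nm v ^+ 2) ->
  chart_around p0 c ->
  forall eta, 0 < eta -> exists2 s, 0 < s & forall x v,
    nm (x - coord c p0) < s -> nm v < s ->
    chart_around (chart_inv c p0 x * ex v)%g c /\
    nm (coord c (chart_inv c p0 x * ex v)%g - x - left_frame p0 c v) <= eta * nm v.
Proof.
move=> e0 A0 eP pc eta eta0; set x0 := coord c p0.
have [r [K [r0 K0 rP]]] := left_product_local pc.
have ht := hol_at_translate p0.
have tc : chart_around (p0 * lpt 0)%g c by rewrite lpt0 mulg1.
have dt := ht.2 c tc.
have [B B0 BP] := nm_linear (diff_continuous dt).
have eta8 : 0 < eta / 8 by rewrite divr_gt0.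
have [t t0 tP] := nm_diff dt eta8.
pose s := Num.min (Num.min e (r / 2)) (Num.min (Num.min (t / 2) A^-1)
  (Num.min (eta / (8 * K)) (eta / (8 * (B * A))))).
have s0 : 0 < s.
  by rewrite /s !lt_min e0 !divr_gt0 ?invr_gt0 ?A0//= ?mulr_gt0.
exists s => // x v.
rewrite /s !lt_min => /andP[/andP[_ xr] /andP[_ /andP[xK _]]].
move=> /andP[/andP[ve vr] /andP[/andP[vt vA] /andP[_ vB]]].
have [exc exv] := eP v ve.
set y := lcoord (ex v); have ey : lpt y = ex v by exact: lcoordK.
have nv := nm_ge0 v.
have Av : A * nm v <= 1 by rewrite -ler_pdivlMl// mulr1; exact: ltW.
have y2 : nm y <= 2 * nm v.
  have := nm_le_sub y v; have : A * nm v ^+ 2 <= nm v by rewrite expr2 mulrA ler_piMl.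
  by lra.
have xr' : nm (x - x0) < r by lra.
have yr : nm y < r by lra.
have yt : nm (y - 0) < t by rewrite subr0; lra.
have [h1 h2] := rP x y xr' yr; rewrite ey in h1 h2.
split; first exact: h1.
have h3 := tP y yt.
move: h3; rewrite subr0 /= lpt0 mulg1 ey -/x0 => h3.
have h4 := BP (y - v).
set L := 'd (coord c \o (fun y => p0 * lpt y)%g) 0 in h3 h4 *.
have h5 : nm (L y - L v) <= B * (A * nm v ^+ 2).
  rewrite -linearB; apply: (le_trans h4); rewrite ler_pM2l//.
have h6 : K * nm (x - x0) * nm y <= eta / 4 * nm v.
  have h : K * nm (x - x0) <= eta / 8.
    rewrite mulrC -ler_pdivlMr//; apply: (le_trans (ltW xK)).
    by rewrite invfM mulrA.
  apply: (@le_trans _ _ (eta / 8 * nm y)); first by rewrite ler_wpM2r ?nm_ge0.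
  have : eta / 8 * nm y <= eta / 8 * (2 * nm v) by rewrite ler_wpM2l//; exact: ltW.
  by move: (nm v) (nm y) => a b; lra.
have h7 : B * (A * nm v ^+ 2) <= eta / 8 * nm v.
  have h : nm v * (B * A) <= eta / 8.
    by rewrite -ler_pdivlMr ?mulr_gt0//; apply: (le_trans (ltW vB)); rewrite invfM mulrA.
  by rewrite expr2 !mulrA ler_wpM2r// mulrC.
have h8 : eta / 8 * nm y <= eta / 4 * nm v.
  have : eta / 8 * nm y <= eta / 8 * (2 * nm v) by rewrite ler_wpM2l//; exact: ltW.
  by move: (nm v) (nm y) => a b; lra.
rewrite /left_frame -/L; move: h2 h3 h5.
set P := coord c _; set Q := coord c _ => h2 h3 h5.
have := nm_tri (Q - x0) (P - x) (L v).
have := nm_tri (L y) (Q - x0) (L v).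
have := mulr_ge0 (ltW eta0) nv.
move: (nm (P - x - L v)) (nm (P - x - (Q - x0))) (nm (Q - x0 - L v)) (nm (Q - x0 - L y))
  (nm (L y - L v)) h2 h3 h5 h6 h7 h8 => a1 a2 a3 a4 a5.
move: (K * _ * _) (eta / 8 * nm y) (B * _) => b1 b2 b3.
clear; move: (nm v) => u; lra.
Qed.

End LeftProduct.

Section Rescaling.
Context {R : realType} {m : nat} {G : complexLieGroupType R m}.
Notation E := 'rV[R[i]]_m.
Notation chart1 := (@chart1 R m G).
Implicit Type eps : 'I_m -> tangent (1%g : G).

Definition basis_matrix eps : 'M[R[i]]_m := \matrix_k eps k chart1.

Lemma lin_comb_chart1 eps z : lin_comb eps z chart1 = z *m basis_matrix eps.
Proof.
rewrite /lin_comb mulmx_sum_row.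
rewrite (big_morph (fun v : tangent (1%g : G) => v chart1) (id1 := 0) (op1 := +%R))//.
by apply: eq_bigr => k _; rewrite rowK.
Qed.

Lemma mulmx_nm (A : 'M[R[i]]_m) : exists2 K : R, 0 < K &
  forall z : E, nm (z *m A) <= K * nm z.
Proof.
pose K := \sum_j \sum_k nm (A k j).
have Kj0 j : 0 <= \sum_k nm (A k j) by apply: sumr_ge0 => k _; exact: nm_ge0.
have K0 : 0 <= K by apply: sumr_ge0 => j _; exact: Kj0.
exists (K + 1); first by lra.
have nm_sum (F : 'I_m -> R[i]) : nm (\sum_k F k) <= \sum_k nm (F k).
  elim/big_rec2: _ => [|k y u _ yu]; first by rewrite nm0.
  by apply: (le_trans (nmD _ _)); rewrite lerD2l.
move=> z; apply: nm_row_le => [|j]; first by apply: mulr_ge0; [lra|exact: nm_ge0].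
rewrite mxE; apply: (le_trans (nm_sum _)).
apply: (@le_trans _ _ (\sum_k nm (A k j) * nm z)).
  apply: ler_sum => k _; rewrite nmM mulrC; apply: ler_wpM2l; first exact: nm_ge0.
  exact: nm_coord.
rewrite -mulr_suml; apply: ler_wpM2r; first exact: nm_ge0.
apply: (@le_trans _ _ K); last by lra.
rewrite /K [leRHS](bigD1 j)//=; apply: ler_wpDr => //.
by apply: sumr_ge0 => i _; exact: Kj0.
Qed.

(** [T] is the linear automorphism of [C^m] between coordinates with respect to
the basis and the chart [c]. Limits of rescalings in the chart and limits of
rescalings along the exponential mappings differ by [T]. *)
Lemma frame_basis (p0 : G) c eps : chart_around p0 c -> is_basis eps ->
  exists T : E -> E, [/\ forall z, T z = left_frame p0 c (z *m basis_matrix eps),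
    forall u, exists z, T z = u, forall z, differentiable T z &
    exists2 K : R, 0 < K & forall z, nm (T z) <= K * nm z].
Proof.
move=> pc [free _]; set B := basis_matrix eps.
have ht := hol_at_translate p0.
have tc : chart_around (p0 * @lpt R m G 0)%g c by rewrite lpt0 mulg1.
have [K1 K10 K1P] := nm_linear (diff_continuous (ht.2 c tc)).
have [K2 K20 K2P] := mulmx_nm B.
have Tlin a u v : left_frame p0 c ((a *: u + v) *m B) =
    a *: left_frame p0 c (u *m B) + left_frame p0 c (v *m B).
  by rewrite mulmxDl -scalemxAl; exact: linearP.
have [T TE] := linear_of Tlin.
have K12 : 0 < K1 * K2 by exact: mulr_gt0.
have TK z : nm (T z) <= K1 * K2 * nm z.
  by rewrite TE; apply: (le_trans (K1P _)); rewrite -mulrA ler_pM2l.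
exists T; split => //; last by exists (K1 * K2).
  have inj z : T z = 0 -> z = 0.
    move=> T0; have zB : z *m B = 0.
      apply: (left_frame_inj pc).
      rewrite -TE T0 /left_frame; exact/esym/linear0.
    apply: free; apply: (tangent_eq (@chart1P R m G)).
    by rewrite lin_comb_chart1.
  have unit_T : lin1_mx T \in unitmx.
    by rewrite -row_free_unit; apply: inj_row_free => v; rewrite mul_rV_lin1 => /inj.
  by move=> u; exists (u *m invmx (lin1_mx T)); rewrite -mul_rV_lin1 mulmxKV.
move=> z; apply: (@nm_differentiable R _ _ T z T (K1 * K2) TK _).1 => e e0.
exists 1 => // y _; rewrite -!linearB /= subrr linear0 nm0.
by apply: mulr_ge0; [exact: ltW|exact: nm_ge0].
Qed.

(** The mappings that are rescaled in the theorem are, in a chart, affine up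
to an error that is small compared to the scale. *)
Lemma exp_at_expansion (p0 : G) c eps : chart_around p0 c ->
  forall M eta, 0 < eta -> exists2 s, 0 < s & forall x (rho : R) z,
    nm (x - coord c p0) < s -> 0 < rho < s -> nm z <= M ->
    let q := exp_at (rho%:C *: dL_at1 (chart_inv c p0 x) (lin_comb eps z)) in
    chart_around q c /\
    nm (coord c q - (x + rho%:C *: left_frame p0 c (z *m basis_matrix eps)))
      <= eta * rho.
Proof.
move=> pc M eta eta0.
have [ex [e [A [e0 A0 eP exM]]]] := @exp_at_lie_exp R m G.
have [K K0 KP] := mulmx_nm (basis_matrix eps).
pose b := K * `|M| + 1.
have b0 : 0 < b by rewrite /b; have := mulr_ge0 (ltW K0) (normr_ge0 M); lra.
have eb0 : 0 < eta / b by rewrite divr_gt0.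
have [s s0 sP] := left_product_expansion e0 A0 eP pc eb0.
exists (Num.min s (s / b)); first by rewrite lt_min s0 divr_gt0.
move=> x rho z; rewrite !lt_min => /andP[xs _] /andP[rho0 /andP[_ rhos]] zM /=.
rewrite exM lin_comb_chart1; set w := z *m _.
have wb : nm w <= b.
  apply: (le_trans (KP z)); rewrite /b.
  have : K * nm z <= K * `|M| by rewrite ler_pM2l// (le_trans zM)// ler_norm.
  by lra.
have vE : nm (rho%:C *: w) = rho * nm w by rewrite nmZ nmC ger0_norm// ltW.
have vs : nm (rho%:C *: w) < s.
  rewrite vE; apply: (@le_lt_trans _ _ (rho * b)); first by rewrite ler_pM2l.
  by rewrite -ltr_pdivlMr.
have [h1 h2] := sP x _ xs vs; split => //.
have lE : left_frame p0 c (rho%:C *: w) = rho%:C *: left_frame p0 c w.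
  exact: linearZ.
rewrite lE vE in h2; rewrite opprD addrA; apply: (le_trans h2).
have h3 : rho * nm w <= rho * b by rewrite ler_pM2l.
have := ler_wpM2l (ltW eb0) h3.
by rewrite (mulrC rho b) [leRHS]mulrA (divfK (lt0r_neq0 b0)).
Qed.

End Rescaling.

Section RescaledMaps.
Context {R : realType} {m n : nat}.
Context {G : complexLieGroupType R m} {N : complexManifoldType R n}.
Notation E := 'rV[R[i]]_m.
Variable d : N -> N -> R.
Hypotheses (dd : is_distance d).
Variables (Omega : set G) (w0 : set_type Omega).
Hypothesis oO : open Omega.
Implicit Type eps : 'I_m -> tangent (1%g : G).

Lemma continuous_unif_bounded (psi : E -> N) M e : continuous psi -> 0 < e ->
  exists2 t, 0 < t & forall u v, nm v <= M -> nm (u - v) < t ->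
    d (psi u) (psi v) < e.
Proof.
move=> cpsi e0; have /compact_near_coveringP cov := @ball_compact R m M.
have e2 : 0 < e / 2 by rewrite divr_gt0.
have h x : [set v : E | nm v <= M] x -> \forall v \near x & k \near \oo,
    forall u, nm (u - v) < k.+1%:R^-1 -> d (psi u) (psi v) < e.
  move=> _; have [r r0 rP] := iffLR (nm_nbhsP x _) (cpsi x _ (dist_ball dd (psi x) e2)).
  have r2 : 0 < r / 2 by rewrite divr_gt0.
  exists ([set v | nm (v - x) < r / 2], [set k : nat | k.+1%:R^-1 < r / 2]) => /=.
    split; first exact: nm_ball_nbhs.
    exact: near_infty_natSinv_lt (PosNum r2).
  move=> [v k] [/= vx k2] u uv; have uv2 : nm (u - v) < r / 2 := lt_trans uv k2.
  have ux : nm (u - x) < r by have := nm_tri v u x; lra.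
  have vx' : nm (v - x) < r by lra.
  have := rP u ux; have := rP v vx'; have := dist_tri dd (psi x) (psi u) (psi v).
  by rewrite (distC dd (psi u) (psi x)) /=; lra.
have := cov _ \oo (fun k v => forall u, nm (u - v) < k.+1%:R^-1 ->
  d (psi u) (psi v) < e) _ h.
move=> [k _ /(_ k (leqnn k)) kP]; exists k.+1%:R^-1; first by rewrite invr_gt0.
by move=> u v vM; exact: kP.
Qed.

(** In the chart the exponential mappings are [x j + rho j (T z + o(1))], so
their rescalings are those of the chart at the arguments [T z + o(1)]; the
error is absorbed by the uniform continuity of [psi]. *)
Lemma rescaled_cvg (f : nat -> continuousType (set_type Omega) N) (p0 : G) c eps a
    (T : E -> E) (x : nat -> E) (rho : nat -> R) (psi : E -> N) :
  chart_around p0 c ->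
  (forall v, nm (v - coord c p0) < a -> Omega (chart_inv c p0 v)) ->
  (forall z, T z = left_frame p0 c (z *m basis_matrix eps)) ->
  (exists2 K : R, 0 < K & forall z, nm (T z) <= K * nm z) ->
  continuous psi ->
  (forall e, 0 < e -> \forall j \near \oo,
     nm (x j - coord c p0) < e /\ 0 < rho j < e) ->
  (forall M e, 0 < e -> \forall j \near \oo, forall y, nm y <= M ->
     nm (x j + (rho j)%:C *: y - coord c p0) < a /\
     d (f j (to_sub w0 (chart_inv c p0 (x j + (rho j)%:C *: y)))) (psi y) < e) ->
  locally_uniform_cvg d (fun j z => omap (f j)
    (insub (exp_at ((rho j)%:C *: dL_at1 (chart_inv c p0 (x j)) (lin_comb eps z)))))
    (psi \o T).
Proof.
move=> pc aO TE [K K0 TK] cpsi small cvg_ S cS e e0.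
have [Mz MzP] := @compact_nm_bounded R E E id S cS (fun p _ => @cvg_id _ _).
have e2 : 0 < e / 2 by rewrite divr_gt0.
pose M := K * `|Mz| + 1.
have [t t0 tP] := continuous_unif_bounded M cpsi e2.
pose eta := Num.min (t / 2) 1.
have eta0 : 0 < eta by rewrite lt_min divr_gt0 ?ltr01.
have etat : eta < t by rewrite gt_min; apply/orP; left; lra.
have eta1 : eta <= 1 by rewrite ge_min lexx orbT.
have [s s0 sP] := @exp_at_expansion R m G p0 c eps pc Mz eta eta0.
apply: filterS2 (small s s0) (cvg_ M _ e2) => j [js rs] jP z Sz.
have zM := MzP z Sz; have [qc qE] := sP (x j) (rho j) z js rs zM.
move: qc qE; set q := exp_at _ => qc qE.
have /andP[r0 _] := rs.
pose w := (rho j)^-1%:C *: (coord c q - x j).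
have wE : x j + (rho j)%:C *: w = coord c q.
  by rewrite /w scalerA -rmorphM/= divff ?gt_eqF// scale1r addrC subrK.
have wT : nm (w - T z) <= eta.
  rewrite -(ler_pM2l r0) -[X in X * nm _](ger0_norm (ltW r0)) -nmC -nmZ scalerBr.
  have -> : (rho j)%:C *: w = coord c q - x j by rewrite -wE addrC addKr.
  by rewrite mulrC TE -addrA -opprD.
have TzM : nm (T z) <= K * `|Mz|.
  by apply: (le_trans (TK z)); rewrite ler_pM2l// (le_trans zM)// ler_norm.
have wM : nm w <= M by rewrite /M; have := nm_le_sub w (T z); lra.
have [qa qd] := jP w wM; rewrite wE in qa qd.
have Oq : Omega q by have := aO _ qa; rewrite chart_invK.
exists (f j (to_sub w0 q)); first exact: omap_to_sub.
rewrite chart_invK// in qd.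
have TM : nm (T z) <= M by rewrite /M; lra.
have := tP w (T z) TM (le_lt_trans wT etat).
by have := dist_tri dd (psi w) (f j (to_sub w0 q)) (psi (T z)); rewrite /=; lra.
Qed.

(** The rescaled points converge to [p0], and on a compact neighbourhood of
[p0] on which [g] is close to [g p0] so are some far terms of the sequence. *)
Lemma rescaled_limit_constant (u : nat -> cont_space (set_type Omega) N)
    (g : cont_space (set_type Omega) N) (p : nat -> G) (p0 : G) eps
    (rho : nat -> R) (phi : E -> N) : Omega p0 ->
  (forall B, nbhs g B -> forall l, exists2 j, (l <= j)%N & B (u j)) ->
  p @ \oo --> p0 -> (forall j, 0 < rho j) -> rho @ \oo --> (0 : R) ->
  locally_uniform_cvg d (fun j z => omap (u j : continuousType _ _)
    (insub (exp_at ((rho j)%:C *: dL_at1 (p j) (lin_comb eps z))))) phi ->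
  forall z, phi z = (g : continuousType _ _) (to_sub w0 p0).
Proof.
move=> Op0 gu pp0 rho0 rho_ cphi z.
pose gf : set_type Omega -> N := (g : continuousType _ _).
have cgf : continuous gf by exact: cts_fun.
set w := to_sub w0 p0; rewrite -/(gf w).
apply: (dist_eq0 dd); apply/eqP; rewrite eq_le (dist_ge0 dd) andbT.
apply/ler_addgt0Pl => e e0; rewrite addr0.
have e2 : 0 < e / 2 by rewrite divr_gt0.
have [c pc] := exists_chart_around p0; set x0 := coord c p0.
have [a a0 aP] := chart_ball oO Op0 pc.
pose P (v : E) : set_type Omega := to_sub w0 (chart_inv c p0 (x0 + v)).
have cP v : nm v < a -> {for v, continuous P}.
  move=> va; have : nm (x0 + v - x0) < a by rewrite addrC addKr.
  move=> /aP[_ _ Ov hv].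
  have ca : {for v, continuous (fun v => chart_inv c p0 (x0 + v))}.
    apply: (@continuous_comp _ _ _ (fun v => x0 + v) (chart_inv c p0)); last exact: hv.1.
    apply/nm_continuousP => e1 e10; exists e1 => // y.
    by rewrite opprD addrACA subrr add0r.
  exact: (@continuous_comp _ _ _ (fun v => chart_inv c p0 (x0 + v)) (to_sub w0) v ca
    (to_sub_continuous oO Ov)).
have P0 : P 0 = w by rewrite /P addr0 chart_invK.
have W : nbhs (0 : E) [set v | d (gf w) (gf (P v)) < e / 2].
  have a0' : nm (0 : E) < a by rewrite nm0.
  have cgP : {for 0, continuous (gf \o P)} by apply: continuous_comp; [exact: cP|exact: cgf].
  by have := cgP _ (dist_ball dd (gf (P 0)) e2); rewrite P0.
have [b1 b10 b1P] := iffLR (nm_nbhsP _ _) W.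
pose b := Num.min a b1 / 2.
have m0 : 0 < Num.min a b1 by rewrite lt_min a0.
have b0 : 0 < b by rewrite divr_gt0.
have [ba bb1] : b < a /\ b < b1.
  have h1 : Num.min a b1 <= a by rewrite ge_min lexx.
  have h2 : Num.min a b1 <= b1 by rewrite ge_min lexx orbT.
  by rewrite /b; split; lra.
pose K := P @` [set v | nm v <= b].
have cK : compact K.
  apply: continuous_compact; last exact: ball_compact.
  apply: continuous_in_subspaceT => v; rewrite inE /= => vb.
  by apply: cP; lra.
have gK : gf @` K `<=` [set y | d (gf w) y < e / 2].
  by move=> _ [_ [v vb <-] <-]; apply: b1P; rewrite subr0; rewrite /= in vb; lra.
have gB := cont_space_nbhs cK (@dist_open_ball R N d dd (gf w) (e / 2)) gK.
have [s s0 sP] := @exp_at_expansion R m G p0 c eps pc (nm z) 1 ltr01.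
set t0 := nm (left_frame p0 c (z *m basis_matrix eps)).
have t00 : 0 <= t0 by exact: nm_ge0.
have t1 : 0 < t0 + 1 by lra.
pose r1 := Num.min s (b / 2 / (t0 + 1)).
have r10 : 0 < r1 by rewrite lt_min s0 !divr_gt0.
pose r2 := Num.min s (b / 2).
have r20 : 0 < r2 by rewrite lt_min s0 !divr_gt0.
have N1 : \forall j \near \oo, chart_around (p j) c.
  have h : \forall j \near \oo, dom c (p j) := pp0 _ (chart_dom_nbhs pc).
  by apply: filterS h => j; split => //; exact: pc.1.
have N2 : \forall j \near \oo, nm (coord c (p j) - x0) < r2.
  have pA : nbhs p0 [set q | nm (coord c q - coord c p0) < r2].
    exact: chart_continuous pc _ (nm_ball_nbhs (coord c p0) r20).
  exact: pp0 _ pA.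
have N3 : \forall j \near \oo, rho j < r1.
  have h : \forall j \near \oo, ball (0 : R) r1 (rho j).
    exact: rho_ _ (nbhsx_ballx (0 : R) r1 r10).
  apply: filterS h => j; by rewrite /ball /= sub0r normrN gtr0_norm.
have N4 := cphi _ (@compact_set1 _ z) _ e2.
have [l _ lP] : \forall j \near \oo, [/\ chart_around (p j) c,
    nm (coord c (p j) - x0) < r2, rho j < r1 & exists2 y,
      omap (u j : continuousType _ _)
        (insub (exp_at ((rho j)%:C *: dL_at1 (p j) (lin_comb eps z)))) = Some y &
      d y (phi z) < e / 2].
  by apply: filterS (filterI (filterI N1 N2) (filterI N3 N4)) =>
    j [[j1 j2] [j3 j4]]; split => //; exact: (j4 z erefl).
have [j lj Bj] := gu _ gB l.
have [pjc pjr rr [y yE yd]] := lP j lj.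
move: pjr rr; rewrite !lt_min => /andP[ps pb] /andP[rs rb].
have rss : 0 < rho j < s by rewrite rho0.
have [] := sP (coord c (p j)) (rho j) z ps rss (lexx _).
rewrite (chart_invK p0 pjc); set q := exp_at _ in yE * => qc.
rewrite mul1r => qE.
have qb : nm (coord c q - x0) <= b.
  have h1 : nm ((rho j)%:C *: left_frame p0 c (z *m basis_matrix eps)) = rho j * t0.
    by rewrite nmZ nmC ger0_norm// ltW.
  have h2 : rho j * (t0 + 1) < b / 2 by rewrite -ltr_pdivlMr.
  rewrite opprD addrA in qE.
  have := nm_le_sub (coord c q - coord c (p j))
    ((rho j)%:C *: left_frame p0 c (z *m basis_matrix eps)).
  have := nm_tri (coord c (p j)) (coord c q) x0.
  by move: qE; rewrite h1; lra.
have qa : nm (coord c q - x0) < a by lra.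
have Oq : Omega q by have [_ _ + _] := aP _ qa; rewrite chart_invK.
have Kq : K (to_sub w0 q).
  by exists (coord c q - x0) => //; rewrite /P addrC subrK chart_invK.
have uq : d (gf w) ((u j : continuousType _ _) (to_sub w0 q)) < e / 2.
  by apply: Bj; exists (to_sub w0 q).
move: yE; rewrite (omap_to_sub w0)// => -[yE]; rewrite -yE in yd.
set y' := (u j : continuousType _ _) (to_sub w0 q) in yd uq *.
have := dist_tri dd y' (phi z) (gf w).
rewrite (distC dd (phi z) y') (distC dd y' (gf w)).
by move: yd uq => /=; lra.
Qed.

End RescaledMaps.

Theorem theorem1p1 (R : realType) (m n : nat)
    (G : complexLieGroupType R m) (Omega : set G)
    (eps : 'I_m -> tangent (1%g : G))
    (N : hermitianManifoldType R n) (d : N -> N -> R)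
    (F : set (cont_space (set_type Omega) N))
    (domain_Omega : is_domain Omega)
    (basis_eps : is_basis eps)
    (compact_N : compact [set: N])
    (distance_d : is_distance d)
    (holo_F : forall f : continuousType (set_type Omega) N, F f ->
       holomorphic (sub_atlas Omega (@atlas R m G)) (@atlas R n N) f) :
  ~ normal_family F <->
  exists (f : nat -> continuousType (set_type Omega) N)
         (p : nat -> G) (p0 : G) (rho : nat -> R),
    [/\ forall j, F (f j),
        (forall j, Omega (p j)) /\ (Omega p0 /\ p @ \oo --> p0),
        (forall j, 0 < rho j) /\ rho @ \oo --> (0 : R) &
        exists phi : 'rV[R[i]]_m -> N,
          [/\ holomorphic (id_atlas 'rV[R[i]]_m) (@atlas R n N) phi,
              exists z w, phi z <> phi w &
              locally_uniform_cvg d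
                (fun j z =>
                   omap (f j) (insub
                     (exp_at ((rho j)%:C *: dL_at1 (p j) (lin_comb eps z)))))
                phi]].
Proof.
have [oO _ _] := domain_Omega.
pose E := 'rV[R[i]]_m.
split=> [not_normal|].
  have [w [e [e0 wP]]] : exists (w : set_type Omega) (e : R), 0 < e /\
      forall W, nbhs w W -> exists f : continuousType (set_type Omega) N,
        exists2 y, W y & F f /\ e <= d (f w) (f y).
    apply: contrapT => nex; apply: not_normal.
    apply: (equicontinuous_normal distance_d compact_N) => w e e0.
    apply: contrapT => nW; apply: nex; exists w, e; split => // W wW.
    apply: contrapT => nf; apply: nW; exists W => // f Ff y Wy.
    by rewrite ltNge; apply/negP => fe; apply: nf; exists f, y.
  pose p0 : G := set_val w; have Op0 : Omega p0 by exact: set_valP.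
  have p0w : to_sub w p0 = w by exact: set_valK.
  have [c pc] := exists_chart_around p0; set x0 := coord c p0.
  have [a a0 aP] := chart_ball oO Op0 pc.
  pose H (f : continuousType (set_type Omega) N) (x : E) : N :=
    f (to_sub w (chart_inv c p0 x)).
  have i0 : chart_inv c p0 x0 = p0 by exact: chart_invK.
  have [||h [x [rho [psi [hP hpsi [z0 [z1 z01]] cvg_]]]]] :=
      @zalcman R m n N d distance_d compact_N
        [set h | exists2 f, F f & h = H f] x0 a a0.
  - move=> _ [f Ff ->] x xa; have [_ _ Ox hx] := aP x xa.
    exact: (hol_at_to_sub w oO (holo_F f Ff) hx Ox).
  - exists e => // r r0.
    pose V := [set q | dom c q] `&` [set q | nm (coord c q - x0) < r].
    have pV : nbhs p0 V.
      apply: filterI; first exact: chart_dom_nbhs.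
      exact: chart_continuous pc _ (nm_ball_nbhs (coord c p0) r0).
    have wV : nbhs w (set_val @^-1` V) by exact: initial_continuous pV.
    have [f [y [/= yc yr] [Ff fe]]] := wP _ wV.
    exists (H f); first by exists f.
    exists (coord c (set_val y)) => //.
    have yc' : chart_around (set_val y) c by split => //; exact: pc.1.
    by rewrite /H i0 p0w (chart_invK p0 yc') set_valK.
  have fH j : exists f, F f /\ h j = H f by have [[f Ff ->] _ _] := hP j; exists f.
  have [f fP] := choice fH.
  have xa j : nm (x j - x0) < a.
    by have [_ + _] := hP j; rewrite lt_min => /andP[].
  have xj j : nm (x j - x0) < j.+1%:R^-1.
    by have [_ + _] := hP j; rewrite lt_min => /andP[].
  have rho0 j : 0 < rho j by have [_ _ /andP[]] := hP j.
  have rhoj j : rho j < j.+1%:R^-1 by have [_ _ /andP[]] := hP j.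
  have small r : 0 < r -> \forall j \near \oo, nm (x j - x0) < r /\ 0 < rho j < r.
    move=> r0; apply: filterS (near_infty_natSinv_lt (PosNum r0)) => j /= jr.
    by rewrite rho0 (lt_trans (rhoj j) jr) (lt_trans (xj j) jr).
  have [T [TE Tsurj dT TK]] := frame_basis pc basis_eps.
  exists f, (fun j => chart_inv c p0 (x j)), p0, rho; split.
  - by move=> j; have [] := fP j.
  - split; first by move=> j; have [] := aP _ (xa j).
    split => // A pA.
    have [r r0 rP] := iffLR (nm_nbhsP _ _) (chart_inv_near p0 pc pA).
    by apply: filterS (small r r0) => j [jr _]; have [] := rP _ jr.
  - split => //; apply/cvgrPdist_lt => r r0.
    apply: filterS (small r r0) => j [_ /andP[_ jr]].
    by rewrite sub0r normrN gtr0_norm.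
  exists (psi \o T); split.
  - by apply/holomorphic_hol_at => z; apply: hol_at_comp (dT z) _; exact: hpsi.
  - have [[u0 Tu0] [u1 Tu1]] := (Tsurj z0, Tsurj z1).
    by exists u0, u1; rewrite /= Tu0 Tu1.
  apply: (rescaled_cvg distance_d (w0 := w) (a := a) pc _ TE TK).
  - by move=> v va; have [] := aP v va.
  - by move=> z; have [] := hpsi z.
  - exact: small.
  move=> M r r0; apply: filterS (cvg_ M r r0) => j jP y yM.
  have [h1 h2] := jP y yM; split => //.
  by move: h2; have [_ ->] := fP j.
move=> [f [p [p0 [rho [Ff [Op [Op0 pp0]] [rho0 rho_] [phi [_ [z [w zw]] cphi]]]]]]].
move=> /(_ (fun j => (f j : cont_space _ _)) Ff)[s [s_incr]].
have s_ge j : (j <= s j)%N.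
  by elim: j => // j IH; apply: leq_ltn_trans IH _; exact: s_incr.
pose w0 : set_type Omega := SigSub (mem_set Op0).
case=> [rc|cd]; last first.
  (* the values at the point [w0] never leave the compact set [N] *)
  have [l _ lP] := cd [set w0] setT (@compact_set1 _ w0) compact_N.
  have : (f (s l) @` [set w0] `&` setT) (f (s l) w0) by split => //; exists w0.
  by rewrite (lP l (leqnn l)).
have [g [_ gP]] : closure (range ((fun j => (f j : cont_space (set_type Omega) N)) \o s))
    `&` cluster (fmap ((fun j => (f j : cont_space (set_type Omega) N)) \o s) \oo) !=set0.
  apply: rc; apply: filterS (filterT : (\oo : set_system nat) setT) => j _ /=.
  by apply: subset_closure; exists j.
have gu B : nbhs g B -> forall l, exists2 j, (l <= j)%N & B (f j).
  move=> gB l.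
  have tail : fmap ((fun j => (f j : cont_space (set_type Omega) N)) \o s) \oo
      [set h | exists2 j, (l <= j)%N & h = f j].
    exists l => // j /= lj; exists (s j) => //; exact: leq_trans (s_ge j).
  by have [h [[j lj ->] Bj]] := gP _ _ tail gB; exists j.
have cst_ := @rescaled_limit_constant R m n G N d distance_d Omega w0 oO _ g p p0 eps rho phi Op0 gu pp0 rho0 rho_ cphi.
by apply: zw; rewrite !cst_.
Qed.
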